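(* Let $X$ be the AR(2)-process with coefficients $(a_1,a_2)\in\mathbb{R}^2$, and assume $Y_1$ is Gaussian with mean zero and positive variance. Then: (1) $\lim_{N\to\infty}p_N=p_\infty>0$ exists if and only if $(a_1,a_2)\in C$; (2) $p_N\sim cN^{-1}$ for some constant $c>0$ if and only if $(a_1,a_2)=(0,1)$, and $p_N\asymp N^{-1/4}$ if and only if $(a_1,a_2)=(2,-1)$; (3) $p_N=N^{-1/2+o(1)}$ if and only if $(a_1,a_2)\in P$ and $|a_2|<1$; (4) $p_N\precsim e^{-\lambda N}$ for some $\lambda>0$ if and only if $(a_1,a_2)\in E$.
   Context: Let $(Y_n)_{n\ge1}$ be i.i.d. The AR(2)-process is $X_n=a_1X_{n-1}+a_2X_{n-2}+Y_n$ for $n\ge1$ with $X_n=0$ for $n\le0$; $p_N:=\mathbb{P}(\sup_{n=1,\dots,N}X_n\le0)$. Regions: $C:=\{a_1\ge2,\ a_1^2+4a_2>0\}\cup\{a_1\in(0,2),\ a_1+a_2>1\}\cup\{a_1^2+4a_2=0,\ a_1>2\}\cup\{a_1=0,\ a_2>1\}$; $P:=\{a_1+a_2=1,\ a_2\in[-1,1]\}$; $E:=\mathbb{R}^2\setminus(C\cup P)$. $f\sim g$ means $f/g\to1$; $f\precsim g$ means $\limsup f/g<\infty$; $f\asymp g$ means $f\precsim g$ and $g\precsim f$. *)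

(* Defs.v *)
From HB Require Import structures.
From mathcomp Require Import all_boot all_order all_algebra.
From mathcomp Require Import all_classical all_reals all_analysis.
Set Implicit Arguments. Unset Strict Implicit. Unset Printing Implicit Defensive.
Import Order.TTheory GRing.Theory Num.Theory.
Import numFieldNormedType.Exports.
Local Open Scope classical_set_scope.
Local Open Scope ring_scope.

Section defs.
Context {R : realType} (d : measure_display) (T : measurableType d)
        (P : probability T R).

Definition indep_pos (Y : nat -> {RV P >-> R}) : Prop :=
  forall (I : seq nat) (B : nat -> set R),
    uniq I -> (forall i, i \in I -> (0 < i)%N) ->
    (forall i, i \in I -> measurable (B i)) ->
    P (\bigcap_(i in [set i | i \in I]) (Y i @^-1` B i)) =
    (\prod_(i <- I) P (Y i @^-1` B i))%E.

(** Each Y n (n >= 1) has law N(0, sigma^2) (hence the Y n are identically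
    distributed). [normal_prob m s] is the normal law with mean m and
    standard deviation s. *)
Definition gaussian_pos (Y : nat -> {RV P >-> R}) (sigma : R) : Prop :=
  forall n, (0 < n)%N -> forall A : set R, measurable A ->
    distribution P (Y n) A = normal_prob 0 sigma A.

(** AR(2): pair (X_{n-1}, X_n), with X_n = 0 for n <= 0. *)
Fixpoint ar2_pair (a1 a2 : R) (Y : nat -> T -> R) (w : T) (n : nat) : R * R :=
  match n with
  | 0 => (0, 0)
  | n'.+1 => let xx := ar2_pair a1 a2 Y w n' in
             (xx.2, a1 * xx.2 + a2 * xx.1 + Y n'.+1 w)
  end.

Definition ar2 (a1 a2 : R) (Y : nat -> T -> R) (n : nat) (w : T) : R :=
  (ar2_pair a1 a2 Y w n).2.

Definition persist_prob (a1 a2 : R) (Y : nat -> T -> R) (N : nat) : R :=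
  fine (P [set w | forall n, (1 <= n <= N)%N -> ar2 a1 a2 Y n w <= 0]).

End defs.

(** f ≾ g : limsup f/g < oo, i.e. f/g is eventually bounded above. *)
Definition precsim {R : realType} (f g : nat -> R) : Prop :=
  exists M : R, \forall N \near \oo, f N / g N <= M.

Definition asymp {R : realType} (f g : nat -> R) : Prop :=
  precsim f g /\ precsim g f.

Section regions.
Context {R : realType}.
Definition regionC (a1 a2 : R) : Prop :=
  (2 <= a1 /\ 0 < a1 ^+ 2 + 4 * a2)
  \/ (0 < a1 < 2 /\ 1 < a1 + a2)
  \/ (a1 ^+ 2 + 4 * a2 = 0 /\ 2 < a1)
  \/ (a1 = 0 /\ 1 < a2).
Definition regionP (a1 a2 : R) : Prop :=
  a1 + a2 = 1 /\ -1 <= a2 <= 1.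
Definition regionE (a1 a2 : R) : Prop :=
  ~ regionC a1 a2 /\ ~ regionP a1 a2.
End regions.

(* Main.v *)
(* Everything is transported to the law of an i.i.d. sequence on [nat -> R].  If the
   characteristic roots are real, [a1 = s1 + s2] and [a2 = - s1 s2], then
   [W_n = X_n - s2 X_(n-1)] is the AR(1) process with parameter [s1]; so [W <= 0] implies
   [X <= 0] when [s2 >= 0], and conversely when [s2 <= 0].

   Region C: one forces [X] below a geometrically decreasing barrier with positive
   probability.  Region E: without a positive root a nonnegative combination of [K]
   consecutive innovations must be nonpositive in every block; stable real roots are
   treated with a Lyapunov function; roots [al >= 1], [-be < -al] by anticoncentration,
   since [X <= 0] makes the AR(1) process with parameter [-be] smaller in absolute value
   than the one with parameter [al].

   (0,1): two independent interleaved random walks, for which the Sparre Andersen argument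
   gives the exact probability C(2n,n)/4^n.

   (2,-1): [X] is the integrated walk.  The vertices of its concave majorant split the path
   into two independent pieces, read backwards and forwards, that stay below a line.  The
   slopes decrease along the vertices and cover [[S_n, 0]], so comparing the expected total
   decrease of slope with E max |S| and E |S_n| shows that the self-convolution of
   [p] is of order [sqrt n], hence that [p_n] is of order [n^(-1/4)].

   P with |a2| < 1: with [b = - a2], [(1 - b) X_n] differs from the random walk by a
   multiple of an AR(1) process with parameter [b], which is at most of order [log N] with
   overwhelming probability; shifting the barrier by [K] costs a factor exp(O(K)).

   The exponents 0, 1, 1/4, 1/2 and infinity being different, each regime characterises
   its region. *)
Require Import Defs.
From HB Require Import structures.
From mathcomp Require Import all_boot all_order all_algebra.
From mathcomp Require Import all_classical all_reals all_analysis.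
From mathcomp Require Import measurable_realfun ring lra zify.
Import Order.TTheory GRing.Theory Num.Theory.
Import numFieldNormedType.Exports.
Local Open Scope classical_set_scope.
Local Open Scope ring_scope.
Set Implicit Arguments. Unset Strict Implicit. Unset Printing Implicit Defensive.

(** * The law of an i.i.d. sequence *)

Section sequence_space.
Context {R : realType}.

Definition cylinder (n : nat) (B : nat -> set R) : set (nat -> R) :=
  [set u | forall i, (i < n)%N -> B i (u i)].

Definition cylinders : set (set (nat -> R)) :=
  [set A | exists n B, (forall i, measurable (B i)) /\ A = cylinder n B].

Definition seqT : measurableType cylinders.-sigma := g_sigma_algebraType cylinders.

Lemma cylinders_setI : setI_closed cylinders.
Proof.
move=> _ _ [n [B [mB ->]]] [m [C [mC ->]]].
exists (maxn n m), (fun i => (if (i < n)%N then B i else setT) `&`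
                        (if (i < m)%N then C i else setT)); split.
  by move=> i; apply: measurableI; case: ifP.
apply/seteqP; split => u /=.
  move=> [Bu Cu] i _ /=; split; case: ifP => //; [exact: Bu | exact: Cu].
move=> H; split=> i li; have /H[] : (i < maxn n m)%N by rewrite leq_max li ?orbT.
  by rewrite li.
by rewrite li.
Qed.

Lemma measurable_coord (i : nat) : measurable_fun setT (fun u : seqT => u i).
Proof.
move=> _ B mB; rewrite setTI; apply: sub_sigma_algebra.
exists i.+1, (fun j => if j == i then B else setT); split; first by move=> j; case: ifP.
apply/seteqP; split => u /=.
  by move=> Bu j _; case: eqP => // ->.
by move=> /(_ i (ltnSn i)); rewrite eqxx.
Qed.

Lemma measurable_cylinder n (B : nat -> set R) : (forall i, measurable (B i)) ->
  measurable (cylinder n B : set seqT).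
Proof. by move=> mB; apply: sub_sigma_algebra; exists n, B. Qed.

Lemma measurable_seqfun d (S : measurableType d) (f : S -> seqT) :
  (forall i, measurable_fun setT (fun s => f s i)) -> measurable_fun setT f.
Proof.
move=> mf; apply: (@measurability _ _ S seqT _ _ cylinders) => // _ [_ [n [B [mB ->]]] <-].
rewrite setTI.
have -> : f @^-1` cylinder n B = \bigcap_i ((fun s => f s i) @^-1` (if (i < n)%N then B i else setT)).
  apply/seteqP; split => s /= H i; first by move=> _ /=; case: ifP => // /H.
  by move=> ni; have /= := H i I; rewrite ni.
apply: bigcapT_measurable => i.
by rewrite -[X in measurable X]setTI; apply: mf => //; case: ifP.
Qed.

Definition iid_law (g : {measure set R -> \bar R}) (m : {measure set seqT -> \bar R}) :=
  forall n (B : nat -> set R), (forall i, measurable (B i)) ->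
    m (cylinder n B) = (\prod_(i <- iota 0 n) g (B i))%E.

Lemma iid_law_setT g m : iid_law g m -> m setT = 1%E.
Proof.
move=> /(_ 0%N (fun=> setT)); rewrite big_nil => <- //.
by congr (m _); apply/seteqP; split.
Qed.

Section transfer.
Variables (g : probability R R) (m : {measure set seqT -> \bar R}).
Hypothesis gm : iid_law g m.
Context d (S : measurableType d).
Variables (nu : {measure set S -> \bar R}) (Z : S -> seqT).
Hypothesis mZ : measurable_fun setT Z.
Hypothesis nuZ : forall n (B : nat -> set R), (forall i, measurable (B i)) ->
  nu (Z @^-1` cylinder n B) = (\prod_(i <- iota 0 n) g (B i))%E.

Let Zm : {mfun S >-> seqT} := HB.pack Z (isMeasurableFun.Build _ _ _ _ _ mZ).

Lemma iid_transfer A : measurable A -> nu (Z @^-1` A) = m A.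
Proof.
move=> mA; symmetry.
have nu0 : forall B, pushforward nu Zm B = nu (Z @^-1` B) by [].
rewrite -nu0; apply: (@measure_unique _ R seqT cylinders (fun=> setT) _ _ _ _ m (pushforward nu Zm)) => //.
- exact: cylinders_setI.
- by move=> _; exists 0%N, (fun=> setT); split => //; apply/seteqP; split.
- by apply/seteqP; split => // u _; exists 0%N.
- by move=> _ [n [B [mB ->]]]; rewrite gm// [RHS]nuZ.
- by move=> _; rewrite (iid_law_setT gm) ltry.
Qed.

Lemma iid_transfer_int (f : seqT -> \bar R) : measurable_fun setT f ->
  (forall u, 0 <= f u)%E -> (\int[m]_u f u = \int[nu]_s f (Z s))%E.
Proof.
move=> mf f0; have := @ge0_integral_pushforward _ _ _ _ _ Z mZ nu setT f measurableT mf.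
move=> <- //.
apply: (@eq_measure_integral _ _ _ setT (pushforward nu Zm) m) => A mA _.
by rewrite -iid_transfer.
Qed.
End transfer.

Section iid.
Variables (g : probability R R) (m : probability seqT R).
Hypothesis gm : iid_law g m.

Lemma iid_inj (I : seq nat) (h : nat -> nat) (B : nat -> set R) :
  uniq I -> {in I &, injective h} -> (forall i, measurable (B i)) ->
  m [set u : seqT | forall i, i \in I -> B i (u (h i))] = (\prod_(i <- I) g (B i))%E.
Proof.
move=> uI hI mB.
pose J := map h I.
have uJ : uniq J by rewrite map_inj_in_uniq.
have [n Jn] : exists n, forall j, j \in J -> (j < n)%N.
  exists (\max_(j <- J) j).+1 => j jJ.
  by rewrite ltnS (leq_bigmax_seq (P := xpredT) (F := id)).
pose C j := if j \in J then B (nth 0%N I (index j J)) else setT.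
have Ch i : i \in I -> C (h i) = B i.
  by move=> iI; rewrite /C map_f// /J nth_index_map.
have mC j : measurable (C j) by rewrite /C; case: ifP.
have -> : [set u : seqT | forall i, i \in I -> B i (u (h i))] = cylinder n C.
  apply/seteqP; split => u /= H.
    move=> j _; rewrite /C; case: ifPn => // jJ.
    have /mapP[i iI jE] := jJ.
    by rewrite jE /J nth_index_map//; apply: H.
  by move=> i iI; rewrite -Ch//; apply: H; apply: Jn; apply: map_f.
rewrite gm// (bigID (mem J))/= [X in (_ * X)%E]big1 ?mule1; last first.
  by move=> j /negPf jJ; rewrite /C jJ probability_setT.
rewrite -big_filter (perm_big J) /=; last first.
  apply: uniq_perm; rewrite ?filter_uniq ?iota_uniq// => j.
  by rewrite mem_filter mem_iota/= add0n; case: (boolP (j \in J)) => //= /Jn ->.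
rewrite /J big_map big_seq_cond [RHS]big_seq_cond; apply: eq_bigr => i /andP[iI _].
by rewrite Ch.
Qed.

Definition smerge (c : nat -> bool) (h : nat -> nat) (uv : seqT * seqT) : seqT :=
  fun i => if c i then uv.1 (h i) else uv.2 (h i).

Lemma measurable_smerge c h : measurable_fun setT (smerge c h).
Proof.
apply: measurable_seqfun => i; rewrite /smerge; case: (c i).
  exact: (measurableT_comp (measurable_coord (h i)) measurable_fst).
exact: (measurableT_comp (measurable_coord (h i)) measurable_snd).
Qed.

Lemma smerge_cylinder c h : (forall i j, c i = c j -> h i = h j -> i = j) ->
  forall n (B : nat -> set R), (forall i, measurable (B i)) ->
  (m \x m)%E (smerge c h @^-1` cylinder n B) = (\prod_(i <- iota 0 n) g (B i))%E.
Proof.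
move=> ch n B mB.
pose I1 := [seq i <- iota 0 n | c i].
pose I2 := [seq i <- iota 0 n | ~~ c i].
have -> : smerge c h @^-1` cylinder n B =
   [set u : seqT | forall i, i \in I1 -> B i (u (h i))] `*`
   [set u : seqT | forall i, i \in I2 -> B i (u (h i))].
  apply/seteqP; split => -[u v] /=.
    rewrite /smerge /cylinder /= => H; split => i; rewrite mem_filter mem_iota add0n => /andP[ci ni].
      by have := H i ni; rewrite ci.
    by have := H i ni; rewrite (negPf ci).
  move=> [H1 H2] i ni; rewrite /smerge/=; case: ifPn => ci.
    by apply: H1; rewrite mem_filter ci mem_iota add0n.
  by apply: H2; rewrite mem_filter ci mem_iota add0n.
have mI (I : seq nat) : measurable [set u : seqT | forall i, i \in I -> B i (u (h i))].
  rewrite [X in measurable X](_ : _ = \bigcap_i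
     ((fun u : seqT => u (h i)) @^-1` (if i \in I then B i else setT))); last first.
    apply/seteqP; split => u /= H i; first by move=> _ /=; case: ifP => // /H.
    by move=> iI; have /= := H i Logic.I; rewrite iI.
  apply: bigcapT_measurable => i.
  by rewrite -[X in measurable X]setTI; apply: measurable_coord => //; case: ifP.
transitivity (m [set u : seqT | forall i, i \in I1 -> B i (u (h i))] *
   m [set u : seqT | forall i, i \in I2 -> B i (u (h i))])%E; first exact: product_measure1E.
rewrite !iid_inj ?filter_uniq ?iota_uniq//.
- by rewrite !big_filter [RHS](bigID c).
- by move=> i j; rewrite !mem_filter => /andP[/negPf ci _] /andP[/negPf cj _]; apply: ch; rewrite ci cj.
- by move=> i j; rewrite !mem_filter => /andP[ci _] /andP[cj _]; apply: ch; rewrite ci cj.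
Qed.

Lemma integral_smerge c h (f : seqT -> \bar R) :
  (forall i j, c i = c j -> h i = h j -> i = j) ->
  measurable_fun setT f -> (forall u, 0 <= f u)%E ->
  (\int[m]_u f u = \int[m]_u \int[m]_v f (smerge c h (u, v)))%E.
Proof.
move=> ch mf f0.
rewrite (iid_transfer_int gm (measurable_smerge c h) (smerge_cylinder ch))//.
have -> := @fubini_tonelli1 _ _ seqT seqT R m m (f \o smerge c h)
  (measurableT_comp mf (measurable_smerge c h)) (fun=> f0 _).
by [].
Qed.

Definition scons (y : R) (v : seqT) : seqT := fun i => if i is j.+1 then v j else y.

Lemma measurable_scons : measurable_fun setT (fun yv : R * seqT => scons yv.1 yv.2).
Proof.
apply: measurable_seqfun => -[|i] /=; first exact: measurable_fst.
exact: (measurableT_comp (measurable_coord i) measurable_snd).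
Qed.

Lemma integral_scons (f : seqT -> \bar R) :
  measurable_fun setT f -> (forall u, 0 <= f u)%E ->
  (\int[m]_u f u = \int[g]_y \int[m]_v f (scons y v))%E.
Proof.
move=> mf f0.
rewrite (@iid_transfer_int g m gm _ _ (g \x m)%E _ measurable_scons)//.
  by have -> := @fubini_tonelli1 _ _ R seqT R g m (fun yv => f (scons yv.1 yv.2))
    (measurableT_comp mf measurable_scons) (fun=> f0 _).
move=> n B mB.
case: n => [|n].
  rewrite big_nil (_ : _ @^-1` _ = setT `*` setT); last by apply/seteqP; split.
  transitivity (g setT * m setT)%E; first exact: product_measure1E.
  by rewrite !probability_setT mule1.
rewrite (_ : _ @^-1` _ = B 0%N `*` cylinder n (fun i => B i.+1)).
  transitivity (g (B 0%N) * m (cylinder n (fun i => B i.+1)))%E.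
    by apply: product_measure1E => //; exact: measurable_cylinder.
  by rewrite gm// [iota 0 n.+1]/= big_cons -[1%N]addn0 iotaDl big_map.
apply/seteqP; split => -[y v] /=.
  by move=> H; split; [exact: (H 0%N) | move=> i ni; exact: (H i.+1)].
by move=> [H0 H] [|i] ni //=; exact: H.
Qed.

Lemma integral_permute (s : nat -> nat) (f : seqT -> \bar R) : injective s ->
  measurable_fun setT f -> (forall u, 0 <= f u)%E ->
  (\int[m]_u f u = \int[m]_u f (u \o s))%E.
Proof.
move=> si mf f0; rewrite (@integral_smerge xpredT s)//; last by move=> i j _ /si.
apply: eq_integral => u _; rewrite (eq_integral (cst (f (u \o s)))) ?integral_cst//.
by rewrite (iid_law_setT gm) mule1.
Qed.

Lemma integral_sym (f : seqT -> \bar R) : (forall B : set R, measurable B -> g (-%R @^-1` B) = g B) ->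
  measurable_fun setT f -> (forall u, 0 <= f u)%E ->
  (\int[m]_u f u = \int[m]_u f (\- u)%R)%E.
Proof.
move=> gs mf f0.
have mo : measurable_fun setT (fun u : seqT => (\- u : seqT)).
  by apply: measurable_seqfun => i; apply: measurable_funN; exact: measurable_coord.
rewrite (@iid_transfer_int g m gm _ _ m _ mo)// => n B mB.
rewrite (_ : _ @^-1` _ = cylinder n (fun i => -%R @^-1` B i)); last by apply/seteqP; split.
rewrite gm; first by apply: eq_bigr => i _; exact: gs.
by move=> i; rewrite -[X in measurable X]setTI; apply: oppr_measurable.
Qed.

End iid.

Lemma seq_law d (T : measurableType d) (P : probability T R)
    (Y : nat -> {RV P >-> R}) (g : probability R R) :
  indep_pos Y ->
  (forall n, (0 < n)%N -> forall A, measurable A -> distribution P (Y n) A = g A) ->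
  exists m : probability seqT R, iid_law g m /\
    forall A : set seqT, measurable A -> P [set w | A (fun i => Y i.+1 w)] = m A.
Proof.
move=> iY gY.
have mZ : measurable_fun setT (fun w => (fun i => Y i.+1 w) : seqT).
  by apply: measurable_seqfun => i.
pose Zm : {mfun T >-> seqT} := HB.pack (fun w => (fun i => Y i.+1 w) : seqT) (isMeasurableFun.Build _ _ _ _ _ mZ).
exists (distribution P Zm); split => // n B mB.
transitivity (P (Zm @^-1` cylinder n B)) => //.
have -> : Zm @^-1` cylinder n B = \bigcap_(i in [set i | i \in iota 1 n]) (Y i @^-1` B i.-1).
  apply/seteqP; split => w /= H i /=.
    by rewrite mem_iota; case: i => // i; rewrite add1n ltnS /= => ni; exact: H.
  by move=> ni; apply: (H i.+1); rewrite /= mem_iota add1n ltnS.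
rewrite (iY (iota 1 n) (fun i => B i.-1)) ?iota_uniq//; last by move=> i; rewrite mem_iota => /andP[].
by rewrite -[1%N]addn0 iotaDl big_map; apply: eq_bigr => i _; exact: gY.
Qed.

End sequence_space.

(** * The normal law *)

Section normal_law.
Context {R : realType}.
Local Notation leb := (@lebesgue_measure R).

Import HBNNSimple.

Lemma integral_normal_prob_le (a s : R) (f : measurableTypeR R -> \bar R) :
  measurable_fun setT f -> (forall x, 0 <= f x)%E ->
  (\int[normal_prob a s]_x f x <= \int[leb]_x (f x * (normal_pdf a s x)%:E))%E.
Proof.
move=> mf f0.
have mpdf : measurable_fun setT (fun x : measurableTypeR R => (normal_pdf a s x)%:E).
  by apply/measurable_EFinP; exact: measurable_normal_pdf.
have pdf0 x : (0 <= (normal_pdf a s x)%:E)%E by rewrite lee_fin normal_pdf_ge0.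
pose h := nnsfun_approx measurableT mf.
have hf n x : ((h n x)%:E <= f x)%E.
  have cv := cvg_nnsfun_approx measurableT mf (fun y _ => f0 y) (I : setT x).
  have nd : nondecreasing_seq (EFin \o (fun k => h k x)).
    by move=> i j ij; rewrite lee_fin; exact/lefP/nd_nnsfun_approx.
  have := ereal_nondecreasing_cvgn nd; move/(cvg_unique _ cv) => -> //.
  by apply: ereal_sup_ubound; exists n.
have -> : (\int[normal_prob a s]_x f x =
    lim (\int[normal_prob a s]_x (EFin \o h n) x @[n --> \oo]))%E.
  under eq_integral => x _ do
    rewrite -(cvg_lim _ (cvg_nnsfun_approx measurableT mf (fun y _ => f0 y) (I : setT x)))//.
  apply: monotone_convergence => //.
  - by move=> n; apply/measurable_EFinP.
  - by move=> n x _ /=; rewrite lee_fin.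
  - by move=> x _ i j ij; rewrite lee_fin; exact/lefP/nd_nnsfun_approx.
apply: lime_le.
  apply: ereal_nondecreasing_is_cvgn => i j ij; apply: ge0_le_integral => //.
  - by move=> x _; rewrite lee_fin.
  - by apply/measurable_EFinP.
  - by apply/measurable_EFinP.
  - by move=> x _; rewrite lee_fin; exact/lefP/nd_nnsfun_approx.
apply: nearW => n.
apply: (@le_trans _ _ (\int[leb]_x ((h n x)%:E * (normal_pdf a s x)%:E))%E); last first.
  apply: ge0_le_integral => //.
  - by move=> x _; rewrite mule_ge0// lee_fin.
  - by apply: emeasurable_funM => //; apply/measurable_EFinP.
  - by apply: emeasurable_funM.
  - by move=> x _; rewrite lee_wpmul2r.
under eq_integral do rewrite /= fimfunE -fsumEFin//.
rewrite ge0_integral_fsum//; last 2 first.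
  - by move=> r; exact/measurable_EFinP/measurableT_comp.
  - by move=> m x _; rewrite EFinM nnfun_muleindic_ge0.
under [leRHS]eq_integral => x _.
  rewrite fimfunE -fsumEFin// ge0_mule_fsuml; last first.
    by move=> r; rewrite EFinM nnfun_muleindic_ge0.
  over.
rewrite ge0_integral_fsum//; last 2 first.
  - by move=> r; apply: emeasurable_funM => //; exact/measurable_EFinP/measurableT_comp.
  - by move=> m x _; rewrite mule_ge0// EFinM nnfun_muleindic_ge0.
apply: lee_fsum => // r _.
under eq_integral do rewrite EFinM.
rewrite integralZl_indic_nnsfun//= integral_indic// setIT.
have [r0|r0] := ltP r 0.
  rewrite preimage_nnfun0//= /normal_prob integral_set0 mule0; apply: integral_ge0 => x _.
  by rewrite mule_ge0// indic0 mulr0.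
under [leRHS]eq_integral do rewrite EFinM -muleA.
rewrite ge0_integralZl//.
- rewrite lee_wpmul2l ?lee_fin//.
  rewrite -[leLHS]/(\int[leb]_(x in h n @^-1` [set r]) (normal_pdf a s x)%:E)%E [leLHS]integral_mkcond.
  rewrite (eq_integral (fun x => (\1_(h n @^-1` [set r]) x)%:E * (normal_pdf a s x)%:E)%E)//.
  by move=> x _; rewrite patchE indicE; case: ifP => _; rewrite ?mul1e ?mul0e.
- by apply: emeasurable_funM => //; apply/measurable_EFinP; exact: measurable_indic.
- by move=> x _; rewrite mule_ge0// lee_fin.
Qed.

Variable s : R.
Hypothesis s0 : 0 < s.
Local Notation gt := (normal_prob 0 s : probability (measurableTypeR R) R).

Lemma measurable_id_typeR : measurable_fun setT (id : measurableTypeR R -> R).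
Proof. by move=> _ B mB; rewrite setTI. Qed.

(* The normal law of the library lives on [measurableTypeR R], whose display
   differs from that of the canonical structure on [R]. *)
Definition normal_law : probability R R := distribution gt
  (HB.pack (id : measurableTypeR R -> R) (isMeasurableFun.Build _ _ _ _ _ measurable_id_typeR) :
    {mfun measurableTypeR R >-> R}).
Local Notation g := normal_law.

Lemma normal_lawE A : normal_law A = normal_prob 0 s A.
Proof. by []. Qed.

Lemma integral_normal_law (f : R -> \bar R) : measurable_fun setT f ->
  (forall x, 0 <= f x)%E -> (\int[g]_x f x = \int[gt]_x f x)%E.
Proof.
by move=> mf f0; rewrite /normal_law /distribution /= ge0_integral_pushforward.
Qed.

Lemma normal_prob_sym (B : set R) : measurable B -> g (-%R @^-1` B) = g B.
Proof.
move=> mB.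
have mo : measurable_fun setT (-%R : R -> R) by exact: oppr_measurable.
pose om : {mfun R >-> R} := HB.pack (-%R : R -> R) (isMeasurableFun.Build _ _ _ _ _ mo).
have mG : measurable = <<s @RGenCInfty.G R >> := RGenCInfty.measurableE R.
have setIG : setI_closed (@RGenCInfty.G R).
  move=> _ _ [x ->] [y ->]; exists (Num.max x y).
  apply/seteqP; split => z /=; rewrite !in_itv/= !andbT ge_max; first by move=> [-> ->].
  by move=> /andP.
pose h n : set R := `[- n%:R, +oo[%classic.
have Gh n : RGenCInfty.G (h n) by eexists; reflexivity.
have coverh : \bigcup_n h n = setT.
  apply/seteqP; split => // x _; exists (Num.truncn `|x|).+1 => //=.
  rewrite /h /= in_itv/= andbT lerNl (le_trans (ler_norm _))// normrN ltW// truncnS_gt.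
  done.
have eqG A : RGenCInfty.G A -> g A = pushforward g om A.
  move=> [x ->]; transitivity (g `]-oo, - x]%classic); last first.
    congr (g _); apply/seteqP; split => z /=; rewrite !in_itv/= ?andbT lerNr//.
  rewrite !normal_lawE /normal_prob ge0_integration_by_substitutionNy.
  + apply: eq_integral => z _ /=.
    by rewrite !normal_pdfE ?gt_eqF// /normal_fun !subr0 sqrrN.
  + by apply: continuous_subspaceT; apply: continuous_normal_pdf; rewrite gt_eqF.
  + by move=> z _; exact: normal_pdf_ge0.
have finh n : (g (h n) < +oo)%E.
  apply: (@le_lt_trans _ _ 1%E); last by rewrite ltry.
  by apply: probability_le1; rewrite mG; apply: sub_sigma_algebra.
have H := @measure_unique _ R R _ h mG setIG Gh coverh g
  (pushforward g om) eqG finh B mB.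
by symmetry; exact: H.
Qed.

Lemma normal_prob_ray_gt0 (c : R) : (0 < g `]-oo, c]%classic)%E.
Proof.
pose e := normal_peak s * expR (- (`|c| + 1) ^+ 2 / (s ^+ 2 *+ 2)).
have e0 : 0 < e by rewrite mulr_gt0 ?expR_gt0// normal_peak_gt0 ?gt_eqF.
have sub : `[c - 1, c]%classic `<=` `]-oo, c]%classic.
  by move=> x /=; rewrite !in_itv/= => /andP[].
apply: (@lt_le_trans _ _ (g `[c - 1, c]%classic)); last by apply: (@le_measure _ _ _ g _ _ _ _ sub); rewrite inE.
apply: (@lt_le_trans _ _ (\int[leb]_(x in `[(c - 1)%R, c]) e%:E)%E); last rewrite normal_lawE.
  rewrite integral_cst//= lebesgue_measure_itv/= lte_fin ltrBlDr ltrDl ltr01.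
  by rewrite -EFinB -EFinM lte_fin mulr_gt0//; lra.
apply: ge0_le_integral => //.
- by move=> x _; rewrite lee_fin ltW.
- by apply/measurable_EFinP; apply: measurable_funTS; exact: measurable_normal_pdf.
- move=> x /=; rewrite in_itv/= => /andP[x1 x2]; rewrite lee_fin normal_pdfE ?gt_eqF//.
  rewrite /e ler_pM2l ?normal_peak_gt0 ?gt_eqF// /normal_fun ler_expR subr0.
  rewrite ler_pM2r ?invr_gt0 ?mulrn_wgt0 ?exprn_gt0// lerN2 -(real_normK (num_real x)).
  rewrite lerXn2r ?nnegrE ?addr_ge0// ler_norml.
  move: (x : R) x1 x2 => y y1 y2; have := ler_norm c; have := ler_norm (- c); rewrite normrN => *.
  by apply/andP; split; lra.
Qed.

Lemma normal_prob_itv_le (a b : R) : a <= b ->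
  (g `[a, b]%classic <= (normal_peak s * (b - a))%:E)%E.
Proof.
move=> ab; rewrite normal_lawE; apply: (@le_trans _ _ (\int[leb]_(x in `[a, b]) (normal_peak s)%:E)%E).
  apply: ge0_le_integral => //.
  - by move=> x _; rewrite lee_fin normal_pdf_ge0.
  - by apply/measurable_EFinP; apply: measurable_funTS; exact: measurable_normal_pdf.
  - by move=> x _; rewrite lee_fin normal_pdf_ub// gt_eqF.
rewrite integral_cst//= lebesgue_measure_itv/= lte_fin EFinM.
rewrite lee_wpmul2l ?lee_fin ?normal_peak_ge0//.
by case: ifP => // _; rewrite lee_fin subr_ge0.
Qed.

Lemma normal_prob_expR_lty (t : R) : (\int[g]_x (expR (t * `|x|))%:E < +oo)%E.
Proof.
have mpdf a : measurable_fun setT (fun x : measurableTypeR R => (normal_pdf a s x)%:E).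
  by apply/measurable_EFinP; exact: measurable_normal_pdf.
have pdf0 a x : (0 <= (normal_pdf a s x)%:E)%E by rewrite lee_fin normal_pdf_ge0.
have me : measurable_fun setT (fun x : R => (expR (t * `|x|))%:E).
  apply/measurable_EFinP; apply: measurableT_comp => //.
  by apply: measurable_funM => //; exact: normr_measurable.
rewrite integral_normal_law//.
apply: le_lt_trans (@integral_normal_prob_le 0 s _ me _) _.
  by move=> x; rewrite lee_fin expR_ge0.
pose c := expR (s ^+ 2 * t ^+ 2 / 2).
have c0 : 0 <= c by exact: expR_ge0.
apply: (@le_lt_trans _ _ (\int[leb]_x (c%:E * ((normal_pdf (t * s ^+ 2) s x)%:E +
   (normal_pdf (- (t * s ^+ 2)) s x)%:E)))%E).
  apply: ge0_le_integral => //.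
  - by move=> x _; rewrite mule_ge0// lee_fin expR_ge0.
  - by apply: emeasurable_funM; [exact: me|exact: mpdf].
  - apply: emeasurable_funM => //; apply: emeasurable_funD; exact: mpdf.
  - move=> x _; rewrite -EFinD -!EFinM lee_fin !normal_pdfE ?gt_eqF// /normal_fun.
    set k := normal_peak s; have k0 : 0 <= k := normal_peak_ge0 s.
    rewrite -mulrDr mulrCA [leRHS]mulrCA ler_wpM2l// /c mulrDr -!expRD subr0.
    have s2 : s ^+ 2 *+ 2 != 0 by rewrite mulrn_eq0/= expf_eq0/= gt_eqF.
    have E1 (u : R) : s ^+ 2 * t ^+ 2 / 2 + - (x - u * (t * s ^+ 2)) ^+ 2 / (s ^+ 2 *+ 2) =
        u * t * x - x ^+ 2 / (s ^+ 2 *+ 2) + (1 - u ^+ 2) * (s ^+ 2 * t ^+ 2 / 2).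
      rewrite -mulr_natr; field. by rewrite gt_eqF.
    have := E1 1; have := E1 (-1); rewrite !mul1r !mulN1r sqrrN expr1n subrr mul0r !addr0.
    move=> -> ->; rewrite mulNr !expRD -mulrDl ler_wpM2r ?expR_ge0//.
    have [x0|x0] := leP 0 x; first by rewrite ger0_norm// lerDl expR_ge0.
    by rewrite ltr0_norm// mulrN mulNr lerDr expR_ge0.
rewrite ge0_integralZl//; last 2 first.
  - by apply: emeasurable_funD; exact: mpdf.
  - by move=> x _; rewrite adde_ge0.
rewrite ge0_integralD//.
rewrite !integral_normal_pdf -EFinD -EFinM ltry//.
Qed.

End normal_law.

Section measurable_events.
Context {R : realType} d (S : measurableType d).

Lemma measurable_le_set (f h : S -> R) : measurable_fun setT f -> measurable_fun setT h ->
  measurable [set s | f s <= h s].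
Proof.
move=> mf mh; have := measurable_fun_ler mf mh.
move=> /(_ measurableT [set true] I); rewrite setTI.
by congr measurable; apply/seteqP; split.
Qed.

Lemma measurable_lt_set (f h : S -> R) : measurable_fun setT f -> measurable_fun setT h ->
  measurable [set s | f s < h s].
Proof.
move=> mf mh; have := measurable_fun_ltr mf mh.
move=> /(_ measurableT [set true] I); rewrite setTI.
by congr measurable; apply/seteqP; split.
Qed.

Lemma measurable_forall (P : nat -> bool) (A : nat -> set S) :
  (forall n, measurable (A n)) -> measurable [set s | forall n, P n -> A n s].
Proof.
move=> mA.
rewrite [X in measurable X](_ : _ = \bigcap_n (if P n then A n else setT)); last first.
  apply/seteqP; split => s /= H n; first by move=> _; case: ifP => // /H.
  by move=> Pn; have := H n I; rewrite Pn.
by apply: bigcapT_measurable => n; case: ifP.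
Qed.

Lemma measurable_forall_le (P : nat -> bool) (f h : nat -> S -> R) :
  (forall n, measurable_fun setT (f n)) -> (forall n, measurable_fun setT (h n)) ->
  measurable [set s | forall n, P n -> f n s <= h n s].
Proof.
by move=> mf mh; apply: (@measurable_forall P (fun n => [set s | f n s <= h n s])) => n; exact: measurable_le_set.
Qed.

Lemma measurable_forall_lt (P : nat -> bool) (f h : nat -> S -> R) :
  (forall n, measurable_fun setT (f n)) -> (forall n, measurable_fun setT (h n)) ->
  measurable [set s | forall n, P n -> f n s < h n s].
Proof.
by move=> mf mh; apply: (@measurable_forall P (fun n => [set s | f n s < h n s])) => n; exact: measurable_lt_set.
Qed.

Lemma EFin_indic_measurable (A : set S) : measurable A ->
  measurable_fun setT (fun s => (\1_A s : R)%:E).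
Proof. by move=> mA; apply/measurable_EFinP; exact: measurable_indic. Qed.

End measurable_events.

Section iid_tools.
Context {R : realType} (g : probability R R) (m : probability (@seqT R) R).
Hypothesis gm : iid_law g m.
Local Notation seqT := (@seqT R).

Lemma probE (A : set seqT) : measurable A -> m A = (\int[m]_u (\1_A u)%:E)%E.
Proof. by move=> mA; rewrite integral_indic// setIT. Qed.

Lemma measurable_scons1 (y : R) : measurable_fun setT (scons y).
Proof.
apply: measurable_seqfun => -[|i] //=; exact: measurable_coord.
Qed.

Lemma measurable_shift k : measurable_fun setT (fun u : seqT => (fun i => u (k + i)%N) : seqT).
Proof. by apply: measurable_seqfun => i; exact: measurable_coord. Qed.

Lemma measurable_scons_set (y : R) (A : set seqT) : measurable A ->
  measurable [set v : seqT | A (scons y v)].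
Proof. by move=> mA; rewrite -[X in measurable X]setTI; exact: measurable_scons1. Qed.

Lemma measurable_sconsl_set (v : seqT) (A : set seqT) : measurable A ->
  measurable [set y | A (scons y v)].
Proof.
move=> mA; have mv : measurable_fun setT (fun y : R => scons y v).
  by apply: measurable_seqfun => -[|i] /=; [exact: measurable_id|exact: measurable_cst].
by rewrite -[X in measurable X]setTI; exact: mv.
Qed.

Lemma prob_scons (A : set seqT) : measurable A ->
  m A = (\int[g]_y m [set v : seqT | A (scons y v)])%E.
Proof.
move=> mA; rewrite probE// (integral_scons gm)//; last exact: EFin_indic_measurable.
apply: eq_integral => y _; rewrite [RHS]probE//; exact: measurable_scons_set.
Qed.

Lemma measurable_prob_cons (A : set seqT) : measurable A ->
  measurable_fun setT (fun y => m [set v : seqT | A (scons y v)]).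
Proof.
move=> mA.
have mf : measurable_fun setT (fun yv : R * seqT => (\1_A (scons yv.1 yv.2) : R)%:E).
  by apply: (measurableT_comp (EFin_indic_measurable mA)); exact: measurable_scons.
have f0 (yv : R * seqT) : (0 <= (\1_A (scons yv.1 yv.2) : R)%:E)%E by rewrite lee_fin.
have := @measurable_fun_fubini_tonelli_F _ _ R seqT R m _ mf f0.
apply: eq_measurable_fun => y _; rewrite /fubini_F [RHS]probE//.
exact: measurable_scons_set.
Qed.

Lemma prob_scons_swap (A : set seqT) : measurable A ->
  m A = (\int[m]_v g [set y | A (scons y v)])%E.
Proof.
move=> mA; rewrite probE// (integral_scons gm)//; last exact: EFin_indic_measurable.
have mf : measurable_fun setT (fun yv : R * seqT => (\1_A (scons yv.1 yv.2) : R)%:E).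
  by apply: (measurableT_comp (EFin_indic_measurable mA)); exact: measurable_scons.
have f0 (yv : R * seqT) : (0 <= (\1_A (scons yv.1 yv.2) : R)%:E)%E by rewrite lee_fin.
have -> := @fubini_tonelli _ _ R seqT R g m _ mf f0.
apply: eq_integral => v _; rewrite -[in RHS](setIT [set y | A (scons y v)]) -integral_indic//.
exact: measurable_sconsl_set.
Qed.

Lemma prob_le_unif (A : set seqT) (c : R) : 0 <= c -> measurable A ->
  (forall v : seqT, (g [set y | A (scons y v)] <= c%:E)%E) -> (m A <= c%:E)%E.
Proof.
move=> c0 mA H; rewrite prob_scons_swap//.
have -> : c%:E = (\int[m]_v (cst c%:E) v)%E by rewrite integral_cst// (iid_law_setT gm) mule1.
have mf : measurable_fun setT (fun yv : R * seqT => (\1_A (scons yv.1 yv.2) : R)%:E).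
  by apply: (measurableT_comp (EFin_indic_measurable mA)); exact: measurable_scons.
have f0 (yv : R * seqT) : (0 <= (\1_A (scons yv.1 yv.2) : R)%:E)%E by rewrite lee_fin.
apply: ge0_le_integral => //.
have := @measurable_fun_fubini_tonelli_G _ _ R seqT R g _ mf f0.
apply: eq_measurable_fun => v _; rewrite /fubini_G.
rewrite -[in RHS](setIT [set y | A (scons y v)]) -integral_indic//.
exact: measurable_sconsl_set.
Qed.

Definition splice k (u v : seqT) : seqT := fun i => if (i < k)%N then u i else v (i - k)%N.

Lemma splice_inj k (i j : nat) : (i < k)%N = (j < k)%N ->
  (if (i < k)%N then i else (i - k)%N) = (if (j < k)%N then j else (j - k)%N) -> i = j.
Proof. clear; case: ltnP => ik; case: ltnP => jk // _; lia. Qed.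

Lemma integral_splice k (f : seqT -> \bar R) : measurable_fun setT f ->
  (forall u, 0 <= f u)%E ->
  (\int[m]_u f u = \int[m]_u \int[m]_v f (splice k u v))%E.
Proof.
move=> mf f0.
rewrite (@integral_smerge _ g m gm (fun i => i < k)%N (fun i => if (i < k)%N then i else (i - k)%N))//.
  apply: eq_integral => u _; apply: eq_integral => v _; congr f.
  by apply/funext => i; rewrite /smerge /splice /=; case: (i < k)%N.
exact: splice_inj.
Qed.

Lemma integral_prefix_shift k (f F : seqT -> \bar R) :
  measurable_fun setT f -> (forall u, 0 <= f u)%E ->
  measurable_fun setT F -> (forall u, 0 <= F u)%E ->
  (forall u v : seqT, (forall i, (i < k)%N -> u i = v i) -> f u = f v) ->
  (\int[m]_u (f u * F (fun i => u (k + i)%N)) = (\int[m]_u f u) * (\int[m]_u F u))%E.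
Proof.
move=> mf f0 mF F0 fk.
rewrite (integral_splice k)//; last 2 first.
- by apply: emeasurable_funM => //; apply: (measurableT_comp mF); exact: measurable_shift.
- by move=> u; rewrite mule_ge0.
rewrite -ge0_integralZr//; last by apply: integral_ge0.
apply: eq_integral => u _; rewrite -ge0_integralZl//.
apply: eq_integral => v _; congr (_ * _)%E.
  by apply: fk => i ik; rewrite /splice ik.
by congr F; apply/funext => i; rewrite /splice ltnNge leq_addr/= addKn.
Qed.

Lemma prob_prefix_shift k (A B : set seqT) : measurable A -> measurable B ->
  (forall u v : seqT, (forall i, (i < k)%N -> u i = v i) -> A u -> A v) ->
  m (A `&` [set u : seqT | B (fun i => u (k + i)%N)]) = (m A * m B)%E.
Proof.
move=> mA mB Ak.
have mB' : measurable [set u : seqT | B (fun i => u (k + i)%N)].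
  by rewrite -[X in measurable X]setTI; exact: measurable_shift.
rewrite probE; last exact: measurableI.
rewrite (probE mA) (probE mB) -(integral_prefix_shift (k := k))//.
- by apply: eq_integral => u _; rewrite -EFinM indicI.
- exact: EFin_indic_measurable.
- exact: EFin_indic_measurable.
move=> u v uv; congr (_%:E); rewrite !indicE; congr (_%:R); congr nat_of_bool.
apply/idP/idP; rewrite !inE; apply: Ak => // i /uv //.
Qed.

Lemma integral_coord j (f : R -> \bar R) : measurable_fun setT f ->
  (forall y, 0 <= f y)%E -> (\int[m]_u f (u j) = \int[g]_y f y)%E.
Proof.
move=> mf f0.
rewrite -(@integral_permute _ g m gm (fun i => i + j)%N (fun u => f (u 0%N)))//; last 2 first.
- by move=> a b /addIn.
- by apply: (measurableT_comp mf); exact: measurable_coord.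
rewrite (integral_scons gm (f := fun u => f (u 0%N)))//; last first.
  by apply: (measurableT_comp mf); exact: measurable_coord.
apply: eq_integral => y _; rewrite (eq_integral (cst (f y)))// integral_cst//.
by rewrite (iid_law_setT gm) mule1.
Qed.

Lemma prob_coord j (B : set R) : measurable B -> m [set u : seqT | B (u j)] = g B.
Proof.
move=> mB.
have mB' : measurable [set u : seqT | B (u j)].
  by rewrite -[X in measurable X]setTI; exact: measurable_coord.
rewrite probE// -[in RHS](setIT B) -integral_indic// -(integral_coord j)//.
exact: EFin_indic_measurable.
Qed.

Definition pr (A : set seqT) : R := fine (m A).

Lemma prE A : measurable A -> m A = (pr A)%:E.
Proof. by move=> mA; rewrite /pr fineK// fin_num_measure. Qed.

Lemma pr_ge0 A : 0 <= pr A.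
Proof. by rewrite /pr fine_ge0. Qed.

Lemma pr_le1 A : measurable A -> pr A <= 1.
Proof. by move=> mA; rewrite -lee_fin -prE// probability_le1. Qed.

Lemma le_pr A B : measurable A -> measurable B -> A `<=` B -> pr A <= pr B.
Proof. by move=> mA mB AB; rewrite -lee_fin -!prE// le_measure// inE. Qed.

Lemma pr_setU_le A B : measurable A -> measurable B -> pr (A `|` B) <= pr A + pr B.
Proof.
move=> mA mB; rewrite -lee_fin EFinD -!prE//; last exact: measurableU.
exact: measureU2.
Qed.

End iid_tools.

(** * The AR(2) recursion and region C *)

Section process.
Context {R : realType}.
Local Notation seqT := (@seqT R).

Fixpoint arp (a1 a2 : R) (u : nat -> R) (n : nat) : R * R :=
  if n is n'.+1 then
    let p := arp a1 a2 u n' in (p.2, a1 * p.2 + a2 * p.1 + u n')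
  else (0, 0).

Definition arx (a1 a2 : R) u n := (arp a1 a2 u n).2.

Lemma arx0 (a1 a2 : R) u : arx a1 a2 u 0 = 0. Proof. by []. Qed.

Lemma arx1 (a1 a2 : R) u : arx a1 a2 u 1 = u 0%N.
Proof. by rewrite /arx /= !mulr0 !add0r. Qed.

Lemma arxSS (a1 a2 : R) u n :
  arx a1 a2 u n.+2 = a1 * arx a1 a2 u n.+1 + a2 * arx a1 a2 u n + u n.+1.
Proof. by []. Qed.

Lemma ar2E d (T : measurableType d) (a1 a2 : R) (Y : nat -> T -> R) n w :
  ar2 a1 a2 Y n w = arx a1 a2 (fun i => Y i.+1 w) n.
Proof.
rewrite /ar2 /arx; congr (_.2); elim: n => [//|n IHn] /=.
by rewrite IHn.
Qed.

Lemma measurable_arp (a1 a2 : R) n : measurable_fun setT (fun u : seqT => (arp a1 a2 u n).1) /\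
  measurable_fun setT (fun u : seqT => (arp a1 a2 u n).2).
Proof.
elim: n => [|n [IH1 IH2]] /=; first by split; exact: measurable_cst.
split => //; apply: measurable_funD; last exact: measurable_coord.
by apply: measurable_funD; apply: measurable_funM => //; exact: measurable_cst.
Qed.

Lemma measurable_arx (a1 a2 : R) n : measurable_fun setT (fun u : seqT => arx a1 a2 u n).
Proof. by case: (measurable_arp a1 a2 n). Qed.

Definition neg (a1 a2 : R) N : set seqT := [set u | forall n, (1 <= n <= N)%N -> arx a1 a2 u n <= 0].

Lemma measurable_negset (a1 a2 : R) N : measurable (neg a1 a2 N).
Proof.
apply: (@measurable_forall_le R _ seqT (fun n => 1 <= n <= N)%N (fun n u => arx a1 a2 u n) (fun _ _ => 0)) => n.
  exact: measurable_arx.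
exact: measurable_cst.
Qed.

Lemma neg_le (a1 a2 : R) N M : (M <= N)%N -> neg a1 a2 N `<=` neg a1 a2 M.
Proof. by move=> MN u H n /andP[n1 nM]; apply: H; rewrite n1 (leq_trans nM). Qed.

Lemma neg_arx (a1 a2 : R) N u n : neg a1 a2 N u -> (n <= N)%N -> arx a1 a2 u n <= 0.
Proof. by case: n => [|n] // H nN; apply: H. Qed.

Lemma arx_factor (s1 s2 : R) u n :
  arx s1 0 u n.+1 = arx (s1 + s2) (- (s1 * s2)) u n.+1 - s2 * arx (s1 + s2) (- (s1 * s2)) u n.
Proof.
elim: n => [|n IHn]; first by rewrite !arx1 arx0 mulr0 subr0.
rewrite [LHS]arxSS mul0r addr0 IHn arxSS; ring.
Qed.

Lemma arx_rec1 (s : R) u n : arx s 0 u n.+1 = s * arx s 0 u n + u n.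
Proof. by case: n => [|n]; rewrite ?arx1 ?arx0 ?mulr0 ?add0r// arxSS mul0r addr0. Qed.

Lemma neg_factor_ge0 (s1 s2 : R) N : 0 <= s2 ->
  neg s1 0 N `<=` neg (s1 + s2) (- (s1 * s2)) N.
Proof.
move=> s20 u H n /andP[_ nN]; elim: n nN => [|n IHn] nN; first by rewrite arx0.
have := arx_factor s1 s2 u n; move/eqP; rewrite eq_sym subr_eq => /eqP ->.
have h1 := neg_arx H nN; have : s2 * arx (s1 + s2) (- (s1 * s2)) u n <= 0.
  by rewrite mulr_ge0_le0// IHn// ltnW.
lra.
Qed.

Lemma neg_factor_le0 (s1 s2 : R) N : s2 <= 0 ->
  neg (s1 + s2) (- (s1 * s2)) N `<=` neg s1 0 N.
Proof.
move=> s20 u H [//|n] /andP[_ nN]; rewrite (arx_factor s1 s2) subr_le0.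
rewrite (le_trans (neg_arx H nN))// mulr_le0//.
by apply: neg_arx H _; exact: ltnW.
Qed.

Lemma neg_ext (a1 a2 : R) N (u v : seqT) : (forall i, (i < N)%N -> u i = v i) -> neg a1 a2 N u -> neg a1 a2 N v.
Proof.
move=> uv H n /andP[n1 nN]; rewrite /arx; have <- : arp a1 a2 u n = arp a1 a2 v n; last first.
  by apply: H; rewrite n1.
elim: n nN {n1} => //= n IHn nN; rewrite IHn ?uv//; exact: ltnW.
Qed.

End process.

Section law.
Context {R : realType}.

Definition tame (g : probability R R) : Prop := [/\
  forall B : set R, measurable B -> g (-%R @^-1` B) = g B,
  forall c : R, (0 < g `]-oo, c]%classic)%E,
  exists C : R, forall a b : R, a <= b -> (g `[a, b]%classic <= (C * (b - a))%:E)%E &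
  forall t : R, (\int[g]_x (expR (t * `|x|))%:E < +oo)%E].

Lemma normal_law_tame (s : R) : 0 < s -> tame (normal_law s).
Proof.
move=> s0; split.
- exact: normal_prob_sym.
- exact: normal_prob_ray_gt0.
- by exists (normal_peak s); exact: normal_prob_itv_le.
- exact: normal_prob_expR_lty.
Qed.

Variable g : probability R R.
Hypothesis tg : tame g.

Lemma measurable_expR_norm (t : R) : measurable_fun setT (fun x : R => (expR (t * `|x|))%:E).
Proof.
apply/measurable_EFinP; apply: measurableT_comp => //.
by apply: measurable_funM => //; exact: normr_measurable.
Qed.

Lemma moment_fin (h : R -> R) (C t : R) : 0 <= C -> measurable_fun setT h -> (forall y, 0 <= h y) ->
  (forall y, h y <= C * expR (t * `|y|)) ->
  exists M : R, 0 <= M /\ (\int[g]_y (h y)%:E = M%:E)%E.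
Proof.
move=> C0 mh h0 hC.
have mhE : measurable_fun setT (fun y => (h y)%:E) by exact/measurable_EFinP.
have I0 : (0 <= \int[g]_y (h y)%:E)%E by apply: integral_ge0 => y _; rewrite lee_fin.
have fin : (\int[g]_y (h y)%:E \is a fin_num)%E.
  rewrite ge0_fin_numE//.
  apply: (@le_lt_trans _ _ (\int[g]_y (C%:E * (expR (t * `|y|))%:E))%E).
    apply: ge0_le_integral => //.
    - by move=> y _; rewrite lee_fin.
    - by apply: emeasurable_funM => //; exact: measurable_expR_norm.
    - by move=> y _; rewrite -EFinM lee_fin.
  rewrite ge0_integralZl//; last exact: measurable_expR_norm.
  have [_ _ _ /(_ t)] := tg.
  by apply: lte_mul_pinfty.
exists (fine (\int[g]_y (h y)%:E)%E); rewrite fineK//; split => //.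
exact: fine_ge0.
Qed.

Lemma abs_moment : exists M : R, 0 <= M /\ (\int[g]_y (`|y|)%:E = M%:E)%E.
Proof.
apply: (@moment_fin Num.norm 1 1) => //.
by move=> y; rewrite !mul1r; have := expR_ge1Dx `|y|; lra.
Qed.

Lemma integral_cst_g (k : R) : (\int[g]_y k%:E = k%:E)%E.
Proof.
rewrite integral_cst//; transitivity (k%:E * 1)%E; last by rewrite mule1.
by congr (_ * _)%E; exact: probability_setT.
Qed.

Lemma g_setC (B : set R) : measurable B -> fine (g (~` B)) = 1 - fine (g B).
Proof.
move=> mB; rewrite probability_setC// fineB// ?fin_num_measure//.
Qed.

Lemma g_fin (B : set R) : measurable B -> g B = (fine (g B))%:E.
Proof. by move=> mB; rewrite fineK// fin_num_measure. Qed.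

Lemma g_ge0 (B : set R) : 0 <= fine (g B).
Proof. exact: fine_ge0. Qed.

Lemma le_g (A B : set R) : measurable A -> measurable B -> A `<=` B ->
  fine (g A) <= fine (g B).
Proof. by move=> mA mB AB; rewrite -lee_fin -!g_fin// le_measure// inE. Qed.

Lemma measurable_norm_gt (t : R) : measurable [set y : R | t < `|y|].
Proof. by apply: measurable_lt_set => //; exact: normr_measurable. Qed.

Lemma ray_gt0 (c : R) : 0 < fine (g `]-oo, c]%classic).
Proof. by rewrite -lte_fin -g_fin//; have [_ /(_ c)] := tg. Qed.

Lemma ray_ge_gt0 (c : R) : 0 < fine (g `[c, +oo[%classic).
Proof.
have [sg _ _ _] := tg.
rewrite -sg//; rewrite [X in g X](_ : _ = `]-oo, - c]%classic); first exact: ray_gt0.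
by apply/seteqP; split => y /=; rewrite !in_itv/= ?andbT lerNr.
Qed.

Lemma ray_lt1 (c : R) : fine (g `]-oo, c]%classic) < 1.
Proof.
have := ray_ge_gt0 (c + 1).
have : fine (g `[c + 1, +oo[%classic) <= fine (g (~` `]-oo, c]%classic)).
  apply: le_g => //; first exact: measurableC.
  move=> y /=; rewrite !in_itv/= andbT => cy; apply/negP; rewrite -ltNge; lra.
rewrite g_setC//; lra.
Qed.

Lemma tail_markov (M t : R) : (\int[g]_y (`|y|)%:E = M%:E)%E -> 0 < t ->
  fine (g [set y | t < `|y|]) <= M / t.
Proof.
move=> EM t0.
have mA := measurable_norm_gt t.
rewrite ler_pdivlMr// -lee_fin EFinM -g_fin// -EM muleC.
rewrite -[in leLHS](setIT [set y | t < `|y|]) -integral_indic// -ge0_integralZl//; last 2 first.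
  exact: EFin_indic_measurable.
  by rewrite lee_fin ltW.
apply: ge0_le_integral => //.
- by move=> y _; rewrite -EFinM lee_fin mulr_ge0// ltW.
- by apply: emeasurable_funM => //; exact: EFin_indic_measurable.
- by apply/measurable_EFinP; exact: normr_measurable.
move=> y _; rewrite -EFinM lee_fin indicE; case: (boolP (y \in _)) => [|_].
  by rewrite inE /= mulr1 => /ltW.
by rewrite mulr0.
Qed.

Lemma prod_ge_sum (e : nat -> R) (s : seq nat) : (forall i, 0 <= e i <= 1) ->
  1 - \sum_(i <- s) e i <= \prod_(i <- s) (1 - e i) <= 1.
Proof.
move=> e01; elim: s => [|i s IHs]; first by rewrite !big_nil subr0 lexx.
rewrite !big_cons; have /andP[ei0 ei1] := e01 i; move: IHs.
have : 0 <= \sum_(i <- s) e i by apply: sumr_ge0 => j _; case/andP: (e01 j).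
have : 0 <= \prod_(i <- s) (1 - e i).
  by apply: prodr_ge0 => j _; rewrite subr_ge0; case/andP: (e01 j).
set P := \prod_(i <- s) _; set S := \sum_(i <- s) _ => P0 S0 /andP[SP P1]; nra.
Qed.

Variable m : probability (@seqT R) R.
Hypothesis gm : iid_law g m.
Local Notation seqT := (@seqT R).
Local Notation pN a1 a2 N := (pr m (neg a1 a2 N)).

Lemma pr_cylinder n (B : nat -> set R) : (forall i, measurable (B i)) ->
  pr m (cylinder n B : set seqT) = \prod_(i <- iota 0 n) fine (g (B i)).
Proof.
move=> mB; rewrite /pr gm//.
rewrite (eq_bigr (fun i => (fine (g (B i)))%:E)); last by move=> i _; exact: g_fin.
elim: (iota 0 n) => [|i s IHs]; first by rewrite !big_nil.
rewrite !big_cons fineM ?IHs//.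
by elim: s {IHs} => [|j s IHs]; rewrite ?big_nil// big_cons fin_numM.
Qed.

Lemma sum_geom_le (x : R) N : 0 <= x < 1 -> \sum_(i <- iota 0 N) x ^+ i <= (1 - x)^-1.
Proof.
move=> /andP[x0 x1].
have y0 : 0 < 1 - x by rewrite subr_gt0.
suff H : \sum_(i <- iota 0 N) x ^+ i * (1 - x) = 1 - x ^+ N.
  by rewrite -[leRHS]mul1r ler_pdivlMr// mulr_suml H gerBl exprn_ge0.
elim: N => [|N IHN]; first by rewrite big_nil expr0 subrr.
rewrite -addn1 iotaD big_cat/= big_cons big_nil IHN add0n addn1 exprS; ring.
Qed.

Lemma neg_pos_ge0 (a1 a2 : R) : 0 <= a1 -> 0 <= a2 -> 1 < a1 + a2 ->
  exists c : R, 0 < c /\ forall N, c <= pN a1 a2 N.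
Proof.
move=> a10 a20 a12.
pose eta := Num.min 1 ((a1 + a2 - 1) / 6).
have [e0 [e1 e2]] : 0 < eta /\ eta <= 1 /\ eta <= (a1 + a2 - 1) / 6.
  by rewrite /eta lt_min ge_min lexx ge_min lexx orbT; split => //; lra.
pose r := 1 + eta.
pose de := a1 * r + a2 - r ^+ 2.
have de0 : 0 < de by rewrite /de /r; nra.
have [M [M0 EM]] := abs_moment.
have r1 : 1 < r by rewrite /r; lra.
have r0 : 0 < r by lra.
pose x := r^-1.
have x01 : 0 <= x < 1 by rewrite /x invr_ge0 ltW//= invf_lt1.
pose K := 2 * (M + 1) / de * (1 - x)^-1.
have x1 : 0 < 1 - x by case/andP: x01; rewrite subr_gt0.
have K0 : 0 < K by rewrite /K !mulr_gt0 ?invr_gt0//; lra.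
pose B i : set R := if i is i'.+2 then `]-oo, K * de * r ^+ i'.+1]%classic
   else `]-oo, - (K * r ^+ i.+1)]%classic.
have mB i : measurable (B i) by case: i => [|[|i]] /=.
have sub N : cylinder N B `<=` neg a1 a2 N.
  move=> u Hu.
  have H n : (n < N)%N -> arx a1 a2 u n.+1 <= - (K * r ^+ n.+1).
    elim/ltn_ind: n => -[|[|n]] IH nN.
    - by rewrite arx1; have := Hu _ nN; rewrite /B /= in_itv.
    - rewrite arxSS arx0 mulr0 addr0.
      have := Hu _ nN; rewrite /B /= in_itv/=.
      have := IH 0%N (ltnSn _) (ltnW nN); rewrite expr1 => h1.
      have : 0 <= K * r by rewrite mulr_ge0 ?ltW//.
      have : a1 * arx a1 a2 u 1 <= 0 by rewrite mulr_ge0_le0//; nra.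
      lra.
    - rewrite arxSS; have := Hu _ nN; rewrite /B /= in_itv/= => h0.
      have h1 := IH n.+1 (ltnSn _) (ltnW nN).
      have h2 := IH n (ltnW (ltnSn _)) (ltnW (ltnW nN)).
      have h3 : a1 * arx a1 a2 u n.+2 <= a1 * - (K * r ^+ n.+2) by rewrite ler_wpM2l.
      have h4 : a2 * arx a1 a2 u n.+1 <= a2 * - (K * r ^+ n.+1) by rewrite ler_wpM2l.
      apply: (le_trans (lerD (lerD h3 h4) h0)).
      rewrite /de [r ^+ n.+3]exprS [r ^+ n.+2]exprS le_eqVlt; apply/orP; left; apply/eqP; ring.
  move=> [//|n] /andP[_ nN]; apply: (le_trans (H _ nN)).
  by rewrite oppr_le0 mulr_ge0 ?exprn_ge0// ltW.
pose b := fine (g (B 0%N)) * fine (g (B 1%N)).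
have b0 : 0 < b by rewrite mulr_gt0// ray_gt0.
exists (b / 2); split; first by lra.
move=> N.
suff H : b / 2 <= pN a1 a2 N.+2.
  apply: (le_trans H); apply: le_pr; try exact: measurable_negset.
  by apply: neg_le; rewrite -addn2 leq_addr.
apply: (@le_trans _ _ (pr m (cylinder N.+2 B : set seqT))); last first.
  by apply: le_pr (sub _); [exact: measurable_cylinder|exact: measurable_negset].
rewrite pr_cylinder// [iota 0 N.+2]/= !big_cons mulrA -/b; apply: ler_wpM2l; first exact: ltW.
have -> : iota 2 N = map (addn 2) (iota 0 N) by rewrite -iotaDl.
pose e i := fine (g (~` B i.+2)).
have eB i : fine (g (B i.+2)) = 1 - e i by rewrite /e g_setC//; ring.
have e01 i : 0 <= e i <= 1.
  rewrite /e g_ge0/= g_setC// gerBl; exact: g_ge0.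
rewrite big_map (eq_bigr (fun i => 1 - e i)); last by move=> i _; exact: eB.
have /andP[+ _] := prod_ge_sum (iota 0 N) e01.
apply: le_trans; rewrite lerBrDr -lerBrDl.
have ei i : e i <= M / (K * de) * x ^+ i.
  apply: (@le_trans _ _ (fine (g [set y | K * de * r ^+ i.+1 < `|y|]))).
    apply: le_g; [exact: measurableC|exact: measurable_norm_gt|].
    move=> y /=; rewrite in_itv/= => /negP; rewrite -ltNge => h.
    by rewrite (lt_le_trans h)// ler_norm.
  have rr : 0 < K * de * r ^+ i.+1 by apply: mulr_gt0; [exact: mulr_gt0|exact: exprn_gt0].
  apply: (le_trans (tail_markov EM rr)).
  rewrite -[leRHS]mulrA; apply: ler_wpM2l => //; rewrite invfM; apply: ler_wpM2l.
    by rewrite invr_ge0 mulr_ge0// ltW.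
  rewrite /x exprVn lef_pV2 ?posrE ?exprn_gt0// exprS; apply: ler_peMl; last exact: ltW.
  by apply: exprn_ge0; exact: ltW.
apply: (@le_trans _ _ (\sum_(i <- iota 0 N) M / (K * de) * x ^+ i)); first exact: ler_sum.
rewrite -mulr_sumr; apply: (@le_trans _ _ (M / (K * de) * (1 - x)^-1)).
  apply: ler_wpM2l; last exact: sum_geom_le.
  by rewrite divr_ge0// mulr_ge0// ltW.
have -> : M / (K * de) * (1 - x)^-1 = M / (2 * (M + 1)).
  rewrite /K; field; apply/and3P; split; rewrite ?gt_eqF//; lra.
rewrite ler_pdivrMr; lra.
Qed.

End law.

(** * Exponential decay *)

Section exponential_decay.
Context {R : realType} (g : probability R R).
Hypothesis tg : tame g.
Variable m : probability (@seqT R) R.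
Hypothesis gm : iid_law g m.
Local Notation seqT := (@seqT R).
Local Notation pN a1 a2 N := (pr m (neg a1 a2 N)).

Definition exp_decay (p : nat -> R) := exists C lam : R, [/\ 0 <= C, 0 < lam &
  forall N, p N <= C * expR (- lam * N%:R)].

Lemma exp_decay_geom (p : nat -> R) (C th : R) (L : nat) : (0 < L)%N -> 0 <= C -> 0 <= th < 1 ->
  (forall N, p N <= C * th ^+ (N %/ L)) -> exp_decay p.
Proof.
move=> L0 C0 /andP[th0 th1] H.
pose t := Num.max th (1 / 2).
have [t0 t1 tht] : [/\ 0 < t, t < 1 & th <= t].
  by rewrite /t lt_max gt_max le_max lexx th1; split => //; [apply/orP; right|]; lra.
have lt0 : 0 < - ln t by rewrite oppr_gt0 ln_lt0// t0.
have Lr : 0 < L%:R :> R by rewrite ltr0n.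
exists (C / t), (- ln t / L%:R); split; [by rewrite divr_ge0// ltW | by rewrite divr_gt0|].
move=> N; apply: (le_trans (H N)); rewrite -mulrA ler_wpM2l//.
apply: (@le_trans _ _ (t ^+ (N %/ L))).
  by rewrite lerXn2r// nnegrE// ltW.
rewrite -[t in X in X <= _](lnK (x := t)) ?posrE// -expRM_natr.
rewrite -[t in t^-1](lnK (x := t)) ?posrE// -expRN -expRD ler_expR.
have : (N%:R : R) / L%:R <= (N %/ L)%:R + 1.
  rewrite ler_pdivrMr// natr1 -natrM ler_nat {1}(divn_eq N L).
  by rewrite mulSn addnC leq_add2r ltnW// ltn_mod.
rewrite !mulNr opprK -mulrA [L%:R^-1 * _]mulrC; move: (N%:R / L%:R) ((N %/ L)%:R) => x y xy.
by nra.
Qed.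

Lemma exp_decay_le (p q : nat -> R) : (forall N, p N <= q N) -> exp_decay q -> exp_decay p.
Proof.
by move=> pq [C [lam [C0 l0 H]]]; exists C, lam; split => // N; exact: le_trans (H N).
Qed.

Definition impulse (a1 a2 : R) := arx a1 a2 (fun i => (i == 0)%:R).

Lemma arx_unfold (a1 a2 : R) (u : nat -> R) n k : (k <= n)%N ->
  arx a1 a2 u n.+2 = \sum_(i < k.+1) impulse a1 a2 i.+1 * u (n.+1 - i)%N
    + impulse a1 a2 k.+2 * arx a1 a2 u (n.+1 - k)%N + a2 * impulse a1 a2 k.+1 * arx a1 a2 u (n - k)%N.
Proof.
rewrite /impulse; elim: k => [_|k IHk kn].
  by rewrite big_ord_recr big_ord0/= arxSS !arxSS !arx1 arx0 !subn0 /=; ring.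
rewrite IHk ?(ltnW kn)// [in RHS]big_ord_recr/= -addrA -[RHS]addrA -[RHS]addrA; congr (_ + _).
have -> : (n.+1 - k = (n - k.+1).+2)%N by lia.
have -> : (n - k = (n - k.+1).+1)%N by lia.
have -> : (n.+1 - k.+1 = (n - k.+1).+1)%N by lia.
rewrite (arxSS _ _ u (n - k.+1)) (arxSS _ _ _ k.+1) /=; ring.
Qed.

Lemma block_decay (a1 a2 : R) (k : nat) : a2 <= 0 ->
  (forall i, (i <= k)%N -> 0 < impulse a1 a2 i.+1) -> impulse a1 a2 k.+2 <= 0 ->
  exp_decay (fun N => pN a1 a2 N).
Proof.
move=> a20 imp0 imp1.
pose L := k.+1.
pose T (u : seqT) : R := \sum_(i < L) impulse a1 a2 i.+1 * u (k - i)%N.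
have mT : measurable_fun setT T.
  apply: (@measurable_sum _ seqT R setT _ _ (fun (i : 'I_L) u => impulse a1 a2 i.+1 * u (k - i)%N)) => i.
  by apply: measurable_funM; [exact: measurable_cst|exact: measurable_coord].
pose A : set seqT := [set u | T u <= 0].
have mA : measurable A by apply: measurable_le_set => //; exact: measurable_cst.
have Ak (u v : seqT) : (forall i, (i < L)%N -> u i = v i) -> A u -> A v.
  move=> uv; rewrite /A/= /T (eq_bigr (fun i : 'I_L => impulse a1 a2 i.+1 * v (k - i)%N))//.
  by move=> i _; rewrite uv// /L; lia.
pose th := pr m A.
have th0 : 0 <= th by exact: pr_ge0.
have th1 : th < 1.
  pose C : set seqT := cylinder L (fun=> `[1, +oo[%classic).
  have mC : measurable C by apply: measurable_cylinder.
  have C0 : 0 < pr m C.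
    rewrite (pr_cylinder gm)// prodr_gt0// => i _; exact: ray_ge_gt0.
  have : pr m C <= pr m (~` A).
    apply: le_pr => //; first exact: measurableC.
    move=> u Cu /=; apply/negP; rewrite -ltNge; apply: (@lt_le_trans _ _ (\sum_(i < L) impulse a1 a2 i.+1)).
      by rewrite big_ord_recl/= ltr_wpDr ?imp0//; apply: sumr_ge0 => i _; rewrite ltW// imp0.
    apply: ler_sum => i _; rewrite ler_peMr//; first by rewrite ltW// imp0// -ltnS.
    have /Cu : (k - i < L)%N by rewrite /L; lia.
    by rewrite /= in_itv/= andbT.
  have -> : pr m (~` A) = 1 - th by rewrite /pr probability_setC// fineB// ?fin_num_measure.
  lra.
pose Bl J : set seqT := [set u | forall j, (j < J)%N -> A (fun i => u (j * L + i)%N)].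
have mBl J : measurable (Bl J).
  apply: (@measurable_forall _ seqT (fun j => j < J)%N (fun j => [set u | A (fun i => u (j * L + i)%N)])) => j.
  by rewrite -[X in measurable X]setTI; exact: measurable_shift.
have BlE J : pr m (Bl J) = th ^+ J.
  elim: J => [|J IHJ].
    by rewrite expr0 /pr (_ : Bl 0 = setT) ?probability_setT//; apply/seteqP; split.
  rewrite (_ : Bl J.+1 = A `&` [set u : seqT | Bl J (fun i => u (L + i)%N)]).
    by rewrite /pr (prob_prefix_shift gm)// fineM ?fin_num_measure// -/(pr m A) -/(pr m (Bl J)) IHJ exprS.
  apply/seteqP; split => u /=.
    move=> H; split; first exact: (H 0%N).
    move=> j jJ; have := H j.+1 jJ; congr A; apply/funext => i; congr u; rewrite mulSn; lia.
  move=> [H0 H] [|j] jJ; first by [].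
  by have := H j jJ; congr A; apply/funext => i; congr u; rewrite mulSn; lia.
have sub N : neg a1 a2 N `<=` [set u : seqT | Bl (N %/ L).-1 (fun i => u (L + i)%N)].
  move=> u Hu j jJ; rewrite /A /= /T.
  have jN : (j.+2 * L <= N)%N.
    apply: leq_trans (leq_trunc_div N L); rewrite leq_mul2r; apply/orP; right; lia.
  pose n := (j.+2 * L - 2)%N.
  have nE : (n.+2 = j.+2 * L)%N by rewrite /n /L; lia.
  have kn : (k <= n)%N by rewrite /n /L; nia.
  have := arx_unfold a1 a2 u kn.
  rewrite (eq_bigr (fun i : 'I_L => impulse a1 a2 i.+1 * u (L + (j * L + (k - i)))%N)); last first.
    move=> i _; congr (_ * u _); have := ltn_ord i; rewrite /n /L; nia.
  move=> E.
  have h1 : arx a1 a2 u n.+2 <= 0 by apply: neg_arx Hu _; rewrite nE.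
  have h2 : arx a1 a2 u (n.+1 - k) <= 0 by apply: neg_arx Hu _; lia.
  have h3 : arx a1 a2 u (n - k) <= 0 by apply: neg_arx Hu _; lia.
  have h4 : 0 <= impulse a1 a2 k.+2 * arx a1 a2 u (n.+1 - k) by rewrite mulr_le0.
  have h5 : 0 <= a2 * impulse a1 a2 k.+1 * arx a1 a2 u (n - k).
    by rewrite mulr_le0// mulr_le0_ge0// ltW// imp0.
  by move: E h1 h4 h5; lra.
have th1' : 0 <= Num.max th (1/2) < 1 by rewrite le_max th0/= gt_max th1; lra.
apply: (@exp_decay_geom _ 2 (Num.max th (1/2)) L) => // N.
have mS : measurable [set u : seqT | Bl (N %/ L).-1 (fun i => u (L + i)%N)].
  by rewrite -[X in measurable X]setTI; exact: measurable_shift.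
apply: (@le_trans _ _ (th ^+ (N %/ L).-1)).
  rewrite -BlE; apply: (le_trans (le_pr m (measurable_negset _ _ _) mS (sub N))).
  rewrite -{1}(setTI [set u | _]) /pr (@prob_prefix_shift _ g m gm L setT)//.
  by rewrite probability_setT mul1e.
have [tm tm'] : th <= Num.max th (1/2) /\ 1/2 <= Num.max th (1/2) by rewrite !le_max !lexx orbT.
apply: (@le_trans _ _ (Num.max th (1/2) ^+ (N %/ L).-1)).
  by rewrite lerXn2r// nnegrE (le_trans th0).
case: (N %/ L)%N => [|J]; first by rewrite !expr0; lra.
rewrite /= exprS; have : 0 <= Num.max th (1/2) ^+ J by rewrite exprn_ge0// (le_trans th0).
by move: (_ ^+ J) => z z0; nra.
Qed.

Lemma impulse_crosses (a1 a2 : R) : a2 <= 0 -> a1 <= 0 \/ a1 ^+ 2 + 4 * a2 < 0 ->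
  exists k, impulse a1 a2 k.+2 <= 0 /\ forall i, (i <= k)%N -> 0 < impulse a1 a2 i.+1.
Proof.
move=> a20 H.
have imp1 : impulse a1 a2 1 = 1 by rewrite /impulse arx1.
have imp2 : impulse a1 a2 2 = a1 by rewrite /impulse arxSS arx1 arx0 /=; ring.
have impS n : impulse a1 a2 n.+3 = a1 * impulse a1 a2 n.+2 + a2 * impulse a1 a2 n.+1.
  by rewrite /impulse arxSS /= addr0.
suff [k Hk] : exists k, impulse a1 a2 k.+2 <= 0.
  have ex : exists k, impulse a1 a2 k.+2 <= 0 by exists k.
  case: (ex_minnP ex) => n Hn nmin; exists n; split => // -[|i] ik; first by rewrite imp1.
  by rewrite ltNge; apply/negP => /nmin; rewrite leqNgt ik.
case: H => [a10|disc]; first by exists 0%N; rewrite imp2.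
have [//|a1p] := leP a1 0; first by exists 0%N; rewrite imp2.
apply: contrapT => /forallNP Hpos.
have pos n : 0 < impulse a1 a2 n.+1.
  by case: n => [|n]; rewrite ?imp1// ltNge; apply/negP; exact: Hpos.
pose de := - (a1 ^+ 2 / 4 + a2) / a1.
have de0 : 0 < de by rewrite /de divr_gt0//; lra.
have key n : impulse a1 a2 n.+2 <= (a1 - n%:R * de) * impulse a1 a2 n.+1.
  elim: n => [|n IHn]; first by rewrite imp1 imp2; lra.
  rewrite impS; have x0 := pos n; have y0 := pos n.+1; have z0 := pos n.+2.
  move: IHn x0 y0 z0; rewrite impS -natr1.
  set x := impulse a1 a2 n.+1; set y := impulse a1 a2 n.+2 => IHn x0 y0 z0.
  have n0 : 0 <= (n%:R : R) * de by rewrite mulr_ge0// ltW.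
  have yx : y <= a1 * x by nra.
  have E : de * a1 = - (a1 ^+ 2 / 4 + a2) by rewrite /de; field; rewrite gt_eqF.
  have q : de * a1 * x ^+ 2 <= y ^+ 2 - a1 * y * x - a2 * x ^+ 2.
    rewrite E; have := sqr_ge0 (y - a1 / 2 * x); lra.
  rewrite -(ler_pM2r x0).
  have h1 : y * y <= (a1 - n%:R * de) * x * y by rewrite ler_wpM2r// ltW.
  have h2 : de * x * y <= de * a1 * x ^+ 2.
    have : 0 <= de * x by rewrite mulr_ge0// ltW.
    by rewrite expr2; nra.
  by lra.
pose n := (Num.truncn (a1 / de)).+1.
have : a1 < n%:R * de by rewrite -ltr_pdivrMr// truncnS_gt.
have := key n; have := pos n.+1; have := pos n; nra.
Qed.

Lemma decay_no_positive_root (a1 a2 : R) : a2 <= 0 -> a1 <= 0 \/ a1 ^+ 2 + 4 * a2 < 0 ->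
  exp_decay (fun N => pN a1 a2 N).
Proof.
by move=> a20 H; have [k [H1 H2]] := impulse_crosses a20 H; exact: (block_decay (k := k)).
Qed.

End exponential_decay.

Section real_roots.
Context {R : realType} (g : probability R R).
Hypothesis tg : tame g.
Variable m : probability (@seqT R) R.
Hypothesis gm : iid_law g m.
Local Notation seqT := (@seqT R).
Local Notation pN a1 a2 N := (pr m (neg a1 a2 N)).

(* The AR(2) recursion with roots [s1, s2] as a first-order recursion for the
   pair (X_n, W_n) with W_n = X_n - s2 X_(n-1), started from an arbitrary pair. *)
Fixpoint xw (s1 s2 : R) (x : R * R) (u : nat -> R) (n : nat) : R * R :=
  if n is n'.+1 then
    let p := xw s1 s2 x u n' in
    (s2 * p.1 + (s1 * p.2 + u n'), s1 * p.2 + u n')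
  else x.

Lemma xwS (s1 s2 : R) x u n : xw s1 s2 x u n.+1 =
  (s2 * (xw s1 s2 x u n).1 + (s1 * (xw s1 s2 x u n).2 + u n), s1 * (xw s1 s2 x u n).2 + u n).
Proof. by []. Qed.

Lemma xw_arx (s1 s2 : R) u n : xw s1 s2 (0, 0) u n =
  (arx (s1 + s2) (- (s1 * s2)) u n, arx s1 0 u n).
Proof.
elim: n => [//|n IHn]; rewrite [LHS]/= IHn /= -arx_rec1 (arx_factor s1 s2).
by congr pair; ring.
Qed.

Lemma xw_scons (s1 s2 : R) x y (v : seqT) n : xw s1 s2 x (scons y v) n.+1 =
  xw s1 s2 (s2 * x.1 + (s1 * x.2 + y), s1 * x.2 + y) v n.
Proof. by elim: n => [//|n IHn]; rewrite xwS IHn. Qed.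

Definition xwneg (s1 s2 : R) x N : set seqT :=
  [set u | forall n, (1 <= n <= N)%N -> (xw s1 s2 x u n).1 <= 0].

Lemma measurable_xw (s1 s2 : R) x n : measurable_fun setT (fun u : seqT => (xw s1 s2 x u n).1) /\
  measurable_fun setT (fun u : seqT => (xw s1 s2 x u n).2).
Proof.
elim: n => [|n [IH1 IH2]] /=; first by split; exact: measurable_cst.
have h : measurable_fun setT (fun u : seqT => s1 * (xw s1 s2 x u n).2 + u n).
  apply: measurable_funD; last exact: measurable_coord.
  by apply: measurable_funM => //; exact: measurable_cst.
split => //; apply: measurable_funD => //.
by apply: measurable_funM => //; exact: measurable_cst.
Qed.

Lemma measurable_xwneg (s1 s2 : R) x N : measurable (xwneg s1 s2 x N).
Proof.
apply: (@measurable_forall_le R _ seqT (fun n => 1 <= n <= N)%N (fun n u => (xw s1 s2 x u n).1) (fun _ _ => 0)) => n.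
  by case: (measurable_xw s1 s2 x n).
exact: measurable_cst.
Qed.

Lemma xwneg_scons (s1 s2 : R) x N y (v : seqT) : xwneg s1 s2 x N.+1 (scons y v) <->
  s2 * x.1 + (s1 * x.2 + y) <= 0 /\
  xwneg s1 s2 (s2 * x.1 + (s1 * x.2 + y), s1 * x.2 + y) N v.
Proof.
split=> [H|[H0 H]].
  split; first by have := H 1%N isT; rewrite xw_scons.
  by move=> n /andP[n1 nN]; rewrite -(xw_scons s1 s2 x y); apply: H.
by move=> [//|[_|n]]; rewrite xw_scons// => /andP[_ nN]; apply: H; rewrite -ltnS.
Qed.

Lemma decay_stable (s1 s2 : R) : `|s1| < 1 -> `|s2| < 1 ->
  exp_decay (fun N => pN (s1 + s2) (- (s1 * s2)) N).
Proof.
move=> s11 s21.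
have [M [M0 EM]] := abs_moment tg.
pose ka := (1 - `|s1|) / 2.
have ka0 : 0 < ka by rewrite /ka; lra.
have ka1 : ka <= 1 by rewrite /ka; have := normr_ge0 s1; lra.
pose c := Num.max `|s2| (`|s1| * (1 + ka)).
have [c1 c2 c3] : [/\ `|s2| <= c, `|s1| * (1 + ka) <= c & c < 1].
  rewrite /c !le_max !lexx orbT gt_max s21; split => //=.
  by rewrite /ka; have := normr_ge0 s1; nra.
have c0 : 0 <= c by rewrite (le_trans _ c1).
pose nm (x : R * R) := ka * `|x.1| + `|x.2|.
have nm0 x : 0 <= nm x by rewrite addr_ge0// mulr_ge0// ltW.
pose Mb := 2 * (1 + ka) * (M + 1) / (1 - c).
have c1' : 0 < 1 - c by lra.
have Mb0 : 0 < Mb by rewrite /Mb divr_gt0// !mulr_gt0//; lra.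
have Mb1 : (1 + ka) * M <= (1 - c) / 2 * Mb.
  have -> : (1 - c) / 2 * Mb = (1 + ka) * (M + 1) by rewrite /Mb; field; rewrite gt_eqF.
  by rewrite ler_wpM2l//; lra.
pose D := Mb / ka + Mb.
pose de := 1 - fine (g `]-oo, D]%classic).
have de0 : 0 < de by rewrite subr_gt0 ray_lt1.
have de1 : de <= 1 by rewrite gerBl g_ge0.
pose Q := c * Mb + (1 + ka) * M + 1.
have Q0 : 0 < Q by rewrite /Q; nra.
pose ep := de / (2 * Q).
have ep0 : 0 < ep by rewrite divr_gt0// mulr_gt0//; lra.
have epQ : ep * Q = de / 2 by rewrite /ep; field; rewrite gt_eqF.
pose th := (1 - c) / 2 * (ep * Mb) / (1 + ep * Mb).
have epM : 0 < ep * Mb by rewrite mulr_gt0.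
have th0 : 0 < th.
  by rewrite /th; apply: divr_gt0; [apply: mulr_gt0 => //; lra|lra].
have th1 : th <= 1 / 2.
  by rewrite /th ler_pdivrMr; nra.
pose rho := Num.max (1 - de / 2) (1 - th).
have [r1 r2 r3] : [/\ 1 - de / 2 <= rho, 1 - th <= rho & rho < 1].
  by rewrite /rho !le_max !lexx orbT gt_max; split => //; apply/andP; split; lra.
have rho0 : 0 <= rho by lra.
pose f x := 1 + ep * nm x.
have f1 x : 1 <= f x by rewrite lerDl mulr_ge0// ltW.
have step (x : R * R) : fine (g `]-oo, - (s2 * x.1 + s1 * x.2)]%classic)
    + ep * (c * nm x + (1 + ka) * M) <= rho * f x.
  have [le|lt] := leP (nm x) Mb.
    have : fine (g `]-oo, - (s2 * x.1 + s1 * x.2)]%classic) <= 1 - de.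
      have -> : 1 - de = fine (g `]-oo, D]%classic) by rewrite /de; ring.
      apply: le_g => // y /=; rewrite !in_itv/= => yl.
      apply: (le_trans yl).
      have h2 : - (s2 * x.1) <= `|x.1|.
        by rewrite (le_trans (ler_norm _))// normrN normrM ler_piMl// ltW.
      have h1 : - (s1 * x.2) <= `|x.2|.
        by rewrite (le_trans (ler_norm _))// normrN normrM ler_piMl// ltW.
      have h3 : `|x.1| <= Mb / ka.
        rewrite ler_pdivlMr// mulrC (le_trans _ le)// lerDl//.
      have h4 : `|x.2| <= Mb by rewrite (le_trans _ le)// lerDr mulr_ge0// ltW.
      by rewrite /D; lra.
    have : ep * (c * nm x + (1 + ka) * M) <= de / 2.
      rewrite -epQ ler_wpM2l// ?ltW// /Q.
      have : c * nm x <= c * Mb by rewrite ler_wpM2l.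
      lra.
    have : rho <= rho * f x by rewrite ler_peMr.
    lra.
  have h1 : fine (g `]-oo, - (s2 * x.1 + s1 * x.2)]%classic) <= 1.
    exact: ltW (ray_lt1 tg _).
  have h2 : (1 + ka) * M <= (1 - c) / 2 * nm x.
    by rewrite (le_trans Mb1)// ler_wpM2l//; [lra|exact: ltW].
  have h3 : ep * (c * nm x + (1 + ka) * M) <= ep * ((1 + c) / 2 * nm x).
    by rewrite ler_wpM2l ?(ltW ep0)//; lra.
  have h4 : (1 - th) * f x <= rho * f x.
    by rewrite ler_wpM2r// (le_trans _ (f1 x)).
  apply: le_trans h4; rewrite /f.
  have : th * (1 + ep * nm x) <= ep * nm x * ((1 - c) / 2).
    rewrite /th mulrAC ler_pdivrMr; last lra.
    rewrite [leLHS](_ : _ = (1 - c) / 2 * ep * (Mb + ep * Mb * nm x)); last by ring.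
    rewrite [leRHS](_ : _ = (1 - c) / 2 * ep * (nm x + ep * Mb * nm x)); last by ring.
    apply: ler_wpM2l; last by rewrite lerD2r ltW.
    by apply: mulr_ge0; [lra|exact: ltW].
  move: h1 h3; set q := fine _; set w := ep * nm x.
  have -> : ep * ((1 + c) / 2 * nm x) = (1 + c) / 2 * w by rewrite /w; ring.
  by move=> *; lra.
have main N x : (m (xwneg s1 s2 x N) <= (rho ^+ N * f x)%:E)%E.
  elim: N x => [|N IHN] x.
    rewrite expr0 mul1r; apply: (@le_trans _ _ 1%E); last by rewrite lee_fin.
    by apply: probability_le1; exact: measurable_xwneg.
  rewrite (prob_scons gm); last exact: measurable_xwneg.
  set b := - (s2 * x.1 + s1 * x.2).
  apply: (@le_trans _ _ (\int[g]_y ((rho ^+ N)%:E * ((\1_(`]-oo, b]%classic) y : R)%:E +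
      (ep * (c * nm x))%:E + (ep * (1 + ka))%:E * `|y|%:E)))%E).
    apply: ge0_le_integral => //.
    - by apply: (@measurable_prob_cons R m); exact: measurable_xwneg.
    - apply: emeasurable_funM => //; apply: emeasurable_funD; last first.
        by apply: emeasurable_funM => //; apply/measurable_EFinP; exact: normr_measurable.
      by apply: emeasurable_funD => //; exact: EFin_indic_measurable.
    - move=> y _; set x' := (s2 * x.1 + (s1 * x.2 + y), s1 * x.2 + y).
      have nmx' : nm x' <= c * nm x + (1 + ka) * `|y|.
        rewrite /nm /x' /=.
        have t1 : `|s2 * x.1 + (s1 * x.2 + y)| <= `|s2| * `|x.1| + (`|s1| * `|x.2| + `|y|).
          rewrite -!normrM (le_trans (ler_normD _ _))// lerD2l; exact: ler_normD.
        have t2 : `|s1 * x.2 + y| <= `|s1| * `|x.2| + `|y| by rewrite -normrM; exact: ler_normD.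
        have t3 : ka * `|s2 * x.1 + (s1 * x.2 + y)| <= ka * (`|s2| * `|x.1| + (`|s1| * `|x.2| + `|y|)).
          by rewrite ler_wpM2l// ltW.
        have t4 : `|s2| * (ka * `|x.1|) <= c * (ka * `|x.1|).
          by rewrite ler_wpM2r// mulr_ge0// ltW.
        have t5 : `|s1| * (1 + ka) * `|x.2| <= c * `|x.2| by rewrite ler_wpM2r.
        lra.
      have [xb|xb] := leP (s2 * x.1 + (s1 * x.2 + y)) 0.
        have yb : y \in `]-oo, b]%classic by rewrite inE /= in_itv/= /b; lra.
        rewrite indicE yb.
        rewrite [X in m X](_ : _ = xwneg s1 s2 x' N); last first.
          apply/seteqP; split => v /=; first by case/xwneg_scons.
          by move=> H; apply/xwneg_scons.
        apply: (le_trans (IHN x')).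
        apply: (@le_trans _ _ (rho ^+ N * (1 + ep * (c * nm x) + ep * (1 + ka) * `|y|))%:E) => //.
        rewrite lee_fin; apply: ler_wpM2l; first exact: exprn_ge0.
        rewrite /f; have : ep * nm x' <= ep * (c * nm x + (1 + ka) * `|y|).
          by rewrite ler_wpM2l// ltW.
        lra.
      rewrite [X in m X](_ : _ = set0); last first.
        by apply/seteqP; split => v //= /xwneg_scons[]; rewrite leNgt xb.
      rewrite measure0; apply: mule_ge0; first by rewrite lee_fin exprn_ge0.
      apply: adde_ge0; last by apply: mule_ge0; rewrite ?lee_fin//; apply: mulr_ge0; [exact: ltW|lra].
      by apply: adde_ge0; rewrite lee_fin//; apply: mulr_ge0; [exact: ltW|exact: mulr_ge0].
  rewrite ge0_integralZl//; last 3 first.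
  - apply: emeasurable_funD; last first.
      by apply: emeasurable_funM => //; apply/measurable_EFinP; exact: normr_measurable.
    by apply: emeasurable_funD => //; exact: EFin_indic_measurable.
  - move=> y _; apply: adde_ge0; last by apply: mule_ge0; rewrite ?lee_fin//; apply: mulr_ge0; [exact: ltW|lra].
    by apply: adde_ge0; rewrite lee_fin//; apply: mulr_ge0; [exact: ltW|exact: mulr_ge0].
  - by rewrite lee_fin exprn_ge0.
  rewrite ge0_integralD//; last 4 first.
  - by move=> y _; apply: adde_ge0; rewrite lee_fin//; apply: mulr_ge0; [exact: ltW|exact: mulr_ge0].
  - by apply: emeasurable_funD => //; exact: EFin_indic_measurable.
  - by move=> y _; apply: mule_ge0; rewrite ?lee_fin//; apply: mulr_ge0; [exact: ltW|lra].
  - by apply: emeasurable_funM => //; apply/measurable_EFinP; exact: normr_measurable.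
  rewrite ge0_integralD//; last 2 first.
  - exact: EFin_indic_measurable.
  - by move=> y _; rewrite lee_fin; apply: mulr_ge0; [exact: ltW|exact: mulr_ge0].
  rewrite integral_indic// setIT integral_cst_g.
  rewrite ge0_integralZl//; last 2 first.
  - by apply/measurable_EFinP; exact: normr_measurable.
  - by rewrite lee_fin mulr_ge0//; [exact: ltW|lra].
  have gE : g `]-oo, b]%classic = (fine (g `]-oo, b]%classic))%:E by exact: g_fin.
  apply: (@le_trans _ _ ((rho ^+ N)%:E * ((fine (g `]-oo, b]%classic))%:E + (ep * (c * nm x))%:E +
    (ep * (1 + ka))%:E * M%:E))%E); first by rewrite -gE EM; exact: lexx.
  apply: (@le_trans _ _ (rho ^+ N * (fine (g `]-oo, b]%classic) + ep * (c * nm x) + ep * (1 + ka) * M))%:E) => //.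
  rewrite lee_fin exprSr -[leRHS]mulrA; apply: ler_wpM2l; first exact: exprn_ge0.
  by have := step x; rewrite -/b; lra.
apply: (@exp_decay_geom R _ 1 rho 1) => //; first by rewrite rho0.
move=> N; rewrite mul1r divn1 -lee_fin -prE; last exact: measurable_negset.
have := main N (0, 0); rewrite /f /nm /= !normr0 mulr0 add0r mulr0 addr0 mulr1.
congr (_ <= _)%E; congr (m _); apply/seteqP.
by split => u H n; have := H n; rewrite xw_arx.
Qed.

Lemma measurable_coord_gt (s : R) i : measurable [set u : seqT | s < `|u i|].
Proof.
by apply: measurable_lt_set => //; apply: measurableT_comp => //; exact: measurable_coord.
Qed.

Lemma measurable_some_large (s : R) k : measurable [set u : seqT | exists i, (i < k)%N /\ s < `|u i|].
Proof.
rewrite (_ : [set u | _] = \bigcup_(i in [set i | (i < k)%N]) [set u : seqT | s < `|u i|]).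
  by apply: bigcup_measurable => i _; exact: measurable_coord_gt.
by apply/seteqP; split => u /=; [move=> [i [? ?]]; exists i|move=> [i ? ?]; exists i].
Qed.

Lemma pr_some_large (s b : R) k : fine (g [set y | s < `|y|]) <= b ->
  pr m [set u : seqT | exists i, (i < k)%N /\ s < `|u i|] <= k%:R * b.
Proof.
move=> gb; elim: k => [|k IHk].
  by rewrite mul0r (_ : [set _ | _] = set0) ?/pr ?measure0//; apply/seteqP; split => u //= [i []].
apply: (@le_trans _ _ (pr m ([set u : seqT | exists i, (i < k)%N /\ s < `|u i|] `|` [set u | s < `|u k|]))).
  apply: le_pr => //; [exact: measurable_some_large|apply: measurableU|].
  - exact: measurable_some_large.
  - exact: measurable_coord_gt.
  move=> u /= [i [ik iu]]; move: ik; rewrite ltnS leq_eqVlt => /predU1P[<-|ik]; [by right|left].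
  by exists i.
apply: (le_trans (pr_setU_le m _ _)).
- exact: measurable_some_large.
- exact: measurable_coord_gt.
rewrite -natr1 mulrDl mul1r lerD// /pr (prob_coord gm k (B := [set y | s < `|y|]))//.
exact: measurable_norm_gt.
Qed.

Lemma decay_alternating (al be : R) : 1 <= al -> al < be ->
  exp_decay (fun N => pN (al - be) (al * be) N).
Proof.
move=> al1 albe.
have [M [M0 EM]] := abs_moment tg.
have [_ _ [C HC] _] := tg.
have al0 : 0 < al by lra.
have be0 : 0 < be by lra.
have C0 : 0 <= C.
  have := HC 0 1 ler01; rewrite subr0 mulr1 -lee_fin; apply: le_trans; exact: measure_ge0.
pose ka := Num.sqrt (Num.sqrt (be / al)).
have q1 : 1 < be / al by rewrite ltr_pdivlMr// mul1r.
have ka1 : 1 < ka.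
  by rewrite /ka -[X in X < _]sqrtr1 ltr_sqrt ?sqrtr_gt0 -?[X in X < _]sqrtr1 ?ltr_sqrt//; lra.
have ka0 : 0 < ka by lra.
have ka4 : ka ^+ 4 = be / al.
  by rewrite -[4%N]/(2 * 2)%N exprM /ka !sqr_sqrtr ?sqrtr_ge0//; lra.
have bernoulli N : N%:R <= ka ^+ N / (ka - 1).
  rewrite ler_pdivlMr ?subr_gt0//; elim: N => [|N IHN]; first by rewrite mul0r expr0.
  have kN : 1 <= ka ^+ N by apply: exprn_ege1; exact: ltW.
  rewrite -natr1 mulrDl mul1r exprS; move: (ka ^+ N) kN IHN => z z1; nra.
have W u N (s : R) : 0 <= s -> (forall i, (i < N)%N -> `|u i| <= s) -> `|arx al 0 u N| <= N%:R * al ^+ N * s.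
  move=> s0; elim: N => [|N IHN] Hu; first by rewrite arx0 normr0 !mul0r.
  rewrite arx_rec1; have h1 := IHN (fun i iN => Hu i (ltnW iN)).
  have h2 := Hu N (ltnSn N).
  apply: (le_trans (ler_normD _ _)); rewrite normrM (ger0_norm (ltW al0)).
  have h3 : al * `|arx al 0 u N| <= al * (N%:R * al ^+ N * s) by rewrite ler_wpM2l// ltW.
  have aN : 1 <= al ^+ N.+1 by apply: exprn_ege1.
  have h4 : s <= al ^+ N.+1 * s by rewrite ler_peMl.
  rewrite -natr1 exprS in h4 *; lra.
have V (y : R) (v : seqT) N : arx (- be) 0 (scons y v) N.+1 = (- be) ^+ N * y + arx (- be) 0 v N.
  elim: N => [|N IHN]; first by rewrite arx_rec1 !arx0 expr0 mulr0 addr0 add0r mul1r.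
  by rewrite arx_rec1 IHN arx_rec1 exprS /=; ring.
pose c1 := M / (ka - 1); pose c2 := 2 * C * al * ka ^+ 4 / (ka - 1).
apply: (@exp_decay_geom R _ (1 + c1 + c2) ka^-1 1) => //.
  by rewrite !addr_ge0// ?divr_ge0// ?mulr_ge0// ?exprn_ge0//; lra.
  by rewrite invr_ge0 ltW//= invf_lt1.
have k10 : 0 < ka - 1 by lra.
have c10 : 0 <= c1 by rewrite divr_ge0// ltW.
have c20 : 0 <= c2 by rewrite divr_ge0 ?(ltW k10)// !mulr_ge0// ?exprn_ge0// ltW.
case=> [|N].
  rewrite divn1 expr0 mulr1 (le_trans (pr_le1 m (measurable_negset _ _ _)))//; lra.
rewrite divn1 exprVn.
pose s := ka ^+ (2 * N.+1).
have s0 : 0 < s by rewrite exprn_gt0.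
pose t := N.+1%:R * al ^+ N.+1 * s.
have t0 : 0 < t by rewrite !mulr_gt0// ?exprn_gt0// ltr0n.
pose E1 : set seqT := [set u | exists i, (i < N.+1)%N /\ s < `|u i|].
pose E2 : set seqT := [set u | `|arx (- be) 0 u N.+1| <= t].
have mE1 : measurable E1 := measurable_some_large _ _.
have mE2 : measurable E2.
  by apply: measurable_le_set => //; apply: measurableT_comp => //; exact: measurable_arx.
have sub : neg (al - be) (al * be) N.+1 `<=` E1 `|` E2.
  move=> u Hu; have [[i [iN iu]]|nE1] := pselect (exists i, (i < N.+1)%N /\ s < `|u i|).
    by left; exists i.
  right; rewrite /E2 /=.
  have hW : `|arx al 0 u N.+1| <= t.
    apply: W; first exact: ltW.
    by move=> i iN; rewrite leNgt; apply/negP => iu; apply: nE1; exists i.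
  apply: le_trans hW.
  have x1 := neg_arx Hu (leqnn _); have x0 := neg_arx Hu (leqnSn N).
  have e1 := arx_factor al (- be) u N; have e2 := arx_factor (- be) al u N.
  rewrite mulrN opprK in e1; rewrite mulNr opprK [- be + al]addrC [be * al]mulrC in e2.
  rewrite e1 e2; move: x1 x0; set x1 := arx _ _ _ N.+1; set x0 := arx _ _ _ N => h1 h0.
  rewrite [X in _ <= X]ler0_norm; last by nra.
  by rewrite ler_norml; apply/andP; split; nra.
have p1 : pr m E1 <= N.+1%:R * (M / s).
  by apply: pr_some_large; exact: (tail_markov EM).
have bN : 0 < be ^+ N by rewrite exprn_gt0.
have p2 : pr m E2 <= 2 * C * t / be ^+ N.
  rewrite -lee_fin -prE//; apply: (prob_le_unif gm) => //.
    apply: divr_ge0; last exact: ltW.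
    by apply: mulr_ge0; [exact: mulr_ge0|exact: ltW].
  move=> v; set w := arx (- be) 0 v N.
  pose sg := (-1 : R) ^+ N.
  have sg2 : sg * sg = 1 by rewrite /sg -expr2 -exprM mulnC exprM sqrrN expr1n expr1n.
  pose a := (- t / be ^+ N) - sg * w / be ^+ N; pose b := (t / be ^+ N) - sg * w / be ^+ N.
  have absE (y : R) : `|(- be) ^+ N * y + w| = `|be ^+ N * y + sg * w|.
    have -> : (- be) ^+ N = sg * be ^+ N by rewrite /sg -exprMn mulN1r.
    have -> : be ^+ N * y + sg * w = sg * (sg * be ^+ N * y + w).
      by rewrite mulrDr !mulrA sg2 mul1r.
    by rewrite normrM [`|sg|]normrX normrN1 expr1n mul1r.
  apply: (@le_trans _ _ (g `[a, b]%classic)).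
    apply: le_measure; rewrite ?inE//; first exact: (measurable_sconsl_set v mE2).
    move=> y; rewrite /E2 /= V in_itv/= absE ler_norml => /andP[y1 y2].
    rewrite /a /b -!mulrBl ler_pdivrMr// ler_pdivlMr//; apply/andP; split; lra.
  apply: (le_trans (HC a b _)).
    by rewrite /a /b lerD2r ler_pM2r ?invr_gt0//; lra.
  rewrite lee_fin le_eqVlt; apply/orP; left; apply/eqP; rewrite /a /b; field; rewrite gt_eqF//.
apply: (le_trans (le_pr m _ _ sub)); [exact: measurable_negset|exact: measurableU|].
apply: (le_trans (pr_setU_le m _ _)) => //.
have kN : 0 < ka ^+ N.+1 by rewrite exprn_gt0.
have b1 : N.+1%:R * (M / s) <= c1 / ka ^+ N.+1.
  have := bernoulli N.+1; rewrite /s mulnC exprM expr2 /c1.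
  move: (ka ^+ N.+1) (N.+1%:R : R) kN => z n z0 nz.
  have Mz : 0 <= M / (z * z) by rewrite divr_ge0// mulr_ge0// ltW.
  apply: (le_trans (ler_wpM2r Mz nz)); rewrite le_eqVlt; apply/orP; left; apply/eqP.
  by field; rewrite !gt_eqF.
have b2 : 2 * C * t / be ^+ N <= c2 / ka ^+ N.+1.
  have beE : be = ka ^+ 4 * al by rewrite ka4; field; rewrite gt_eqF.
  have := bernoulli N.+1; rewrite /t /s beE exprMn mulnC exprM expr2 -exprM mulnC exprM /c2.
  rewrite [al ^+ N.+1]exprS [ka ^+ N.+1]exprS.
  have aN : 0 < al ^+ N by rewrite exprn_gt0.
  have kN' : 0 < ka ^+ N by rewrite exprn_gt0.
  move: (ka ^+ N) (N.+1%:R : R) (al ^+ N) kN' aN => z n x z0 x0 nz.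
  have Mz : 0 <= 2 * C * (al * x) * (ka * z) ^+ 2 / (z ^+ 4 * x).
    apply: divr_ge0; last by apply: mulr_ge0; [exact/exprn_ge0/ltW|exact: ltW].
    apply: mulr_ge0; last by apply: sqr_ge0.
    apply: mulr_ge0; first exact: mulr_ge0.
    by apply: mulr_ge0; exact: ltW.
  have := ler_wpM2r Mz nz.
  have -> : n * (2 * C * (al * x) * (ka * z) ^+ 2 / (z ^+ 4 * x)) =
     2 * C * (n * (al * x) * (ka * z * (ka * z))) / (z ^+ 4 * x) by field; rewrite !gt_eqF.
  move=> h; apply: (le_trans h); rewrite le_eqVlt; apply/orP; left; apply/eqP.
  by field; rewrite !gt_eqF.
have : 0 <= 1 / ka ^+ N.+1 by rewrite divr_ge0// ltW.
rewrite !mulrDl; lra.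
Qed.

End real_roots.

(** * Random walks *)

Section central_binomial.
Context {R : realType}.

(* [cbin n] is C(2n,n)/4^n. *)
Fixpoint cbin (n : nat) : R :=
  if n is n'.+1 then cbin n' * ((n'%:R + 1 / 2) / (n'%:R + 1)) else 1.

Let nat_ge0 n : 0 <= n%:R :> R. Proof. by []. Qed.

Lemma cbinS n : cbin n.+1 = cbin n * ((n%:R + 1 / 2) / (n%:R + 1)).
Proof. by []. Qed.

Lemma cbin_gt0 n : 0 < cbin n.
Proof.
elim: n => [//|n IHn]; rewrite cbinS; apply: mulr_gt0 => //.
Qed.

Lemma cbin_rec n : (n%:R + 1) * cbin n.+1 = (n%:R + 1 / 2) * cbin n.
Proof.
by rewrite cbinS; field; have := nat_ge0 n; move=> h; rewrite gt_eqF//; lra.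
Qed.

Lemma cbin_conv n : \sum_(k < n.+1) cbin k * cbin (n - k) = 1.
Proof.
pose T n := \sum_(k < n.+1) cbin k * cbin (n - k).
pose D n := \sum_(k < n.+1) (k%:R : R) * (cbin k * cbin (n - k)).
have DT j : 2 * D j = j%:R * T j.
  rewrite mulr_natl mulr2n {2}/D (reindex_inj rev_ord_inj)/= /D /T -big_split/= mulr_sumr.
  apply: eq_bigr => k _; have kj : (k <= j)%N by rewrite -ltnS.
  rewrite subSS subKn// [cbin (j - k) * _]mulrC -mulrDl natrB//; congr (_ * _); ring.
have DS j : D j.+1 = (j.+1%:R / 2) * T j.
  have := DT j; rewrite {2}/D big_ord_recl/= mul0r add0r.
  rewrite (eq_bigr (fun k : 'I_j.+1 => (k%:R : R) * (cbin k * cbin (j - k)) + (cbin k * cbin (j - k)) / 2)).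
    rewrite big_split/= -mulr_suml -/(D j) -/(T j) -[j.+1%:R]natr1; lra.
  move=> k _; rewrite /bump/= add1n subSS -[k.+1%:R]natr1.
  by rewrite mulrA cbin_rec; ring.
rewrite -/(T n); elim: n => [|n IHn].
  by rewrite /T big_ord_recl big_ord0 /= addr0 mulr1.
have := DT n.+1; rewrite DS IHn mulr1 => /esym.
have -> : 2 * (n.+1%:R / 2) = n.+1%:R :> R by field.
by move=> h; apply: (@mulfI _ n.+1%:R); rewrite ?pnatr_eq0// mulr1.
Qed.

Lemma conv_unique (a b : nat -> R) : a 0%N = 1 -> b 0%N = 1 ->
  (forall n, \sum_(k < n.+1) a k * a (n - k)%N = 1) ->
  (forall n, \sum_(k < n.+1) b k * b (n - k)%N = 1) -> forall n, a n = b n.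
Proof.
move=> a0 b0 Ha Hb; elim/ltn_ind => -[|n] IH; first by rewrite a0.
have E (c : nat -> R) : c 0%N = 1 -> (forall n, \sum_(k < n.+1) c k * c (n - k)%N = 1) ->
    2 * c n.+1 = 1 - \sum_(k < n) c k.+1 * c (n - k)%N.
  move=> c0 /(_ n.+1); rewrite big_ord_recl big_ord_recr/= subnn /bump/= subn0 c0 add1n.
  rewrite (eq_bigr (fun k : 'I_n => c k.+1 * c (n - k)%N)) => [|k _]; last first.
    by rewrite add1n subSS.
  lra.
have := E a a0 Ha; have := E b b0 Hb.
rewrite (eq_bigr (fun k : 'I_n => a k.+1 * a (n - k)%N)) => [|k _]; first lra.
by rewrite !IH//; have := ltn_ord k; lia.
Qed.

Lemma cbin_le n k : (k <= n)%N -> cbin n <= cbin k.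
Proof.
move=> kn; rewrite -(subnK kn); elim: (n - k)%N => [//|j IHj].
rewrite addSn cbinS; apply: le_trans IHj; apply: ler_piMr; first exact/ltW/cbin_gt0.
by have := nat_ge0 (j + k); move=> h; rewrite ler_pdivrMr; lra.
Qed.

Lemma cbin_sqr_ub n : (n%:R + 1 / 2) * cbin n ^+ 2 <= 1 / 2.
Proof.
elim: n => [|n IHn]; first by rewrite expr1n; lra.
apply: le_trans IHn.
have := cbin_rec n; rewrite -[n.+1%:R]natr1; have := cbin_gt0 n; have := cbin_gt0 n.+1.
have := nat_ge0 n; move: (n%:R : R) (cbin n) (cbin n.+1) => x a b x0 b0 a0 E.
have bE : b = (x + 1 / 2) / (x + 1) * a.
  by apply: (@mulfI _ (x + 1)); rewrite ?E; [rewrite gt_eqF//; lra|field; rewrite gt_eqF//; lra].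
rewrite bE.
have -> : (x + 1 + 1 / 2) * ((x + 1 / 2) / (x + 1) * a) ^+ 2 =
   ((x + 3 / 2) * (x + 1 / 2) / (x + 1) ^+ 2) * ((x + 1 / 2) * a ^+ 2).
  by field; rewrite gt_eqF//; lra.
apply: ler_piMl; first by apply: mulr_ge0; [lra|exact: sqr_ge0].
by rewrite ler_pdivrMr; [nra|apply: exprn_gt0; lra].
Qed.

Lemma cbin_sqr_incr n : n%:R * cbin n ^+ 2 <= n.+1%:R * cbin n.+1 ^+ 2.
Proof.
have := cbin_rec n; rewrite -[n.+1%:R]natr1; have := cbin_gt0 n; have := cbin_gt0 n.+1.
have := nat_ge0 n; move: (n%:R : R) (cbin n) (cbin n.+1) => x a b x0 b0 a0 E.
have bE : b = (x + 1 / 2) / (x + 1) * a.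
  by apply: (@mulfI _ (x + 1)); rewrite ?E; [rewrite gt_eqF//; lra|field; rewrite gt_eqF//; lra].
rewrite bE.
have -> : (x + 1) * ((x + 1 / 2) / (x + 1) * a) ^+ 2 = ((x + 1 / 2) ^+ 2 / (x + 1)) * a ^+ 2.
  by field; rewrite gt_eqF//; lra.
apply: ler_wpM2r; first exact: sqr_ge0.
by rewrite ler_pdivlMr; [nra|lra].
Qed.

Lemma cbin_cvg : exists c : R, [/\ 0 < c,
  (n%:R * cbin n ^+ 2) @[n --> \oo] --> c & (cbin n ^+ 2) @[n --> \oo] --> (0 : R)].
Proof.
have np n : 0 < n%:R + 1 / 2 :> R by have := nat_ge0 n; lra.
pose a n : R := n%:R * cbin n ^+ 2.
have nd : nondecreasing_seq a.
  by apply/nondecreasing_seqP => n; exact: cbin_sqr_incr.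
have ub n : a n <= 1 / 2.
  apply: le_trans (cbin_sqr_ub n); rewrite /a; apply: ler_wpM2r; [exact: sqr_ge0|lra].
have cv : cvgn a.
  apply: nondecreasing_is_cvgn => //; exists (1 / 2) => _ [n _ <-]; exact: ub.
exists (limn a); split => //.
  apply: (@lt_le_trans _ _ (a 1%N)); last exact: nondecreasing_cvgn_le.
  by rewrite /a mul1r exprn_gt0// cbin_gt0.
apply: (@squeeze_cvgr _ _ _ _ (fun=> 0) (fun n => (1 / 2) / (n%:R + 1 / 2))); last 2 first.
- exact: cvg_cst.
- rewrite -[X in _ --> X](mulr0 (1 / 2)); apply: cvgMl_tmp.
  apply/cvgrPdist_lt => e e0; near=> n; rewrite sub0r normrN gtr0_norm ?invr_gt0; last exact: np.
  rewrite invf_plt ?posrE//.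
  apply: (@lt_trans _ _ n%:R); last lra.
  by near: n; exact: nbhs_infty_gtr.
apply: nearW => n; rewrite sqr_ge0/= ler_pdivlMr//.
by rewrite mulrC; exact: cbin_sqr_ub.
Unshelve. all: by end_near. Qed.

End central_binomial.

Section random_walk.
Context {R : realType} (g : probability R R).
Hypothesis tg : tame g.
Variable m : probability (@seqT R) R.
Hypothesis gm : iid_law g m.
Local Notation seqT := (@seqT R).
Local Notation pN a1 a2 N := (pr m (neg a1 a2 N)).

Definition walk (u : nat -> R) n := \sum_(i < n) u i.

Lemma walkS u n : walk u n.+1 = walk u n + u n.
Proof. by rewrite /walk big_ord_recr. Qed.

Lemma walk0 u : walk u 0 = 0.
Proof. by rewrite /walk big_ord0. Qed.

Lemma arx_walk u n : arx 1 0 u n = walk u n.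
Proof.
by elim: n => [|n IHn]; rewrite ?arx0 ?walk0// arx_rec1 mul1r IHn walkS.
Qed.

Lemma measurable_walk n : measurable_fun setT (fun u : seqT => walk u n).
Proof.
apply: (eq_measurable_fun (fun u : seqT => arx 1 0 u n)) => [u _|]; first exact: arx_walk.
exact: measurable_arx.
Qed.

Lemma walk_scons y (v : seqT) n : walk (scons y v) n.+1 = y + walk v n.
Proof. by rewrite /walk big_ord_recl/=. Qed.

Lemma walk_shift u k n : walk u (k + n) = walk u k + walk (fun i => u (k + i)%N) n.
Proof.
by elim: n => [|n IHn]; rewrite ?addn0 ?walk0 ?addr0// addnS !walkS IHn addrA.
Qed.

Lemma walk_eq0_null n : pr m [set u : seqT | walk u n.+1 = 0] = 0.
Proof.
have mA : measurable [set u : seqT | walk u n.+1 = 0].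
  rewrite (_ : [set u | _] = [set u : seqT | walk u n.+1 <= 0] `&` [set u : seqT | 0 <= walk u n.+1]).
    by apply: measurableI; apply: measurable_le_set; (exact: measurable_walk || exact: measurable_cst).
  apply/seteqP; split => u /=; first by move=> ->.
  by move=> [h1 h2]; apply/eqP; rewrite eq_le h1.
have [_ _ [C HC] _] := tg.
apply/eqP; rewrite eq_le pr_ge0 andbT -lee_fin -prE//.
apply: (prob_le_unif gm) => // v.
rewrite (_ : [set y | _] = `[- walk v n, - walk v n]%classic).
  by apply: (le_trans (HC _ _ (lexx _))); rewrite subrr mulr0.
apply/seteqP; split => y /=; rewrite walk_scons in_itv/= -eq_le.
  by move=> /eqP; rewrite addr_eq0 eq_sym.
by move=> /eqP <-; rewrite addNr.
Qed.

Definition sneg n : set seqT := [set u | forall j, (1 <= j <= n)%N -> walk u j < 0].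

Lemma measurable_sneg n : measurable (sneg n).
Proof.
apply: (@measurable_forall_lt R _ seqT (fun j => 1 <= j <= n)%N (fun j u => walk u j) (fun _ _ => 0)) => j.
  exact: measurable_walk.
exact: measurable_cst.
Qed.

Lemma pr_sneg n : pr m (sneg n) = pN 1 0 n.
Proof.
apply/eqP; rewrite eq_le; apply/andP; split.
  apply: le_pr; [exact: measurable_sneg|exact: measurable_negset|].
  by move=> u H j /H; rewrite arx_walk => /ltW.
pose Z k : set seqT := [set u | exists j, (j < k)%N /\ walk u j.+1 = 0].
have mz j : measurable [set u : seqT | walk u j.+1 = 0].
  rewrite (_ : [set u | _] = [set u : seqT | walk u j.+1 <= 0] `&` [set u : seqT | 0 <= walk u j.+1]).
    by apply: measurableI; apply: measurable_le_set; (exact: measurable_walk || exact: measurable_cst).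
  apply/seteqP; split => u /=; first by move=> ->.
  by move=> [h1 h2]; apply/eqP; rewrite eq_le h1.
have mZ k : measurable (Z k).
  rewrite (_ : Z k = \bigcup_(j in [set j | (j < k)%N]) [set u : seqT | walk u j.+1 = 0]).
    by apply: bigcup_measurable => j _; exact: mz.
  by apply/seteqP; split => u /=; [move=> [j [? ?]]; exists j|move=> [j ? ?]; exists j].
have Z0 k : pr m (Z k) <= 0.
  elim: k => [|k IHk].
    by rewrite (_ : Z 0%N = set0) ?/pr ?measure0//; apply/seteqP; split => u //= [j []].
  apply: (@le_trans _ _ (pr m (Z k `|` [set u : seqT | walk u k.+1 = 0]))).
    apply: le_pr => //; first exact: measurableU.
    move=> u /= [j [jk ju]]; move: jk; rewrite ltnS leq_eqVlt => /predU1P[<-|jk]; [by right|left].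
    by exists j.
  by apply: (le_trans (pr_setU_le m _ _)) => //; rewrite walk_eq0_null addr0.
apply: (@le_trans _ _ (pr m (sneg n `|` Z n))).
  apply: le_pr; [exact: measurable_negset|apply: measurableU => //; exact: measurable_sneg|].
  move=> u H; have [Zu|nZ] := pselect (Z n u); [by right|left] => -[//|j] /andP[_ jn].
  rewrite lt_neqAle -arx_walk H ?jn//= andbT arx_walk; apply/eqP => ju.
  by apply: nZ; exists j.
apply: (le_trans (pr_setU_le m (measurable_sneg _) _)) => //.
by rewrite -[leRHS]addr0 lerD2l.
Qed.

Definition revn k (i : nat) := if (i < k)%N then (k - i.+1)%N else i.

Lemma revn_inj k : injective (revn k).
Proof. clear; move=> i j; rewrite /revn; case: (ltnP i k) => ?; case: (ltnP j k) => ?; lia. Qed.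

Lemma first_argmax (f : nat -> R) n : exists k, [/\ (k <= n)%N,
  forall i, (i <= n)%N -> f i <= f k & forall i, (i < k)%N -> f i < f k].
Proof.
elim: n => [|n [k [kn H1 H2]]]; first by exists 0%N; split => // i; rewrite leqn0 => /eqP ->.
have [le|lt] := leP (f n.+1) (f k).
  exists k; split => //; first exact: leq_trans (leqnSn n).
  by move=> i; rewrite leq_eqVlt => /predU1P[->//|]; rewrite ltnS; exact: H1.
exists n.+1; split => // i; last first.
  by rewrite ltnS => /H1 h; exact: le_lt_trans lt.
by rewrite leq_eqVlt => /predU1P[->//|]; rewrite ltnS => /H1 h; exact/ltW/le_lt_trans/lt.
Qed.

Definition bwd k : set seqT := [set u | forall j, (1 <= j <= k)%N -> walk u (k - j) < walk u k].

Lemma measurable_bwd k : measurable (bwd k).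
Proof.
apply: (@measurable_forall_lt R _ seqT (fun j => 1 <= j <= k)%N (fun j u => walk u (k - j)) (fun _ u => walk u k)) => j;
  exact: measurable_walk.
Qed.

Lemma walk_revn (u : nat -> R) k j : (j <= k)%N ->
  walk (fun i => - u (revn k i)) j = walk u (k - j) - walk u k.
Proof.
elim: j => [|j IHj] jk; first by rewrite walk0 subn0 subrr.
rewrite walkS IHj ?(ltnW jk)// /revn jk.
have -> : (k - j = (k - j.+1).+1)%N by lia.
by rewrite walkS; ring.
Qed.

Lemma pr_bwd k : pr m (bwd k) = pN 1 0 k.
Proof.
rewrite -pr_sneg /pr (probE _ (measurable_bwd k)) (probE _ (measurable_sneg k)).
have [sg _ _ _] := tg.
congr fine; rewrite [RHS](integral_sym gm sg)//; last by apply: EFin_indic_measurable; exact: measurable_sneg.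
have mo : measurable_fun setT (fun u : seqT => (\- u : seqT)).
  by apply: measurable_seqfun => i; apply: measurable_funN; exact: measurable_coord.
rewrite [RHS](@integral_permute _ g m gm (revn k) (fun u => (\1_(sneg k) (\- u : seqT))%:E))//; last 2 first.
- exact: revn_inj.
- by apply: (measurableT_comp (EFin_indic_measurable _) mo); exact: measurable_sneg.
apply: eq_integral => u _; congr (_%:E); rewrite !indicE; congr (_%:R); congr nat_of_bool.
apply/idP/idP; rewrite !inE => H j /andP[j1 jk]; have := H j; rewrite j1 jk => /(_ isT).
  by rewrite -subr_lt0 -walk_revn.
by rewrite [walk _ _](walk_revn u jk) subr_lt0.
Qed.

Lemma sparre_andersen n : pN 1 0 n = cbin n.
Proof.
have q0 : pN 1 0 0 = 1.
  rewrite /pr (_ : neg 1 0 0 = setT) ?probability_setT//.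
  by apply/seteqP; split => // u _ [].
apply: (conv_unique (a := fun n => pN 1 0 n)) => // [{}n|]; last exact: cbin_conv.
pose A k : set seqT := bwd k `&` [set u : seqT | neg 1 0 (n - k)%N (fun i => u (k + i)%N)].
have mA k : measurable (A k).
  apply: measurableI; first exact: measurable_bwd.
  by rewrite -[X in measurable X]setTI; apply: measurable_shift => //; exact: measurable_negset.
have EA k : m (A k) = (pN 1 0 k * pN 1 0 (n - k)%N)%:E.
  rewrite /A (prob_prefix_shift gm); [|exact: measurable_bwd|exact: measurable_negset|].
    by rewrite EFinM -pr_bwd (prE m (measurable_bwd k)) (prE m (measurable_negset _ _ _)).
  have we (u v : seqT) j : (forall i, (i < k)%N -> u i = v i) -> (j <= k)%N -> walk u j = walk v j.
    by move=> uv jk; apply: eq_bigr => i _; apply: uv; apply: leq_trans jk.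
  by move=> u v uv H j jk; rewrite -!(we u v)// ?leq_subr//; exact: H.
apply: EFin_inj; rewrite -sumEFin.
under eq_bigr do rewrite -EA (probE _ (mA _)).
rewrite -ge0_integral_sum//; last by move=> k; exact: EFin_indic_measurable.
rewrite -(probability_setT m) -[RHS]mul1e -integral_cst//.
apply: eq_integral => u _ /=; rewrite sumEFin; congr (_%:E).
have [k [kn H1 H2]] := first_argmax (walk u) n.
pose k' : 'I_n.+1 := Ordinal (kn : (k < n.+1)%N).
rewrite (bigD1 k')//= big1 ?addr0.
  rewrite indicE mem_set//; split=> j.
    by move=> /andP[j1 jk]; apply: H2; rewrite ltn_subrL j1/=; exact: leq_trans jk.
  move=> /andP[j1 jn]; rewrite arx_walk; have := H1 (k + j)%N; rewrite walk_shift.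
  have -> : (k + j <= n)%N by lia.
  by move=> /(_ isT); lra.
move=> i ik; rewrite indicE memNset// => -[B F].
have {}ik : nat_of_ord i <> k by move=> e; move/eqP: ik; apply; apply: val_inj.
have i_n : (i <= n)%N by rewrite -ltnS.
case: (ltngtP i k) => [lt|gt|//].
  have := F (k - i)%N; rewrite subn_gt0 lt leq_sub2r// => /(_ isT).
  have := H2 i lt; rewrite arx_walk -{1}(subnKC (ltnW lt)) walk_shift; lra.
have := B (i - k)%N; rewrite subn_gt0 gt leq_subr => /(_ isT).
by rewrite subKn ?(ltnW gt)//; have := H1 i i_n; lra.
Qed.

Lemma arx01 u n : arx 0 1 u n.*2 = walk (fun i => u i.*2.+1) n /\
  arx 0 1 u n.*2.+1 = walk (fun i => u i.*2) n.+1.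
Proof.
elim: n => [|n [IH1 IH2]]; first by rewrite arx0 walk0 arx1 walkS walk0 add0r.
have e : arx 0 1 u n.+1.*2 = walk (fun i => u i.*2.+1) n.+1.
  by rewrite doubleS arxSS IH1 walkS; ring.
by split => //; rewrite doubleS arxSS -doubleS IH2 [RHS]walkS doubleS; ring.
Qed.

Lemma neg01 N : pN 0 1 N = cbin (uphalf N) * cbin N./2.
Proof.
rewrite -!sparre_andersen.
apply: EFin_inj; rewrite EFinM -!prE; try exact: measurable_negset.
rewrite probE; last exact: measurable_negset.
rewrite (@integral_smerge _ g m gm (fun i => ~~ odd i) half)//; last 2 first.
- move=> i j /(congr1 negb); rewrite !negbK => oij hij.
  by rewrite -(odd_double_half i) -(odd_double_half j) oij hij.
- by apply: EFin_indic_measurable; exact: measurable_negset.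
have mn a1 a2 n := @measurable_negset R a1 a2 n.
rewrite (probE _ (mn 1 0 (uphalf N))) -ge0_integralZr//; last exact: EFin_indic_measurable.
apply: eq_integral => u _.
rewrite (probE _ (mn 1 0 N./2)) -ge0_integralZl//; last exact: EFin_indic_measurable.
apply: eq_integral => v _; rewrite -EFinM; congr (_%:E); rewrite !indicE.
have sE (w : seqT) : w = smerge (fun i => ~~ odd i) half (u, v) ->
    (forall i, w i.*2 = u i) /\ (forall i, w i.*2.+1 = v i).
  move=> ->; split => i; rewrite /smerge /= odd_double /= ?doubleK//.
  by rewrite uphalf_double.
move: (smerge _ _ _) sE => w /(_ w erefl) [we wo].
have W1 k : arx 0 1 w k.*2 = walk v k.
  by rewrite (arx01 w k).1; apply: eq_bigr => i _; rewrite wo.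
have W2 k : arx 0 1 w k.*2.+1 = walk u k.+1.
  by rewrite (arx01 w k).2; apply: eq_bigr => i _; rewrite we.
have -> : (w \in neg 0 1 N) = (u \in neg 1 0 (uphalf N)) && (v \in neg 1 0 N./2).
  apply/idP/andP; rewrite !inE.
    move=> H; split => j /andP[j1 jN]; rewrite arx_walk.
      case: j j1 jN => // j _ jN; rewrite -W2; apply: H; rewrite /=.
      by move: jN; rewrite uphalfE; lia.
    by rewrite -W1; apply: H; lia.
  move=> [Hu Hv] j /andP[j1 jN]; rewrite -(odd_double_half j); case: (boolP (odd j)) => oj.
    rewrite add1n W2 -arx_walk; apply: Hu; rewrite /= uphalfE; lia.
  by rewrite add0n W1 -arx_walk; apply: Hv; move: (odd_double_half j) oj; case: odd => //; lia.
by case: (u \in _); case: (v \in _); rewrite ?mulr0 ?mul0r ?mulr1.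
Qed.

Lemma neg01_cvg : exists c : R, 0 < c /\ (pN 0 1 N / (c * N%:R^-1)) @[N --> \oo] --> (1 : R).
Proof.
have [c [c0 cv r0]] := @cbin_cvg R.
exists (2 * c); split; first by rewrite mulr_gt0.
have halfoo : (n./2 @[n --> \oo]) --> \oo.
  by move=> A [k _ Ak]; exists k.*2 => // n /= kn; apply: Ak => /=; lia.
have uhalfoo : (uphalf n @[n --> \oo]) --> \oo.
  by move=> A [k _ Ak]; exists k.*2 => // n /= kn; apply: Ak => /=; rewrite uphalfE; lia.
pose lo n : R := (2 * ((uphalf n)%:R * cbin (uphalf n) ^+ 2) - cbin (uphalf n) ^+ 2) / (2 * c).
pose hi n : R := (2 * (n./2%:R * cbin n./2 ^+ 2) + cbin n./2 ^+ 2) / (2 * c).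
have one : (1 : R) = (2 * c - 0) / (2 * c) by rewrite subr0 divff// gt_eqF// mulr_gt0.
have one' : (1 : R) = (2 * c + 0) / (2 * c) by rewrite addr0 divff// gt_eqF// mulr_gt0.
have clo : lo n @[n --> \oo] --> (1 : R).
  rewrite [X in _ --> X]one; apply: cvgMr_tmp; apply: cvgB.
    by apply: cvgMl_tmp; exact: (cvg_comp _ _ uhalfoo cv).
  exact: (cvg_comp _ _ uhalfoo r0).
have chi : hi n @[n --> \oo] --> (1 : R).
  rewrite [X in _ --> X]one'; apply: cvgMr_tmp; apply: cvgD.
    by apply: cvgMl_tmp; exact: (cvg_comp _ _ halfoo cv).
  exact: (cvg_comp _ _ halfoo r0).
apply: (squeeze_cvgr _ clo chi); exists 1%N => // N /= N1.
have N0 : 0 < N%:R :> R by rewrite ltr0n.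
have -> : pN 0 1 N / (2 * c * N%:R^-1) = (N%:R * (cbin (uphalf N) * cbin N./2)) / (2 * c).
  by rewrite neg01; field; rewrite !gt_eqF.
have c20 : 0 <= (2 * c)^-1 by rewrite invr_ge0 mulr_ge0// ltW.
rewrite /lo /hi; apply/andP; split; apply: ler_wpM2r => //.
  have h1 : cbin (uphalf N) ^+ 2 <= cbin (uphalf N) * cbin N./2 :> R.
    rewrite expr2; apply: ler_wpM2l; first exact/ltW/cbin_gt0.
    by apply: cbin_le; rewrite uphalfE; lia.
  have h2 : 2 * (uphalf N)%:R - 1 <= N%:R :> R.
    by rewrite lerBlDr -natrM natr1 ler_nat uphalfE; lia.
  have h3 : 0 <= cbin (uphalf N) ^+ 2 :> R by exact: sqr_ge0.
  apply: (@le_trans _ _ (N%:R * cbin (uphalf N) ^+ 2)); last by apply: ler_wpM2l => //; exact: ltW.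
  by move: (cbin _ ^+ 2) h3 (uphalf N)%:R (N%:R : R) h2 => z z0 a b ab; nra.
have h1 : cbin (uphalf N) * cbin N./2 <= cbin N./2 ^+ 2 :> R.
  rewrite expr2; apply: ler_wpM2r; first exact/ltW/cbin_gt0.
  by apply: cbin_le; rewrite uphalfE; lia.
have h2 : N%:R <= 2 * N./2%:R + 1 :> R by rewrite -natrM natr1 ler_nat; lia.
have h3 : 0 <= cbin N./2 ^+ 2 :> R by exact: sqr_ge0.
apply: (@le_trans _ _ (N%:R * cbin N./2 ^+ 2)); first by apply: ler_wpM2l => //; exact: ltW.
by move: (cbin _ ^+ 2) h3 N./2%:R (N%:R : R) h2 => z z0 a b ab; nra.
Qed.

End random_walk.

(** * Concave majorants of integrated walks *)

Section integrated_walk_paths.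
Context {R : realType}.
Implicit Types u : nat -> R.

Definition iwalk u n := \sum_(i < n) walk u i.+1.

Lemma iwalkS u n : iwalk u n.+1 = iwalk u n + walk u n.+1.
Proof. by rewrite /iwalk big_ord_recr. Qed.

Lemma iwalk0 u : iwalk u 0 = 0.
Proof. by rewrite /iwalk big_ord0. Qed.

Lemma arx_iwalk u n : arx 2 (- 1) u n = iwalk u n.
Proof.
have [] // : arx 2 (- 1) u n = iwalk u n /\ arx 2 (- 1) u n.+1 = iwalk u n.+1.
elim: n => [|n [IH1 IH2]].
  by rewrite arx0 iwalk0 arx1 iwalkS iwalk0 walkS walk0 !add0r.
split=> //; rewrite arxSS IH1 IH2 (iwalkS u n.+1) (walkS u n.+1) !iwalkS; ring.
Qed.

Lemma iwalk_shift1 u n : iwalk u n.+1 = n.+1%:R * u 0%N + iwalk (fun i => u (1 + i)%N) n.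
Proof.
have w k : walk u k.+1 = u 0%N + walk (fun i => u (1 + i)%N) k by rewrite (walk_shift u 1) walkS walk0 add0r.
elim: n => [|n IHn]; first by rewrite iwalkS !iwalk0 w walk0; ring.
by rewrite iwalkS IHn iwalkS w -[n.+2%:R]natr1; ring.
Qed.

Definition bk k u : nat -> R := fun i => u (revn k.+1 (1 + i)%N).
Definition fw k u : nat -> R := fun i => u (k.+1 + i)%N.

Lemma iwalk_fw u k j : iwalk u (k + j.+1) - iwalk u k = j.+1%:R * walk u k.+1 + iwalk (fw k u) j.
Proof.
elim: j => [|j IHj]; first by rewrite addn1 iwalkS iwalk0; ring.
rewrite addnS iwalkS addrAC IHj iwalkS -[(k + j.+1).+1]/((k.+1) + j.+1)%N walk_shift -/(fw k u).
by rewrite -[j.+2%:R]natr1; ring.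
Qed.

Lemma walk_bk u k j : (j <= k)%N -> walk (bk k u) j = walk u k - walk u (k - j).
Proof.
elim: j => [|j IHj] jk; first by rewrite walk0 subn0 subrr.
rewrite walkS IHj ?(ltnW jk)// /bk /revn ltnS add1n jk subSS.
have -> : (k - j = (k - j.+1).+1)%N by lia.
by rewrite walkS; ring.
Qed.

Lemma iwalk_bk u k j : (j < k)%N ->
  iwalk u k - iwalk u (k - j.+1) = j.+1%:R * walk u k - iwalk (bk k u) j.
Proof.
elim: j => [|j IHj] jk.
  by case: k jk => // k _; rewrite iwalk0 subn1 /= iwalkS; ring.
have := IHj (ltnW jk); have -> : (k - j.+1 = (k - j.+2).+1)%N by lia.
rewrite iwalkS [iwalk _ j.+1]iwalkS walk_bk; last exact: ltnW.
have -> : (k - j.+1 = (k - j.+2).+1)%N by lia.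
rewrite -[j.+2%:R]natr1; lra.
Qed.

Definition below (x : R) a u := forall i, (1 <= i <= a)%N -> iwalk u i <= i%:R * x.

Definition dn (y : R) := Num.max (- y) 0.

Lemma dn_ge0 y : 0 <= dn y. Proof. by rewrite le_max lexx orbT. Qed.

Lemma dn_lt0 y : y <= 0 -> dn y = - y.
Proof. by move=> y0; rewrite /dn max_l// oppr_ge0. Qed.

(* The indices [k] with [good] below are vertices of the concave majorant of the
   integrated walk, along which the slopes [walk u k] decrease. *)
Definition good n u k := below 0 k (bk k u) /\ below 0 (n - k.+1) (fw k u).

Lemma good_slopes n u k k' : (k < k' < n)%N -> good n u k -> good n u k' ->
  walk u k' <= walk u k.+1.
Proof.
move=> /andP[kk kn] [_ fk] [bk' _].
pose j := (k' - k.+1)%N.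
have jE : k' = (k + j.+1)%N by rewrite /j; lia.
have := iwalk_fw u k j; rewrite -jE.
have jk' : (j < k')%N by rewrite /j; lia.
have := iwalk_bk u jk'; have -> : (k' - j.+1 = k)%N by rewrite /j; lia.
have h1 : iwalk (fw k u) j <= 0.
  case E : j => [|i]; first by rewrite iwalk0.
  have := fk i.+1; rewrite mulr0; apply; rewrite /= -E /j; lia.
have h2 : iwalk (bk k' u) j <= 0.
  case E : j => [|i]; first by rewrite iwalk0.
  have := bk' i.+1; rewrite mulr0; apply; rewrite /= -E /j; lia.
have j0 : 0 < j.+1%:R :> R by rewrite ltr0n.
move=> e1 e2; rewrite -(ler_pM2l j0); lra.
Qed.

Lemma good_sum_le n u (lo hi : R) : (forall i, (i <= n)%N -> lo <= walk u i <= hi) ->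
  \sum_(k < n) dn (u k) * (`[< good n u k >])%:R <= hi - lo.
Proof.
move=> H.
suff key j : (j <= n)%N -> forall z : R, z <= hi ->
    (forall k, (k < j)%N -> good n u k -> z <= walk u k.+1) ->
    \sum_(k < j) dn (u k) * (`[< good n u k >])%:R <= hi - z.
  apply: key => //; first by case/andP: (H 0%N (leq0n _)); exact: le_trans.
  by move=> k kn _; case/andP: (H k.+1 kn).
elim: j => [_ z zh _|j IHj jn z zh Hz]; first by rewrite big_ord0 subr_ge0.
rewrite big_ord_recr/=; case: asboolP => [gj|_]; last first.
  rewrite mulr0 addr0; apply: IHj => //; first exact: ltnW.
  by move=> k kj; apply: Hz; exact: ltnW.
rewrite mulr1; have [u0|u0] := leP (u j) 0; last first.
  rewrite /dn max_r ?oppr_le0 ?(ltW u0)// addr0; apply: IHj => //; first exact: ltnW.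
  by move=> k kj; apply: Hz; exact: ltnW.
have := IHj (ltnW jn) (walk u j); have /andP[_ ->] := H j (ltnW jn).
move=> /(_ isT) h; rewrite dn_lt0//.
have : \sum_(k < j) dn (u k) * (`[< good n u k >])%:R <= hi - walk u j.
  apply: h => k kj gk; apply: (@good_slopes n) => //; by rewrite kj.
by have := Hz j (ltnSn j) gj; rewrite walkS; lra.
Qed.

Definition wgood n u k := below (2 * dn (u k)) k.-1 (bk k u) /\
  below (2 * dn (u k)) (n - k.+1) (fw k u).

Lemma slope_covered n u (s : R) : walk u n < s <= 0 ->
  exists k, [/\ (k < n)%N, walk u k.+1 <= s <= walk u k & wgood n u k].
Proof.
move=> /andP[ns s0].
pose B i := iwalk u i - s * i%:R.
have [k [kn H1 H2]] := first_argmax B n.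
have BS i : B i.+1 - B i = walk u i.+1 - s by rewrite /B iwalkS -natr1; ring.
have k_n : (k < n)%N.
  rewrite ltn_neqAle kn andbT; apply/eqP => kE.
  case: k kE kn H1 H2 => [kE _ _ _|k kE _ _ /(_ k (ltnSn k))].
    by move: ns; rewrite -kE walk0 ltNge s0.
  by have := BS k; rewrite kE => h1 h2; lra.
have c1 : walk u k.+1 <= s by have := H1 k.+1 k_n; have := BS k; lra.
have c2 : s <= walk u k.
  case: k {c1 k_n} kn H1 H2 => [_ _ _|k _ _ /(_ k (ltnSn k))]; first by rewrite walk0.
  by have := BS k; lra.
have uk : u k <= 0 by move: c1 c2; rewrite walkS; lra.
have dk : dn (u k) = walk u k - walk u k.+1 by rewrite dn_lt0// walkS; ring.
exists k; split=> //; first by rewrite c1.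
have i2 (i : nat) : (1 <= i)%N -> i.+1%:R <= 2 * i%:R :> R by move=> i1; rewrite -natrM ler_nat; lia.
split=> i /andP[i1 ia].
  have ik : (i < k)%N by lia.
  have := iwalk_bk u ik; have := H1 (k - i.+1)%N; rewrite /B natrB//.
  have -> : (k - i.+1 <= n)%N by lia.
  move=> /(_ isT) h e.
  have : iwalk (bk k u) i <= i.+1%:R * (walk u k - s) by lra.
  have i0 : 0 <= i.+1%:R :> R by [].
  have : i.+1%:R * (walk u k - s) <= i.+1%:R * dn (u k).
    by apply: ler_wpM2l => //; rewrite dk; lra.
  have := ler_wpM2r (dn_ge0 (u k)) (i2 _ i1); lra.
have := iwalk_fw u k i; have := H1 (k + i.+1)%N; rewrite /B natrD.
have -> : (k + i.+1 <= n)%N by lia.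
move=> /(_ isT) h e.
have : iwalk (fw k u) i <= i.+1%:R * (s - walk u k.+1) by lra.
have i0 : 0 <= i.+1%:R :> R by [].
have : i.+1%:R * (s - walk u k.+1) <= i.+1%:R * dn (u k).
  by apply: ler_wpM2l => //; rewrite dk; lra.
have := ler_wpM2r (dn_ge0 (u k)) (i2 _ i1); lra.
Qed.

Lemma wgood_sum_ge n u : dn (walk u n) <= \sum_(k < n) dn (u k) * (`[< wgood n u k >])%:R.
Proof.
have [w0|w0] := leP (walk u n) 0; last first.
  rewrite /dn max_r ?oppr_le0 ?(ltW w0)//; apply: sumr_ge0 => k _.
  by apply: mulr_ge0 => //; exact: dn_ge0.
rewrite dn_lt0//.
pose I k : set (measurableTypeR R) := if `[< wgood n u k >] then `[walk u k.+1, walk u k]%classic else set0.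
have mI k : measurable (I k) by rewrite /I; case: ifP.
have : (lebesgue_measure `]walk u n, 0%R]%classic <= \sum_(k < n) lebesgue_measure (I k))%E.
  apply: (@le_trans _ _ (lebesgue_measure (\big[setU/set0]_(k < n) I k))).
    apply: le_measure; rewrite ?inE//; first by apply: bigsetU_measurable.
    move=> s /=; rewrite in_itv/= => /slope_covered [k [kn sk gk]].
    rewrite -bigcup_mkord; exists k => //=; rewrite /I asboolT//= in_itv.
  exact: Boole_inequality.
rewrite lebesgue_measure_itv/= lte_fin.
have hk k : (lebesgue_measure (I k) <= (dn (u k) * (`[< wgood n u k >])%:R)%:E)%E.
  rewrite /I; case: asboolP => _; last by rewrite measure0 lee_fin mulr0.
  rewrite lebesgue_measure_itv/= lte_fin mulr1.
  case: ltP => [lt|_]; last by rewrite lee_fin dn_ge0.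
  have e := walkS u k; rewrite dn_lt0; last by lra.
  by apply: (@le_trans _ _ (walk u k - walk u k.+1)%:E) => //; rewrite lee_fin; lra.
move=> h; have {h} : ((if (walk u n < 0)%R then (0%:E + (- walk u n)%:E) else 0) <=
   \sum_(k < n) (dn (u k) * (`[< wgood n u k >])%:R)%:E)%E.
  by apply: (le_trans h); apply: lee_sum => k _; exact: hk.
rewrite sumEFin; case: ltP => [_|w1].
  by move=> h; rewrite -lee_fin; apply: le_trans h; rewrite -[leRHS]/((0 - walk u n)%:E) sub0r.
by move=> _; have -> : walk u n = 0 by [lra|apply/eqP; rewrite eq_le w0];
  rewrite oppr0; apply: sumr_ge0 => k _; apply: mulr_ge0 => //; exact: dn_ge0.
Qed.

Fixpoint mabs (s b : R) u n :=
  if n is n'.+1 then Num.max (mabs s b u n') `|s + walk u n| else b.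

Lemma mabs_ge s b u n i : (i <= n)%N -> `|s| <= b -> `|s + walk u i| <= mabs s b u n.
Proof.
move=> + sb; elim: n => [|n IHn]; first by rewrite leqn0 => /eqP ->; rewrite walk0 addr0.
rewrite leq_eqVlt => /predU1P[->|]; first by rewrite /= le_max lexx orbT.
by rewrite ltnS => /IHn h; rewrite /= le_max h.
Qed.

End integrated_walk_paths.

(** * The integrated random walk *)

Section integrated_walk.
Context {R : realType} (g : probability R R).
Hypothesis tg : tame g.
Variable m : probability (@seqT R) R.
Hypothesis gm : iid_law g m.
Local Notation seqT := (@seqT R).
Local Notation pN a1 a2 N := (pr m (neg a1 a2 N)).

Lemma measurable_iwalk n : measurable_fun setT (fun u : seqT => iwalk u n).
Proof.
apply: (eq_measurable_fun (fun u : seqT => arx 2 (- 1) u n)) => [u _|]; first exact: arx_iwalk.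
exact: measurable_arx.
Qed.

Definition belowset (x : R) a : set seqT := [set u | below x a u].

Lemma measurable_below x a : measurable (belowset x a).
Proof.
apply: (@measurable_forall_le R _ seqT (fun i => 1 <= i <= a)%N (fun i u => iwalk u i) (fun i _ => i%:R * x)) => i.
  exact: measurable_iwalk.
exact: measurable_cst.
Qed.

Definition ip x a := pr m (belowset x a).

Lemma ip0 a : ip 0 a = pN 2 (- 1) a.
Proof.
congr (pr m _); apply/seteqP; split => u H i /H; rewrite arx_iwalk mulr0; exact.
Qed.

Lemma ip_ge0 x a : 0 <= ip x a. Proof. exact: pr_ge0. Qed.

Lemma ip_le1 x a : ip x a <= 1. Proof. by apply: pr_le1; exact: measurable_below. Qed.

Lemma ip_decr x a a' : (a <= a')%N -> ip x a' <= ip x a.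
Proof.
move=> aa; apply: le_pr; try exact: measurable_below.
by move=> u H i /andP[i1 ia]; apply: H; rewrite i1 (leq_trans ia).
Qed.

Lemma ip_incr x x' a : x <= x' -> ip x a <= ip x' a.
Proof.
move=> xx; apply: le_pr; try exact: measurable_below.
by move=> u H i ia; apply: (le_trans (H i ia)); exact: ler_wpM2l.
Qed.

Local Notation b := (fine (g `]-oo, -1]%classic)).
Let b0 : 0 < b := ray_gt0 tg (-1).

Lemma ip_shift x a : 0 <= x -> b * ip (x + 1) a <= ip x a.+1.
Proof.
move=> x0.
pose A : set seqT := [set u | u 0%N \in `]-oo, -1]].
have mA : measurable A.
  rewrite [X in measurable X](_ : _ = [set u : seqT | u 0%N <= -1]).
    by apply: measurable_le_set => //; exact: measurable_coord.
  by apply/seteqP; split => u /=; rewrite /A /= in_itv.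
have bA : b = pr m A.
  by rewrite /pr -(prob_coord gm 0 (B := `]-oo, -1]%classic)).
apply: (@le_trans _ _ (pr m (A `&` [set u : seqT | belowset (x + 1) a (fun i => u (1 + i)%N)]))).
  rewrite /pr (prob_prefix_shift gm mA (measurable_below _ _)); last first.
    by move=> u v uv; rewrite /A /= uv.
  have -> : m A = (pr m A)%:E by exact: prE.
  have -> : m (belowset (x + 1) a) = (ip (x + 1) a)%:E by apply: prE; exact: measurable_below.
  by rewrite /= bA.
apply: le_pr; last 1 first.
- move=> u [Au Bu] [//|i] /andP[_ ia]; rewrite iwalk_shift1.
  have u0 : u 0%N <= -1 by move: Au; rewrite /A /= in_itv.
  have i0 : 0 <= i%:R :> R by [].
  have h : iwalk (fun i => u (1 + i)%N) i <= i%:R * (x + 1).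
    by case: i ia {i0} => [|i] ia; [rewrite iwalk0 mul0r|exact: Bu].
  rewrite -natr1; have : (i%:R + 1) * u 0%N <= (i%:R + 1) * -1 by apply: ler_wpM2l => //; lra.
  lra.
- apply: measurableI => //.
  by rewrite -[X in measurable X]setTI; apply: measurable_shift => //; exact: measurable_below.
- exact: measurable_below.
Qed.

Lemma ip_ub : exists t, 0 <= t /\ forall x a, 0 <= x -> ip x a <= expR (t * (x + 1)) * ip 0 a.
Proof.
have b1 : b <= 1 by exact/ltW/ray_lt1.
exists (- ln b); have t0 : 0 <= - ln b by rewrite oppr_ge0 ln_le0.
split=> // x a x0.
have step y : 0 <= y -> ip (y + 1) a <= b^-1 * ip y a.
  move=> y0; rewrite ler_pdivlMl//; apply: (le_trans (ip_shift a y0)).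
  exact: ip_decr.
have H k : ip k%:R a <= expR (- ln b * k%:R) * ip 0 a.
  elim: k => [|k IHk]; first by rewrite mulr0 expR0 mul1r.
  rewrite -natr1; apply: (le_trans (step _ _)) => //.
  have -> : expR (- ln b * (k%:R + 1)) = b^-1 * expR (- ln b * k%:R).
    by rewrite mulrDr mulr1 expRD mulrC expRN lnK.
  by rewrite -mulrA; apply: ler_wpM2l => //; rewrite invr_ge0 ltW.
have := truncnS_gt x; set k := (Num.truncn x).+1 => xk.
have kx : k%:R <= x + 1.
  by rewrite /k -natr1 lerD2r truncn_le.
apply: (le_trans (ip_incr a (ltW xk))); apply: (le_trans (H k)).
apply: ler_wpM2r; first exact: ip_ge0.
by rewrite ler_expR; apply: ler_wpM2l.
Qed.

Lemma measurable_dn : measurable_fun setT (@dn R).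
Proof. by apply: measurable_maxr => //; exact: oppr_measurable. Qed.

Lemma measurable_integral_scons (f : seqT -> \bar R) : measurable_fun setT f ->
  (forall u, 0 <= f u)%E -> measurable_fun setT (fun y => \int[m]_v f (scons y v))%E.
Proof.
move=> mf f0.
have mf' : measurable_fun setT (fun yv : R * seqT => f (scons yv.1 yv.2)).
  exact: (measurableT_comp mf measurable_scons).
exact: (@measurable_fun_fubini_tonelli_F _ _ R seqT R m _ mf' (fun=> f0 _)).
Qed.

(* Exposing the coordinate [k] makes the two sides of the walk independent. *)
Lemma integral_two_sided k a c (x : R -> R) : (a <= k)%N -> measurable_fun setT x ->
  measurable_fun setT (fun u : seqT => (dn (u k) * (`[< below (x (u k)) a (bk k u) /\
    below (x (u k)) c (fw k u) >])%:R)%:E) /\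
  measurable_fun setT (fun y => (dn y * (ip (x y) a * ip (x y) c))%:E) /\
  (\int[m]_u (dn (u k) * (`[< below (x (u k)) a (bk k u) /\ below (x (u k)) c (fw k u) >])%:R)%:E
   = \int[g]_y (dn y * (ip (x y) a * ip (x y) c))%:E)%E.
Proof.
move=> ak mx.
pose W : set seqT := [set w | below (x (w 0%N)) a (fun i => w (1 + i)%N) /\
    below (x (w 0%N)) c (fun i => w (k.+1 + i)%N)].
pose H (w : seqT) : R := dn (w 0%N) * \1_W w.
have mW : measurable W.
  have aux l h : measurable [set w : seqT | below (x (w 0%N)) h (fun i => w (l + i)%N)].
    apply: (@measurable_forall_le R _ seqT (fun i => 1 <= i <= h)%N
      (fun i w => iwalk (fun j => w (l + j)%N) i) (fun i w => i%:R * x (w 0%N))) => i.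
      exact: (measurableT_comp (measurable_iwalk i) (measurable_shift l)).
    apply: measurable_funM; first exact: measurable_cst.
    by apply: measurableT_comp => //; exact: measurable_coord.
  by apply: measurableI; exact: aux.
have mH : measurable_fun setT (fun w => (H w)%:E).
  apply/measurable_EFinP; apply: measurable_funM; last exact: measurable_indic.
  by apply: (measurableT_comp measurable_dn); exact: measurable_coord.
have H0 w : (0 <= (H w)%:E)%E by rewrite lee_fin mulr_ge0// dn_ge0.
have inner y : (\int[m]_v (H (scons y v))%:E = (dn y * (ip (x y) a * ip (x y) c))%:E)%E.
  rewrite (eq_integral (fun v => ((dn y)%:E * (\1_(belowset (x y) a `&`
      [set v : seqT | belowset (x y) c (fun i => v (k + i)%N)]) v)%:E)%E)); last first.
    by move=> v _; rewrite /H /= -EFinM.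
  have mB : measurable (belowset (x y) a `&` [set v : seqT | belowset (x y) c (fun i => v (k + i)%N)]).
    apply: measurableI; first exact: measurable_below.
    by rewrite -[X in measurable X]setTI; apply: measurable_shift => //; exact: measurable_below.
  rewrite ge0_integralZl//; last 2 first.
  - exact: EFin_indic_measurable.
  - by rewrite lee_fin dn_ge0.
  rewrite -(probE m mB) (prob_prefix_shift gm); try exact: measurable_below.
    by rewrite (prE m (measurable_below (x y) a)) (prE m (measurable_below (x y) c)).
  move=> u v uv Hu i /andP[i1 ia]; rewrite (_ : iwalk v i = iwalk u i) ?Hu ?i1//.
  apply: eq_bigr => j _; apply: eq_bigr => l _; rewrite uv//.
  have := ltn_ord l; have := ltn_ord j; lia.
have HE (u : seqT) : dn (u k) * (`[< below (x (u k)) a (bk k u) /\ below (x (u k)) c (fw k u) >])%:R =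
    H (u \o revn k.+1).
  have e0 : (u \o revn k.+1) 0%N = u k by rewrite /= /revn ltn0Sn subSS subn0.
  have e2 : (fun i => (u \o revn k.+1) (k.+1 + i)%N) = fw k u.
    by apply/funext => i; rewrite /fw /= /revn ltnNge leq_addr.
  have WE : W (u \o revn k.+1) = (below (x ((u \o revn k.+1) 0%N)) a (bk k u) /\
    below (x ((u \o revn k.+1) 0%N)) c (fun i => (u \o revn k.+1) (k.+1 + i)%N)) by [].
  rewrite e0 e2 in WE; rewrite /H e0; congr (_ * _); rewrite indicE; case: asboolP => h.
    by rewrite mem_set// WE.
  by rewrite memNset// WE.
split; [|split].
- apply: (eq_measurable_fun (fun u : seqT => (H (u \o revn k.+1))%:E)) => [u _|]; first by rewrite HE.
  apply: (measurableT_comp mH); apply: measurable_seqfun => i; exact: measurable_coord.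
- apply: (eq_measurable_fun (fun y => \int[m]_v (H (scons y v))%:E)%E) => [y _|].
    exact: inner.
  exact: (measurable_integral_scons mH).
transitivity (\int[m]_u (H (u \o revn k.+1))%:E)%E.
  by apply: eq_integral => u _; rewrite HE.
rewrite -(integral_permute gm (s := revn k.+1) (f := fun w => (H w)%:E))//; last exact: revn_inj.
by rewrite (integral_scons gm)//; apply: eq_integral => y _; exact: inner.
Qed.

Lemma integral_g_opp (h : R -> R) : measurable_fun setT h -> (forall y, 0 <= h y) ->
  (\int[g]_y (h y)%:E = \int[g]_y (h (- y))%:E)%E.
Proof.
move=> mh h0; have [sg _ _ _] := tg.
have mo : measurable_fun setT (-%R : R -> R) by exact: oppr_measurable.
pose om : {mfun R >-> R} := HB.pack (-%R : R -> R) (isMeasurableFun.Build _ _ _ _ _ mo).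
have mhE : measurable_fun setT (fun y => (h y)%:E) by exact/measurable_EFinP.
have := @ge0_integral_pushforward _ _ R R R -%R mo g setT (fun y => (h y)%:E) measurableT mhE.
move=> <-; last by move=> y _; rewrite lee_fin.
apply: (@eq_measure_integral _ _ _ setT (pushforward g om) g) => A mA _.
by rewrite -[LHS]sg.
Qed.

Lemma integral_g_sym (h : R -> R) : measurable_fun setT h -> (forall y, 0 <= h y) ->
  (\int[g]_y (h y)%:E + \int[g]_y (h y)%:E = \int[g]_y (h y + h (- y))%:E)%E.
Proof.
move=> mh h0; rewrite {2}integral_g_opp//.
have mho : measurable_fun setT (fun y : R => h (- y)).
  by apply: (measurableT_comp mh); exact: oppr_measurable.
rewrite -ge0_integralD//.
- by move=> y _; rewrite lee_fin.
- exact/measurable_EFinP.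
- by move=> y _; rewrite lee_fin.
- exact/measurable_EFinP.
Qed.

Lemma integral_g_affine (f : R -> R) (F A B : R) : measurable_fun setT f -> (forall y, 0 <= f y) ->
  (\int[g]_y (f y)%:E = F%:E)%E -> 0 <= A -> 0 <= B ->
  (\int[g]_y (A + B * f y)%:E = (A + B * F)%:E)%E.
Proof.
move=> mf f0 EF A0 B0.
rewrite (eq_integral (fun y => A%:E + B%:E * (f y)%:E)%E)//.
rewrite ge0_integralD//; last 2 first.
- by move=> y _; apply: mule_ge0; rewrite lee_fin.
- by apply: emeasurable_funM => //; exact/measurable_EFinP.
have mfE : measurable_fun setT (fun y => (f y)%:E) by exact/measurable_EFinP.
have f0E y : (0 <= (f y)%:E)%E by rewrite lee_fin.
by rewrite integral_cst_g ge0_integralZl// EF.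
Qed.

Lemma integral_g_sym_le (f h : R -> R) (F A B : R) :
  measurable_fun setT h -> (forall y, 0 <= h y) ->
  measurable_fun setT f -> (forall y, 0 <= f y) ->
  (\int[g]_y (f y)%:E = F%:E)%E -> 0 <= A -> 0 <= B -> 0 <= F ->
  (forall y, h y + h (- y) <= 2 * (A + B * f y)) ->
  (\int[g]_y (h y)%:E <= (A + B * F)%:E)%E.
Proof.
move=> mh h0 mf f0 EF A0 B0 F0 H.
have mho : measurable_fun setT (fun y : R => h (- y)).
  by apply: (measurableT_comp mh); exact: oppr_measurable.
have : (\int[g]_y (h y)%:E + \int[g]_y (h y)%:E <= (2 * A + 2 * B * F)%:E)%E.
  rewrite integral_g_sym// -(integral_g_affine mf f0 EF) ?mulr_ge0//.
  apply: ge0_le_integral => //.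
  - by move=> y _; rewrite lee_fin addr_ge0.
  - by apply/measurable_EFinP; exact: measurable_funD.
  - apply/measurable_EFinP; apply: measurable_funD => //.
    by apply: measurable_funM.
  - by move=> y _; rewrite lee_fin; have := H y; lra.
have : (0 <= \int[g]_y (h y)%:E)%E by apply: integral_ge0 => y _; rewrite lee_fin.
case: (\int[g]_y (h y)%:E)%E => [r||]//=; rewrite !lee_fin => *; lra.
Qed.

Lemma integral_g_sym_ge (f h : R -> R) (F A B : R) :
  measurable_fun setT h -> (forall y, 0 <= h y) ->
  measurable_fun setT f -> (forall y, 0 <= f y) ->
  (\int[g]_y (f y)%:E = F%:E)%E -> 0 <= A -> 0 <= B -> 0 <= F ->
  (forall y, 2 * (A + B * f y) <= h y + h (- y)) ->
  ((A + B * F)%:E <= \int[g]_y (h y)%:E)%E.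
Proof.
move=> mh h0 mf f0 EF A0 B0 F0 H.
have mho : measurable_fun setT (fun y : R => h (- y)).
  by apply: (measurableT_comp mh); exact: oppr_measurable.
have : ((2 * A + 2 * B * F)%:E <= \int[g]_y (h y)%:E + \int[g]_y (h y)%:E)%E.
  rewrite integral_g_sym// -(integral_g_affine mf f0 EF) ?mulr_ge0//.
  apply: ge0_le_integral => //.
  - by move=> y _; rewrite lee_fin addr_ge0// !mulr_ge0.
  - apply/measurable_EFinP; apply: measurable_funD => //.
    by apply: measurable_funM.
  - by apply/measurable_EFinP; exact: measurable_funD.
  - by move=> y _; rewrite lee_fin; have := H y; lra.
have : (0 <= \int[g]_y (h y)%:E)%E by apply: integral_ge0 => y _; rewrite lee_fin.
case: (\int[g]_y (h y)%:E)%E => [r||]//=; rewrite ?lee_fin ?leey// => *; lra.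
Qed.

Lemma power_moment k : exists M : R, 0 <= M /\ (\int[g]_y (`|y| ^+ k.+1)%:E = M%:E)%E.
Proof.
apply: (@moment_fin R g tg (fun y => `|y| ^+ k.+1) (k.+1)`!%:R 1) => //.
- by apply: measurable_funX; exact: normr_measurable.
- move=> y; rewrite mul1r; have := @expR_ge1Dxn R `|y| k (normr_ge0 y).
  have f0 : 0 < (k.+1)`!%:R :> R by rewrite ltr0n fact_gt0.
  move=> h; rewrite -ler_pdivrMl// mulrC; lra.
Qed.

Lemma measurable_mabs s c n : measurable_fun setT (fun u : seqT => mabs s c u n).
Proof.
elim: n => [|n IHn] /=; first exact: measurable_cst.
apply: measurable_maxr => //; apply: measurableT_comp => //.
by apply: measurable_funD; [exact: measurable_cst|exact: measurable_walk].
Qed.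

Lemma mabs_scons s c y (v : seqT) n :
  mabs s c (scons y v) n.+1 = mabs (s + y) (Num.max c `|s + y|) v n.
Proof.
elim: n => [|n IHn]; first by rewrite /= walk_scons walk0 addr0.
by rewrite [LHS]/= -/(mabs s c (scons y v) n.+1) IHn walk_scons addrA.
Qed.

Lemma mabs_ge0 s c u n : 0 <= c -> 0 <= mabs s c u n :> R.
Proof. by move=> c0; elim: n => [//|n IHn] /=; rewrite le_max IHn. Qed.

Section moments.
Variables (V Q : R).
Hypotheses (V0 : 0 <= V) (Q0 : 0 <= Q).
Hypothesis EV : (\int[g]_y (`|y| ^+ 2)%:E = V%:E)%E.
Hypothesis EQ : (\int[g]_y (`|y| ^+ 4)%:E = Q%:E)%E.

Let mn k : measurable_fun setT (fun y : R => `|y| ^+ k).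
Proof. by apply: measurable_funX; exact: normr_measurable. Qed.

(* Doob's maximal inequality, through the supermartingale
   [4 s^2 - 4 c |s| + 2 c^2 - 4 V n] of the pair (walk, running maximum). *)
Lemma doob s c n : `|s| <= c ->
  (\int[m]_u (mabs s c u n ^+ 2)%:E <= (4 * s ^+ 2 - 4 * c * `|s| + 2 * c ^+ 2 + 4 * n%:R * V)%:E)%E.
Proof.
have nneg (t e : R) : 0 <= 4 * t ^+ 2 - 4 * e * `|t| + 2 * e ^+ 2.
  have := sqr_ge0 (2 * `|t| - e); have := sqr_ge0 e; rewrite -[t ^+ 2](real_normK (num_real t)).
  by move=> *; nra.
elim: n s c => [|n IHn] s c sc.
  rewrite /= (eq_integral (cst (c ^+ 2)%:E))// integral_cst// (iid_law_setT gm) mule1 lee_fin.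
  have := sqr_ge0 (2 * `|s| - c); rewrite -[s ^+ 2](real_normK (num_real s)); nra.
have mf : measurable_fun setT (fun u : seqT => (mabs s c u n.+1 ^+ 2)%:E).
  by apply/measurable_EFinP; apply: measurable_funX; exact: measurable_mabs.
have f0 (u : seqT) : (0 <= (mabs s c u n.+1 ^+ 2)%:E)%E by rewrite lee_fin sqr_ge0.
rewrite (integral_scons gm)//.
pose h y := 4 * (s + y) ^+ 2 - 4 * c * `|s + y| + 2 * c ^+ 2 + 4 * n%:R * V.
have mh : measurable_fun setT h.
  apply: measurable_funD; last exact: measurable_cst.
  apply: measurable_funD; last exact: measurable_cst.
  have ms : measurable_fun setT (fun y : R => s + y) by apply: measurable_funD => //; exact: measurable_cst.
  apply: measurable_funB; apply: measurable_funM; try exact: measurable_cst.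
    exact: measurable_funX.
  exact: measurableT_comp.
have nV : 0 <= 4 * n%:R * V by rewrite !mulr_ge0.
apply: (@le_trans _ _ (\int[g]_y (h y)%:E)%E).
  apply: ge0_le_integral => //.
  - by move=> y _; apply: integral_ge0 => v _.
  - exact: (measurable_integral_scons mf).
  - exact/measurable_EFinP.
  move=> y _; under eq_integral do rewrite mabs_scons.
  apply: (le_trans (IHn _ _ _)); first by rewrite le_max lexx orbT.
  rewrite lee_fin /h lerD2r; case: (leP c `|s + y|) => [le|lt]; last by [].
  rewrite -[(s + y) ^+ 2](real_normK (num_real (s + y))).
  have := sqr_ge0 (`|s + y| - c); nra.
have -> : 4 * s ^+ 2 - 4 * c * `|s| + 2 * c ^+ 2 + 4 * n.+1%:R * V =
   (4 * s ^+ 2 - 4 * c * `|s| + 2 * c ^+ 2 + 4 * n%:R * V) + 4 * V.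
  by rewrite -[n.+1%:R]natr1; ring.
apply: (@integral_g_sym_le (fun y => `|y| ^+ 2)) => //.
- by move=> y; rewrite addr_ge0.
- by rewrite addr_ge0.
move=> y; rewrite /h (real_normK (num_real y)).
have c0 : 0 <= c by exact: le_trans sc.
have : 2 * `|s| <= `|s + y| + `|s + - y|.
  have := ler_normD (s + y) (s - y); have -> : s + y + (s - y) = 2 * s by ring.
  by rewrite normrM (ger0_norm (_ : 0 <= 2)).
move=> t; have : c * (2 * `|s|) <= c * (`|s + y| + `|s + - y|) by exact: ler_wpM2l.
lra.
Qed.

Lemma second_moment s n :
  ((s ^+ 2 + n%:R * V)%:E <= \int[m]_u ((s + walk u n) ^+ 2)%:E)%E.
Proof.
elim: n s => [|n IHn] s.
  under eq_integral do rewrite walk0 addr0.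
  by rewrite (eq_integral (cst (s ^+ 2)%:E))// integral_cst// (iid_law_setT gm) mule1 lee_fin mul0r addr0.
have mf : measurable_fun setT (fun u : seqT => ((s + walk u n.+1) ^+ 2)%:E).
  apply/measurable_EFinP; apply: measurable_funX.
  by apply: measurable_funD; [exact: measurable_cst|exact: measurable_walk].
have f0 (u : seqT) : (0 <= ((s + walk u n.+1) ^+ 2)%:E)%E by rewrite lee_fin sqr_ge0.
rewrite (integral_scons gm)//.
have ms : measurable_fun setT (fun y : R => s + y) by apply: measurable_funD => //; exact: measurable_cst.
have mh : measurable_fun setT (fun y : R => (s + y) ^+ 2 + n%:R * V).
  by apply: measurable_funD; [exact: measurable_funX|exact: measurable_cst].
have nV : 0 <= n%:R * V by rewrite !mulr_ge0.
apply: (@le_trans _ _ (\int[g]_y ((s + y) ^+ 2 + n%:R * V)%:E)%E); last first.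
  apply: ge0_le_integral => //.
  - by move=> y _; rewrite lee_fin addr_ge0// sqr_ge0.
  - exact/measurable_EFinP.
  - exact: (measurable_integral_scons mf).
  move=> y _; under [leRHS]eq_integral do rewrite walk_scons addrA.
  exact: IHn.
have -> : s ^+ 2 + n.+1%:R * V = (s ^+ 2 + n%:R * V) + 1 * V by rewrite -[n.+1%:R]natr1; ring.
apply: (@integral_g_sym_ge (fun y => `|y| ^+ 2)) => //.
- by move=> y; rewrite addr_ge0// sqr_ge0.
- by rewrite addr_ge0// sqr_ge0.
by move=> y; rewrite (real_normK (num_real y)); lra.
Qed.

Lemma fourth_moment s n :
  (\int[m]_u ((s + walk u n) ^+ 4)%:E <=
   (s ^+ 4 + 6 * n%:R * V * s ^+ 2 + n%:R ^+ 2 * (3 * V ^+ 2 + Q))%:E)%E.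
Proof.
have e4 (z : R) : 0 <= z ^+ 4 by rewrite -[4%N]/(2 * 2)%N exprM sqr_ge0.
elim: n s => [|n IHn] s.
  under eq_integral do rewrite walk0 addr0.
  rewrite (eq_integral (cst (s ^+ 4)%:E))// integral_cst// (iid_law_setT gm) mule1 lee_fin.
  by rewrite mulr0 expr0n/= !mul0r !addr0.
have mf : measurable_fun setT (fun u : seqT => ((s + walk u n.+1) ^+ 4)%:E).
  apply/measurable_EFinP; apply: measurable_funX.
  by apply: measurable_funD; [exact: measurable_cst|exact: measurable_walk].
have f0 (u : seqT) : (0 <= ((s + walk u n.+1) ^+ 4)%:E)%E by rewrite lee_fin.
rewrite (integral_scons gm)//.
have ms : measurable_fun setT (fun y : R => s + y) by apply: measurable_funD => //; exact: measurable_cst.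
pose K := n%:R ^+ 2 * (3 * V ^+ 2 + Q).
have K0 : 0 <= K by rewrite mulr_ge0 ?sqr_ge0// addr_ge0// mulr_ge0// sqr_ge0.
have nV : 0 <= 6 * n%:R * V by rewrite !mulr_ge0.
pose h (y : R) := (s + y) ^+ 4 + 6 * n%:R * V * (s + y) ^+ 2 + K.
have h0 y : 0 <= h y by rewrite !addr_ge0// mulr_ge0// sqr_ge0.
have mh : measurable_fun setT h.
  apply: measurable_funD; last exact: measurable_cst.
  apply: measurable_funD; first exact: measurable_funX.
  by apply: measurable_funM; [exact: measurable_cst|exact: measurable_funX].
apply: (@le_trans _ _ (\int[g]_y (h y)%:E)%E).
  apply: ge0_le_integral => //.
  - by move=> y _; apply: integral_ge0 => v _.
  - exact: (measurable_integral_scons mf).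
  - exact/measurable_EFinP.
  move=> y _; under eq_integral do rewrite walk_scons addrA.
  exact: IHn.
pose c2 := 6 * s ^+ 2 + 6 * n%:R * V.
have c20 : 0 <= c2 by rewrite addr_ge0// mulr_ge0// sqr_ge0.
pose f (y : R) := `|y| ^+ 4 + c2 * `|y| ^+ 2.
have Ef : (\int[g]_y (f y)%:E = (Q + c2 * V)%:E)%E.
  rewrite (eq_integral (fun y : R => (`|y| ^+ 4)%:E + (c2%:E * (`|y| ^+ 2)%:E))%E)//.
  have mk k : measurable_fun setT (fun y : R => (`|y| ^+ k)%:E) by apply/measurable_EFinP; exact: mn.
  have pk k (y : R) : (0 <= (`|y| ^+ k)%:E)%E by rewrite lee_fin exprn_ge0.
  rewrite ge0_integralD//; last 2 first.
  - by move=> y _; apply: mule_ge0; rewrite lee_fin.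
  - exact: emeasurable_funM.
  by rewrite EQ ge0_integralZl// EV.
pose A := s ^+ 4 + 6 * n%:R * V * s ^+ 2 + K.
have A0 : 0 <= A by rewrite !addr_ge0// mulr_ge0// sqr_ge0.
apply: (@le_trans _ _ (A + 1 * (Q + c2 * V))%:E).
  apply: (@integral_g_sym_le f h _ A 1) => //.
  - apply: measurable_funD => //; apply: measurable_funM => //; exact: measurable_cst.
  - by move=> y; rewrite addr_ge0 ?exprn_ge0// mulr_ge0// exprn_ge0.
  - by rewrite addr_ge0// mulr_ge0.
  move=> y; rewrite /h /f /A /c2 (_ : `|y| ^+ 4 = y ^+ 4) ?(real_normK (num_real y)); last by rewrite -normrX ger0_norm.
  by rewrite le_eqVlt; apply/orP; left; apply/eqP; ring.
rewrite lee_fin /A /K /c2 -[n.+1%:R]natr1.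
have n0 : 0 <= n%:R :> R by []; move: (n%:R : R) n0 => x x0.
have := mulr_ge0 x0 Q0; have := sqr_ge0 V; lra.
Qed.

Lemma mean_dn_ge : 0 < V -> exists c : R, 0 < c /\
  forall n, ((c * Num.sqrt n%:R)%:E <= \int[m]_u (dn (walk u n))%:E)%E.
Proof.
move=> Vp; pose ka := 3 * V ^+ 2 + Q.
have ka0 : 0 < ka by rewrite /ka ltr_pwDl// mulr_gt0// exprn_gt0.
pose la := Num.sqrt (ka / V).
have la0 : 0 < la by rewrite sqrtr_gt0 divr_gt0.
have la2 : la ^+ 2 = ka / V by rewrite sqr_sqrtr// divr_ge0// ltW.
exists (3 / 8 * V / la); split; first by rewrite divr_gt0// mulr_gt0//; lra.
case=> [|n].
  by rewrite sqrtr0 mulr0; apply: integral_ge0 => u _; rewrite lee_fin dn_ge0.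
set r := Num.sqrt n.+1%:R.
have r0 : 0 < r by rewrite sqrtr_gt0 ltr0n.
have r2 : n.+1%:R = r ^+ 2 by rewrite sqr_sqrtr.
pose L := la * r; have L0 : 0 < L by rewrite mulr_gt0.
have md : measurable_fun setT (fun u : seqT => dn (walk u n.+1)).
  by apply: (measurableT_comp measurable_dn); exact: measurable_walk.
have [sg _ _ _] := tg.
have dE : (\int[m]_u (dn (walk u n.+1))%:E = \int[m]_u (dn (- walk u n.+1))%:E)%E.
  rewrite (integral_sym gm sg)//; last 2 first.
  - exact/measurable_EFinP.
  - by move=> u; rewrite lee_fin dn_ge0.
  by apply: eq_integral => u _; rewrite /walk sumrN.
set I := (\int[m]_u (dn (walk u n.+1))%:E)%E in dE *.
have mdo : measurable_fun setT (fun u : seqT => dn (- walk u n.+1)).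
  by apply: (measurableT_comp measurable_dn); apply: measurable_funN; exact: measurable_walk.
have mw k : measurable_fun setT (fun u : seqT => (walk u n.+1 ^+ k)%:E).
  by apply/measurable_EFinP; apply: measurable_funX; exact: measurable_walk.
have e4 (z : R) : 0 <= z ^+ 4 by rewrite -[4%N]/(2 * 2)%N exprM sqr_ge0.
have L3 : 0 < 4 * L ^+ 3 by rewrite mulr_gt0// exprn_gt0.
have Li0 : 0 < L^-1 by rewrite invr_gt0.
have pw (t : R) : L^-1 * t ^+ 2 <= dn t + dn (- t) + (4 * L ^+ 3)^-1 * t ^+ 4.
  have -> : dn t + dn (- t) = `|t|.
    rewrite /dn opprK; have [t0|t0] := leP 0 t; first by rewrite max_r ?max_l ?ger0_norm ?oppr_le0// add0r.
    by rewrite max_l ?max_r ?ltr0_norm ?oppr_ge0 ?addr0// ltW.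
  have -> : (4 * L ^+ 3)^-1 * t ^+ 4 = `|t| * ((`|t| * L^-1) ^+ 3 / 4).
    rewrite -[t ^+ 4]/(t ^+ (2 * 2)) exprM -[t ^+ 2](real_normK (num_real t)); field.
    by rewrite lt0r_neq0.
  have -> : L^-1 * t ^+ 2 = `|t| * (`|t| * L^-1).
    by rewrite -(real_normK (num_real t)); ring.
  rewrite -[X in _ <= X + _]mulr1 -mulrDr; apply: ler_wpM2l => //.
  have : 0 <= `|t| * L^-1 by rewrite mulr_ge0// ltW.
  move: (`|t| * L^-1) => x x0.
  have := mulr_ge0 (sqr_ge0 (x - 6 / 5)) (_ : 0 <= x + 12 / 5); rewrite !exprS expr0; lra.
have key : ((L^-1)%:E * \int[m]_u (walk u n.+1 ^+ 2)%:E <=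
    (I + I) + ((4 * L ^+ 3)^-1)%:E * \int[m]_u (walk u n.+1 ^+ 4)%:E)%E.
  have dn0 (t : R) : (0 <= (dn t)%:E)%E by rewrite lee_fin dn_ge0.
  have i3 : (0 <= ((4 * L ^+ 3)^-1)%:E)%E by rewrite lee_fin invr_ge0 ltW.
  have e4E (u : seqT) : (0 <= (walk u n.+1 ^+ 4)%:E)%E by rewrite lee_fin.
  have mdE : measurable_fun setT (fun u : seqT => (dn (walk u n.+1))%:E) by exact/measurable_EFinP.
  have mdoE : measurable_fun setT (fun u : seqT => (dn (- walk u n.+1))%:E) by exact/measurable_EFinP.
  rewrite {2}dE /I.
  rewrite -ge0_integralZl//; last 2 first.
  - by move=> u _; rewrite lee_fin sqr_ge0.
  - by rewrite lee_fin ltW.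
  rewrite -ge0_integralZl// -ge0_integralD// -ge0_integralD//; last 3 first.
  - exact: emeasurable_funD.
  - by move=> u _; apply: mule_ge0.
  - by apply: emeasurable_funM.
  2: by move=> u _; apply: adde_ge0.
  apply: ge0_le_integral => //.
  - by move=> u _; apply: mule_ge0; rewrite lee_fin ?sqr_ge0 ?ltW.
  - by apply: emeasurable_funM.
  - by apply: emeasurable_funD; [exact: emeasurable_funD|exact: emeasurable_funM].
  by move=> u _; exact: pw.
have s2 := second_moment 0 n.+1; have s4 := fourth_moment 0 n.+1.
have : ((L^-1 * (n.+1%:R * V))%:E <= (I + I) + ((4 * L ^+ 3)^-1 * (n.+1%:R ^+ 2 * ka))%:E)%E.
  apply: (@le_trans _ _ ((L^-1)%:E * \int[m]_u (walk u n.+1 ^+ 2)%:E)%E).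
    rewrite EFinM; apply: lee_wpmul2l; first by rewrite lee_fin ltW.
    move: s2; rewrite expr0n add0r; congr (_ <= _)%E.
    by apply: eq_integral => u _; rewrite add0r.
  apply: (le_trans key); apply: leeD => //.
  rewrite EFinM; apply: lee_wpmul2l; first by rewrite lee_fin invr_ge0 ltW.
  move: s4; rewrite !expr0n mulr0 !add0r; congr (_ <= _)%E.
  by apply: eq_integral => u _; rewrite add0r.
have : (0 <= I)%E by apply: integral_ge0 => u _; rewrite lee_fin dn_ge0.
case: I {key dE} => [I||]//=; last by move=> *; rewrite leey.
rewrite !lee_fin => I0; rewrite r2.
have -> : L^-1 * (r ^+ 2 * V) = V / la * r by rewrite /L; field; rewrite ?lt0r_neq0.
have kaE : ka = la ^+ 2 * V by rewrite la2; field; rewrite ?lt0r_neq0.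
have -> : (4 * L ^+ 3)^-1 * ((r ^+ 2) ^+ 2 * ka) = V / la * r / 4.
  by rewrite kaE /L; field; rewrite ?lt0r_neq0.
have -> : 3 / 8 * V / la * r = 3 / 8 * (V / la * r) by ring.
lra.
Qed.

Lemma mean_mabs_le n :
  (\int[m]_u (mabs 0 0 u n)%:E <= ((2 * V + 1 / 2) * Num.sqrt n%:R)%:E)%E.
Proof.
case: n => [|n].
  by rewrite sqrtr0 mulr0 (eq_integral (cst 0%E))// integral0.
set r := Num.sqrt n.+1%:R.
have r0 : 0 < r by rewrite sqrtr_gt0 ltr0n.
have r2 : n.+1%:R = r ^+ 2 by rewrite sqr_sqrtr.
have ri : 0 < (2 * r)^-1 by rewrite invr_gt0 mulr_gt0.
have mM := measurable_mabs 0 0 n.+1.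
apply: (@le_trans _ _ (\int[m]_u (((2 * r)^-1)%:E * (mabs 0 0 u n.+1 ^+ 2)%:E + (r / 2)%:E))%E).
  apply: ge0_le_integral => //.
  - by move=> u _; rewrite lee_fin mabs_ge0.
  - exact/measurable_EFinP.
  - apply: emeasurable_funD; last exact: measurable_cst.
    by apply: emeasurable_funM => //; apply/measurable_EFinP; exact: measurable_funX.
  move=> u _; rewrite -[leRHS]/((2 * r)^-1 * mabs 0 0 u n.+1 ^+ 2 + r / 2)%:E lee_fin.
  move: (mabs 0 0 u n.+1) => M.
  have -> : (2 * r)^-1 * M ^+ 2 + r / 2 = M + (2 * r)^-1 * (M - r) ^+ 2.
    by field; rewrite lt0r_neq0.
  by rewrite lerDl mulr_ge0 ?sqr_ge0// ltW.
rewrite ge0_integralD//; last 3 first.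
- by move=> u _; apply: mule_ge0; rewrite lee_fin ?sqr_ge0 ?ltW.
- by apply: emeasurable_funM => //; apply/measurable_EFinP; exact: measurable_funX.
- by move=> u _; rewrite lee_fin divr_ge0// ltW.
rewrite integral_cst// (iid_law_setT gm) mule1 ge0_integralZl//; last 3 first.
- by apply/measurable_EFinP; exact: measurable_funX.
- by move=> u _; rewrite lee_fin sqr_ge0.
- by rewrite lee_fin ltW.
have := doob n.+1 (_ : `|0| <= 0 :> R); rewrite normr0 lexx => /(_ isT) D.
apply: (@le_trans _ _ (((2 * r)^-1)%:E * (4 * n.+1%:R * V)%:E + (r / 2)%:E)%E).
  apply: leeD => //; apply: lee_wpmul2l; first by rewrite lee_fin ltW.
  by move: D; rewrite expr0n !mulr0 subr0 !add0r.
rewrite -[leLHS]/((2 * r)^-1 * (4 * n.+1%:R * V) + r / 2)%:E lee_fin r2.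
by rewrite le_eqVlt; apply/orP; left; apply/eqP; field; rewrite lt0r_neq0.
Qed.

End moments.

Lemma integral_gt0_of_ray (h : R -> R) (I : R) : measurable_fun setT h -> (forall y, 0 <= h y) ->
  (forall y, y <= -1 -> 1 <= h y) -> (\int[g]_y (h y)%:E = I%:E)%E -> 0 < I.
Proof.
move=> mh h0 h1 EI; apply: (lt_le_trans b0); rewrite -lee_fin -EI.
have <- : (\int[g]_y (\1_(`]-oo, (-1)]%classic) y)%:E = b%:E)%E.
  by rewrite integral_indic// setIT; exact: g_fin.
apply: ge0_le_integral => //.
- exact: EFin_indic_measurable.
- exact/measurable_EFinP.
move=> y _; rewrite lee_fin indicE; have [/set_mem|_] := boolP (_ \in _); last exact: h0.
by rewrite /= in_itv/=; exact: h1.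
Qed.

Lemma dn_le_norm (y : R) : dn y <= `|y|.
Proof. by rewrite /dn ge_max normr_ge0 -normrN ler_norm. Qed.

Lemma variance : exists V, 0 < V /\ (\int[g]_y (`|y| ^+ 2)%:E = V%:E)%E.
Proof.
have [V [V0 EV]] := power_moment 1; exists V; split=> //.
apply: (integral_gt0_of_ray _ _ _ EV).
- by apply: measurable_funX; exact: normr_measurable.
- by move=> y; rewrite exprn_ge0.
- by move=> y y1; rewrite exprn_ege1// ler0_norm; lra.
Qed.

Lemma conv_ub : exists C : R, 0 <= C /\ forall n,
  \sum_(k < n) ip 0 k * ip 0 (n - k.+1) <= C * Num.sqrt n%:R.
Proof.
have [V [V0 EV]] := variance.
have [D [D0 ED]] : exists M : R, 0 <= M /\ (\int[g]_y (dn y)%:E = M%:E)%E.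
  apply: (@moment_fin R g tg (@dn R) 1 1) => //; first exact: measurable_dn.
    exact: dn_ge0.
  by move=> y; rewrite !mul1r; have := expR_ge1Dx `|y|; have := dn_le_norm y; lra.
have Dp : 0 < D.
  apply: (integral_gt0_of_ray measurable_dn _ _ ED) => [|y y1]; first exact: dn_ge0.
  by rewrite dn_lt0; lra.
exists (2 * (2 * V + 1 / 2) / D); split.
  by rewrite divr_ge0// mulr_ge0//; lra.
move=> n; rewrite mulrAC ler_pdivlMr// mulr_suml.
have m0 : measurable_fun setT (fun _ : R => 0 : R) by exact: measurable_cst.
have ts (k : 'I_n) := integral_two_sided (n - k.+1) (leqnn k) m0.
rewrite -lee_fin.
apply: (@le_trans _ _ (\int[m]_u (\sum_(k < n) (dn (u k) * (`[< good n u k >])%:R)%:E))%E).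
  rewrite ge0_integral_sum//; last 2 first.
  - by move=> k; have [] := ts k.
  - by move=> k u _; rewrite lee_fin mulr_ge0// dn_ge0.
  rewrite -sumEFin; apply: lee_sum => k _.
  have [_ [_ E]] := ts k; rewrite (_ : (\int[m]_u _)%E = (\int[g]_y (dn y * (ip 0 k * ip 0 (n - k.+1)))%:E)%E)//.
  have -> : (\int[g]_y (dn y * (ip 0 k * ip 0 (n - k.+1)))%:E =
     \int[g]_y ((ip 0 k * ip 0 (n - k.+1))%:E * (dn y)%:E))%E.
    by apply: eq_integral => y _; rewrite -EFinM mulrC.
  rewrite ge0_integralZl//; last 3 first.
  - by apply/measurable_EFinP; exact: measurable_dn.
  - by move=> y _; rewrite lee_fin dn_ge0.
  - by rewrite lee_fin mulr_ge0// ip_ge0.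
  by rewrite ED.
have mM := measurable_mabs 0 0 n.
apply: (@le_trans _ _ (\int[m]_u (2%:E * (mabs 0 0 u n)%:E))%E).
  apply: ge0_le_integral => //.
  - by move=> u _; apply: sume_ge0 => k _; rewrite lee_fin mulr_ge0// dn_ge0.
  - by apply: emeasurable_sum => k; have [] := ts k.
  - by apply: emeasurable_funM => //; exact/measurable_EFinP.
  move=> u _; rewrite sumEFin -EFinM lee_fin.
  have := @good_sum_le R n u (- mabs 0 0 u n) (mabs 0 0 u n).
  have -> : mabs 0 0 u n - - mabs 0 0 u n = 2 * mabs 0 0 u n by ring.
  apply=> i ile; rewrite -ler_norml -[walk u i]add0r; apply: mabs_ge => //.
  by rewrite normr0.
rewrite ge0_integralZl//; last 2 first.
- exact/measurable_EFinP.
- by move=> u _; rewrite lee_fin mabs_ge0.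
apply: (@le_trans _ _ (2%:E * ((2 * V + 1 / 2) * Num.sqrt n%:R)%:E)%E).
  by apply: lee_wpmul2l => //; exact: (mean_mabs_le (ltW V0) EV n).
by rewrite -EFinM lee_fin mulrA.
Qed.

Lemma conv_lb : exists c : R, 0 < c /\ forall n,
  c * Num.sqrt n%:R <= \sum_(k < n) ip 0 k.-1 * ip 0 (n - k.+1).
Proof.
have [V [V0 EV]] := variance.
have [Q [Q0 EQ]] := power_moment 3.
have [c [c0 Hc]] := mean_dn_ge (ltW V0) Q0 EV EQ V0.
have [t [t0 Ht]] := ip_ub.
pose h (y : R) := dn y * expR (2 * (t * (2 * dn y + 1))).
have h0 y : 0 <= h y by rewrite mulr_ge0 ?dn_ge0 ?expR_ge0.
have mh : measurable_fun setT h.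
  apply: measurable_funM; first exact: measurable_dn.
  apply: (measurableT_comp (f := @expR R)); first exact: measurable_expR.
  apply: measurable_funM; first exact: measurable_cst.
  apply: measurable_funM; first exact: measurable_cst.
  apply: measurable_funD; last exact: measurable_cst.
  by apply: measurable_funM; [exact: measurable_cst|exact: measurable_dn].
have [M [M0 EM]] : exists M : R, 0 <= M /\ (\int[g]_y (h y)%:E = M%:E)%E.
  apply: (@moment_fin R g tg h (expR (2 * t)) (4 * t + 1)) => //.
  move=> y; apply: (@le_trans _ _ (expR (dn y) * expR (2 * (t * (2 * dn y + 1))))).
    by apply: ler_wpM2r; [exact: expR_ge0|have := expR_ge1Dx (dn y); lra].
  rewrite -!expRD ler_expR; have := ler_wpM2l t0 (dn_le_norm y); have := dn_le_norm y; lra.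
exists (c / (M + 1)); split; first by rewrite divr_gt0//; lra.
move=> n; rewrite mulrAC ler_pdivrMr; last by lra.
have mx : measurable_fun setT (fun y : R => 2 * dn y).
  by apply: measurable_funM; [exact: measurable_cst|exact: measurable_dn].
have ts (k : 'I_n) := integral_two_sided (n - k.+1) (leq_pred k) mx.
rewrite -lee_fin; apply: (le_trans (Hc n)).
apply: (@le_trans _ _ (\int[m]_u (\sum_(k < n) (dn (u k) * (`[< wgood n u k >])%:R)%:E))%E).
  apply: ge0_le_integral => //.
  - by move=> u _; rewrite lee_fin dn_ge0.
  - by apply/measurable_EFinP; apply: (measurableT_comp measurable_dn); exact: measurable_walk.
  - by apply: emeasurable_sum => k; have [] := ts k.
  by move=> u _; rewrite sumEFin lee_fin wgood_sum_ge.
rewrite ge0_integral_sum//; last 2 first.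
- by move=> k; have [] := ts k.
- by move=> k u _; rewrite lee_fin mulr_ge0// dn_ge0.
rewrite mulr_suml -sumEFin; apply: lee_sum => k _.
have [_ [mk E]] := ts k; rewrite (_ : (\int[m]_u _)%E =
  (\int[g]_y (dn y * (ip (2 * dn y) k.-1 * ip (2 * dn y) (n - k.+1)))%:E)%E)//.
pose q := ip 0 k.-1 * ip 0 (n - k.+1).
have q0 : 0 <= q by rewrite mulr_ge0// ip_ge0.
apply: (@le_trans _ _ (\int[g]_y (q%:E * (h y)%:E))%E).
  apply: ge0_le_integral => //.
  - by move=> y _; rewrite lee_fin mulr_ge0 ?dn_ge0// mulr_ge0// ip_ge0.
  - by apply: emeasurable_funM => //; exact/measurable_EFinP.
  move=> y _; rewrite -EFinM lee_fin /h [leRHS]mulrCA; apply: ler_wpM2l; first exact: dn_ge0.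
  have d0 : 0 <= 2 * dn y by rewrite mulr_ge0// dn_ge0.
  apply: (le_trans (ler_pM (ip_ge0 _ _) (ip_ge0 _ _) (Ht _ _ d0) (Ht _ _ d0))).
  rewrite /q mulrACA -expRD mulrC le_eqVlt; apply/orP; left; apply/eqP.
  by congr (_ * expR _); ring.
rewrite ge0_integralZl//; last 2 first.
- exact/measurable_EFinP.
- by move=> y _; rewrite lee_fin.
rewrite EM -EFinM lee_fin -/q; apply: ler_wpM2l => //; lra.
Qed.

End integrated_walk.

Section quarter.
Context {R : realType}.
Implicit Types p : nat -> R.

Definition qroot n : R := Num.sqrt (Num.sqrt n%:R).

Lemma qroot_ge0 n : 0 <= qroot n. Proof. exact: sqrtr_ge0. Qed.

Lemma qroot2 n : qroot n ^+ 2 = Num.sqrt n%:R.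
Proof. by rewrite sqr_sqrtr// sqrtr_ge0. Qed.

Lemma qroot4 n : qroot n ^+ 4 = n%:R.
Proof. by rewrite -[4%N]/(2 * 2)%N exprM qroot2 sqr_sqrtr. Qed.

Lemma qroot_ge1 n : (0 < n)%N -> 1 <= qroot n.
Proof.
move=> n0; rewrite leNgt; apply/negP => q1; have := qroot4 n.
have : qroot n ^+ 4 < 1 by rewrite exprn_ilt1// qroot_ge0.
by rewrite ltNge => /negP h e; apply: h; rewrite e ler1n.
Qed.

Lemma sum_inv_sqrt n : \sum_(k < n) (Num.sqrt k.+1%:R)^-1 <= 2 * Num.sqrt n%:R :> R.
Proof.
elim: n => [|n IHn]; first by rewrite big_ord0 mulr_ge0// sqrtr_ge0.
rewrite big_ord_recr/=; apply: (le_trans (lerD IHn (lexx _))).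
have := sqr_sqrtr (ler0n R n); have := sqr_sqrtr (ler0n R n.+1).
have := sqrtr_ge0 (n%:R : R).
have : 0 < Num.sqrt n.+1%:R :> R by rewrite sqrtr_gt0 ltr0n.
move: (Num.sqrt n.+1%:R) (Num.sqrt n%:R) => x y x0 y0 xE yE.
have xy : x ^+ 2 = y ^+ 2 + 1 by rewrite xE yE natr1.
have xi : x * x^-1 = 1 by rewrite divff// lt0r_neq0.
have : x * (2 * y + x^-1) <= x * (2 * x).
  rewrite mulrDr xi; have := sqr_ge0 (x - y); move: xy; rewrite !expr2; lra.
by rewrite ler_pM2l.
Qed.

(* Lower bound: for [n = 2h + 2] every term of the convolution has an index at least [h],
   so the sum is at most [p h] times partial sums of [p], which the upper bound makes
   of order [n^(3/4)]. *)
Lemma quarter_of_conv p (c C : R) : (forall k, 0 <= p k <= 1) ->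
  (forall a b, (a <= b)%N -> p b <= p a) -> 0 < c -> 0 <= C ->
  (forall n, \sum_(k < n) p k * p (n - k.+1)%N <= C * Num.sqrt n%:R) ->
  (forall n, c * Num.sqrt n%:R <= \sum_(k < n) p k.-1 * p (n - k.+1)%N) ->
  exists e E : R, 0 < e /\ 0 < E /\ forall n, (0 < n)%N -> e <= p n * qroot n <= E.
Proof.
move=> p01 dp c0 C0 ub lb.
have p0 k : 0 <= p k by case/andP: (p01 k).
have p1 k : p k <= 1 by case/andP: (p01 k).
have up n : p n ^+ 2 * Num.sqrt n%:R <= C.
  case: n => [|n]; first by rewrite sqrtr0 mulr0.
  have r0 : 0 < Num.sqrt n.+1%:R :> R by rewrite sqrtr_gt0 ltr0n.
  rewrite -(ler_pM2r r0) -mulrA -expr2 sqr_sqrtr//; apply: le_trans (ub n.+1).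
  rewrite mulr_natr -[X in _ *+ X]card_ord -sumr_const; apply: ler_sum => k _.
  by rewrite expr2; apply: ler_pM => //; apply: dp; [exact: ltnW|rewrite leq_subr].
have K n : (0 < n)%N -> \sum_(k < n) p k <= (C + 3 / 2) * qroot n ^+ 3.
  case: n => // n _; rewrite big_ord_recl.
  have w1 := qroot_ge1 (ltn0Sn n); have := qroot2 n.+1; have := qroot4 n.+1.
  move: (qroot n.+1) w1 => w w1 w4 w2.
  have w0 : 0 < w by lra.
  have : \sum_(i < n) p (lift ord0 i) <= \sum_(i < n) (w * C / 2 * (Num.sqrt i.+1%:R)^-1 + (2 * w)^-1).
    apply: ler_sum => i _; rewrite lift0.
    have r0 : 0 < Num.sqrt i.+1%:R :> R by rewrite sqrtr_gt0 ltr0n.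
    have : p i.+1 ^+ 2 <= C * (Num.sqrt i.+1%:R)^-1 by rewrite ler_pdivlMr.
    move: (Num.sqrt i.+1%:R)^-1 (p i.+1) => ri P pX.
    have -> : w * C / 2 * ri + (2 * w)^-1 = P + w / 2 * (C * ri - P ^+ 2) + (2 * w)^-1 * (w * P - 1) ^+ 2.
      by field; rewrite lt0r_neq0.
    have : 0 <= w / 2 * (C * ri - P ^+ 2) by rewrite mulr_ge0 ?subr_ge0// divr_ge0// ltW.
    have : 0 <= (2 * w)^-1 * (w * P - 1) ^+ 2 by rewrite mulr_ge0 ?sqr_ge0// invr_ge0 mulr_ge0// ltW.
    lra.
  rewrite big_split/= -mulr_sumr sumr_const card_ord.
  have h1 : w * C / 2 * \sum_(i < n) (Num.sqrt i.+1%:R)^-1 <= C * w ^+ 3.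
    apply: (@le_trans _ _ (w * C / 2 * (2 * w ^+ 2))); last first.
      by rewrite le_eqVlt; apply/orP; left; apply/eqP; field.
    apply: ler_wpM2l; first by rewrite divr_ge0// mulr_ge0// ltW.
    apply: (le_trans (sum_inv_sqrt n)); apply: ler_wpM2l => //.
    by rewrite w2 ler_sqrt// ler_nat.
  have h2 : (2 * w)^-1 *+ n <= w ^+ 3 / 2.
    have -> : w ^+ 3 / 2 = (2 * w)^-1 * w ^+ 4 by field; rewrite lt0r_neq0.
    rewrite -[leLHS]mulr_natr w4; apply: ler_wpM2l; last by rewrite ler_nat.
    by rewrite invr_ge0 mulr_ge0// ltW.
  have h3 : 1 <= w ^+ 3 by rewrite exprn_ege1.
  have h4 : p (ord0 : 'I_n.+1) <= 1 := p1 0%N.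
  move=> h; have -> : (C + 3 / 2) * w ^+ 3 = w ^+ 3 + (C * w ^+ 3 + w ^+ 3 / 2) by field.
  by apply: lerD; [exact: le_trans h4 h3|apply: (le_trans h); exact: lerD].
exists (c / (2 * (2 * C + 4))), (C + 1); split; [|split].
- by rewrite divr_gt0// mulr_gt0//; lra.
- by lra.
move=> h h0; have q1 := qroot_ge1 h0.
apply/andP; split; last first.
  have : (p h * qroot h) ^+ 2 <= C by rewrite exprMn qroot2.
  move: (p h * qroot h) => x xC; have := sqr_ge0 (x - 1); move: xC; rewrite !expr2; lra.
pose N := h.*2.+2; have w1 := qroot_ge1 (ltn0Sn h.*2.+1 : (0 < N)%N).
have Kh := K N (ltn0Sn _).
have s1 : \sum_(k < N) p k.-1 <= 1 + \sum_(k < N) p k.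
  rewrite big_ord_recl [leRHS]addrC [in leRHS]big_ord_recr/=.
  rewrite -addrA [leLHS]addrC; apply: lerD; first by apply: ler_sum.
  by have := p1 0%N; have := p0 h.*2.+1; lra.
have s2 : \sum_(k < N) p (N - k.+1)%N = \sum_(k < N) p k.
  by rewrite [RHS](reindex_inj rev_ord_inj).
have : c * qroot N ^+ 2 <= p h * ((2 * C + 4) * qroot N ^+ 3).
  rewrite qroot2; apply: (le_trans (lb N)).
  apply: (@le_trans _ _ (\sum_(k < N) p h * (p k.-1 + p (N - k.+1)%N))).
    apply: ler_sum => k _; rewrite mulrDr.
    have [hk|kh] := leqP h k.-1.
      have := ler_wpM2r (p0 (N - k.+1)%N) (dp _ _ hk); have := mulr_ge0 (p0 h) (p0 k.-1); lra.
    have hk : (h <= N - k.+1)%N by move: kh; rewrite /N; clear; lia.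
    have := ler_wpM2l (p0 k.-1) (dp _ _ hk); have := mulr_ge0 (p0 h) (p0 (N - k.+1)%N); lra.
  rewrite -mulr_sumr big_split/= s2; apply: ler_wpM2l => //.
  have : 1 <= qroot N ^+ 3 by rewrite exprn_ege1.
  move: Kh s1; move: (qroot N ^+ 3) (\sum_(k < N) p k) (\sum_(k < N) p k.-1) => X Y Z; lra.
have w0 : 0 < qroot N by lra.
have wq : qroot N <= 2 * qroot h.
  rewrite -(@ler_pXn2r _ 4)// ?nnegrE ?mulr_ge0 ?qroot_ge0//.
  rewrite exprMn !qroot4 -natrX -natrM ler_nat /N; move: h0; clear; lia.
have -> : p h * ((2 * C + 4) * qroot N ^+ 3) = (p h * (2 * C + 4) * qroot N) * qroot N ^+ 2.
  by ring.
rewrite ler_pM2r ?exprn_gt0// => hc.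
rewrite ler_pdivrMr; last by rewrite mulr_gt0//; lra.
apply: (le_trans hc).
have -> : p h * qroot h * (2 * (2 * C + 4)) = p h * (2 * C + 4) * (2 * qroot h) by ring.
by apply: ler_wpM2l => //; rewrite mulr_ge0//; lra.
Qed.

Lemma persist_quarter (g : probability R R) (m : probability (@seqT R) R) : tame g -> iid_law g m ->
  exists e E : R, 0 < e /\ 0 < E /\
    forall n, (0 < n)%N -> e <= pr m (neg 2 (- 1) n) * qroot n <= E.
Proof.
move=> tg gm; have [C [C0 ub]] := conv_ub tg gm; have [c [c0 lb]] := conv_lb tg gm.
have [|a b ab|e [E [e0 [E0 H]]]] := quarter_of_conv _ _ c0 C0 ub lb.
- by move=> k; rewrite ip_ge0 ip_le1.
- exact: ip_decr.
by exists e, E; split=> //; split=> // n n0; rewrite -ip0; exact: H.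
Qed.

End quarter.

(** * A unit root *)

Section power_scale.
Context {R : realType}.
Implicit Types (p : nat -> R) (th e : R).

Definition expo_le th p := forall e, 0 < e ->
  exists C : R, \forall N \near \oo, p N <= C * N%:R `^ (- th + e).

Definition expo_ge th p := forall e, 0 < e ->
  exists c : R, 0 < c /\ \forall N \near \oo, c * N%:R `^ (- th - e) <= p N.

Lemma powR_near (d C : R) : 0 < d -> \forall N \near \oo, C < N%:R `^ d.
Proof.
move=> d0; pose D := Num.max C 1.
have D0 : 0 < D by rewrite lt_max ltr01 orbT.
near=> N; have h : D `^ d^-1 < N%:R by near: N; exact: nbhs_infty_gtr.
apply: (@le_lt_trans _ _ D); first by rewrite le_max lexx.
have N0 : 0 <= N%:R :> R by [].
have := gt0_ltr_powR d0 (powR_ge0 D d^-1) N0 h.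
by rewrite -powRrM mulVf ?gt_eqF// powRr1 ?ltW.
Unshelve. all: by end_near. Qed.

Lemma expo_uniq th th' p : expo_le th p -> expo_ge th' p -> th <= th'.
Proof.
move=> ple pge; rewrite leNgt; apply/negP => lt.
pose e := (th - th') / 4; have e0 : 0 < e by rewrite divr_gt0// subr_gt0.
have [C HC] := ple e e0; have [c [c0 Hc]] := pge e e0.
have : \forall N \near \oo, False; last by move=> [N _ /(_ N (leqnn N))].
near=> N.
have N0 : (0 : R) < N%:R by near: N; exact: nbhs_infty_gtr.
have h1 : p N <= C * N%:R `^ (- th + e) by near: N.
have h2 : c * N%:R `^ (- th' - e) <= p N by near: N.
have h3 : C / c < N%:R `^ (2 * e) by near: N; apply: powR_near; rewrite mulr_gt0.
have : c * N%:R `^ (2 * e) <= C.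
  rewrite -(ler_pM2r (powR_gt0 (- th + e) N0)) -mulrA -powRD; last by rewrite (gt_eqF N0) implybT.
  have -> : 2 * e + (- th + e) = - th' - e by rewrite /e; field.
  exact: le_trans h2 h1.
by rewrite leNgt mulrC -ltr_pdivrMr// h3.
Unshelve. all: by end_near. Qed.

Lemma expo_ge_of th p (c : R) : 0 < c -> (\forall N \near \oo, c * N%:R `^ (- th) <= p N) -> expo_ge th p.
Proof.
move=> c0 H e e0; exists c; split=> //; near=> N.
have N1 : (1 : R) <= N%:R by near: N; exact: nbhs_infty_ger.
apply: (@le_trans _ _ (c * N%:R `^ (- th))); last by near: N.
by apply: ler_wpM2l; [exact: ltW|apply: ler_powR => //; lra].
Unshelve. all: by end_near. Qed.

Lemma expo_le_of th p (C : R) : 0 <= C -> (\forall N \near \oo, p N <= C * N%:R `^ (- th)) -> expo_le th p.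
Proof.
move=> C0 H e e0; exists C; near=> N.
have N1 : (1 : R) <= N%:R by near: N; exact: nbhs_infty_ger.
apply: (@le_trans _ _ (C * N%:R `^ (- th))); first by near: N.
by apply: ler_wpM2l => //; apply: ler_powR => //; lra.
Unshelve. all: by end_near. Qed.

Lemma expo_le_near th p e : expo_le th p -> 0 < e -> \forall N \near \oo, p N <= N%:R `^ (- th + e).
Proof.
move=> ple e0; have e20 : 0 < e / 2 by rewrite divr_gt0.
have [C HC] := ple _ e20; near=> N.
have N0 : (0 : R) < N%:R by near: N; exact: nbhs_infty_gtr.
apply: (@le_trans _ _ (C * N%:R `^ (- th + e / 2))); first by near: N.
have -> : - th + e = e / 2 + (- th + e / 2) by field.
rewrite [leRHS]powRD; last by rewrite (gt_eqF N0) implybT.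
apply: ler_wpM2r; first exact: powR_ge0.
by apply: ltW; near: N; exact: powR_near.
Unshelve. all: by end_near. Qed.

Lemma expo_ge_near th p e : expo_ge th p -> 0 < e -> \forall N \near \oo, N%:R `^ (- th - e) <= p N.
Proof.
move=> pge e0; have e20 : 0 < e / 2 by rewrite divr_gt0.
have [c [c0 Hc]] := pge _ e20; near=> N.
have N0 : (0 : R) < N%:R by near: N; exact: nbhs_infty_gtr.
apply: (@le_trans _ _ (c * N%:R `^ (- th - e / 2))); last by near: N.
have -> : - th - e = - (e / 2) + (- th - e / 2) by field.
rewrite [leLHS]powRD; last by rewrite (gt_eqF N0) implybT.
apply: ler_wpM2r; first exact: powR_ge0.
rewrite powRN -[leRHS]invrK lef_pV2 ?posrE ?powR_gt0 ?invr_gt0//.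
by apply: ltW; near: N; exact: powR_near.
Unshelve. all: by end_near. Qed.

End power_scale.

Section unit_root.
Context {R : realType} (g : probability R R).
Hypothesis tg : tame g.
Variable m : probability (@seqT R) R.
Hypothesis gm : iid_law g m.
Local Notation seqT := (@seqT R).
Local Notation pN a1 a2 N := (pr m (neg a1 a2 N)).
Local Notation beta := (fine (g `]-oo, -1]%classic)).
Let beta0 : 0 < beta := ray_gt0 tg (-1).

Definition wbelow (x : R) N : set seqT := [set u | forall n, (1 <= n <= N)%N -> walk u n <= x].

Lemma measurable_wbelow x N : measurable (wbelow x N).
Proof.
apply: (@measurable_forall_le R _ seqT (fun i => 1 <= i <= N)%N (fun i u => walk u i) (fun _ _ => x)) => i.
  exact: measurable_walk.
exact: measurable_cst.
Qed.

Lemma wbelow0 N : pr m (wbelow 0 N) = cbin N.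
Proof.
rewrite -(sparre_andersen tg gm); congr (pr m _).
by apply/seteqP; split => u H i /H; rewrite arx_walk.
Qed.

Lemma wbelow_shift x N : 0 <= x -> beta * pr m (wbelow (x + 1) N) <= pr m (wbelow x N).
Proof.
move=> x0.
pose A : set seqT := [set u | u 0%N \in `]-oo, -1]].
have mA : measurable A.
  rewrite [X in measurable X](_ : _ = [set u : seqT | u 0%N <= -1]).
    by apply: measurable_le_set => //; exact: measurable_coord.
  by apply/seteqP; split => u /=; rewrite /A /= in_itv.
have bA : beta = pr m A.
  by rewrite /pr -(prob_coord gm 0 (B := `]-oo, -1]%classic)).
apply: (@le_trans _ _ (pr m (A `&` [set u : seqT | wbelow (x + 1) N (fun i => u (1 + i)%N)]))).
  rewrite /pr (prob_prefix_shift gm mA (measurable_wbelow _ _)); last first.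
    by move=> u v uv; rewrite /A /= uv.
  have -> : m A = (pr m A)%:E by exact: prE.
  have -> : m (wbelow (x + 1) N) = (pr m (wbelow (x + 1) N))%:E by apply: prE; exact: measurable_wbelow.
  by rewrite /= bA.
apply: le_pr; last 1 first.
- move=> u [Au Bu] [//|i] /andP[_ ia].
  have u0 : u 0%N <= -1 by move: Au; rewrite /A /= in_itv.
  rewrite -[i.+1]/(1 + i)%N walk_shift walkS walk0 add0r.
  have : walk (fun j => u (1 + j)%N) i <= x + 1.
    by case: i ia => [|i] ia; [rewrite walk0; lra|apply: Bu; rewrite /= ltnW].
  lra.
- apply: measurableI => //.
  by rewrite -[X in measurable X]setTI; apply: measurable_shift => //; exact: measurable_wbelow.
- exact: measurable_wbelow.
Qed.

Lemma wbelow_ub : exists t, 0 <= t /\ forall x N, 0 <= x ->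
  pr m (wbelow x N) <= expR (t * (x + 1)) * cbin N.
Proof.
have b1 : beta <= 1 by exact/ltW/ray_lt1.
exists (- ln beta); have t0 : 0 <= - ln beta by rewrite oppr_ge0 ln_le0.
split=> // x a x0.
have step y : 0 <= y -> pr m (wbelow (y + 1) a) <= beta^-1 * pr m (wbelow y a).
  by move=> y0; rewrite ler_pdivlMl//; exact: wbelow_shift.
have H k : pr m (wbelow k%:R a) <= expR (- ln beta * k%:R) * cbin a.
  elim: k => [|k IHk]; first by rewrite mulr0 expR0 mul1r wbelow0.
  rewrite -natr1; apply: (le_trans (step _ _)) => //.
  have -> : expR (- ln beta * (k%:R + 1)) = beta^-1 * expR (- ln beta * k%:R).
    by rewrite mulrDr mulr1 expRD mulrC expRN lnK.
  by rewrite -mulrA; apply: ler_wpM2l => //; rewrite invr_ge0 ltW.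
have := truncnS_gt x; set k := (Num.truncn x).+1 => xk.
have kx : k%:R <= x + 1.
  by rewrite /k -natr1 lerD2r truncn_le.
apply: (@le_trans _ _ (pr m (wbelow k%:R a))).
  apply: le_pr; try exact: measurable_wbelow.
  by move=> u Hu i /Hu h; exact: le_trans h (ltW xk).
apply: (le_trans (H k)); apply: ler_wpM2r; first exact/ltW/cbin_gt0.
by rewrite ler_expR; apply: ler_wpM2l.
Qed.

Lemma tail_exp (t : R) : 0 <= t -> exists M : R, 0 <= M /\
  forall K, fine (g [set y | K < `|y|]) <= M * expR (- (t * K)).
Proof.
move=> t0.
have me : measurable_fun setT (fun y : R => expR (t * `|y|)).
  apply: (measurableT_comp (f := @expR R)); first exact: measurable_expR.
  by apply: measurable_funM; [exact: measurable_cst|exact: normr_measurable].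
have [M [M0 EM]] : exists M : R, 0 <= M /\ (\int[g]_y (expR (t * `|y|))%:E = M%:E)%E.
  apply: (@moment_fin R g tg (fun y => expR (t * `|y|)) 1 t) => //.
  by move=> y; rewrite mul1r.
exists M; split=> // K; have mA := measurable_norm_gt K.
rewrite expRN ler_pdivlMr ?expR_gt0// -lee_fin EFinM -g_fin// -EM muleC.
rewrite -[in leLHS](setIT [set y | K < `|y|]) -integral_indic// -ge0_integralZl//; last exact: EFin_indic_measurable.
apply: ge0_le_integral => //.
- by apply: emeasurable_funM => //; exact: EFin_indic_measurable.
- exact/measurable_EFinP.
move=> y _; rewrite -EFinM lee_fin indicE; case: (boolP (y \in _)) => [|_].
  by rewrite inE /= mulr1 => /ltW Ky; rewrite ler_expR; exact: ler_wpM2l.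
by rewrite mulr0 expR_ge0.
Qed.

Section interior.
Variable b : R.
Hypothesis b1 : `|b| < 1.
Local Notation Xb u n := (arx (1 + b) (- (1 * b)) u n).
Let kap := `|b| / (1 - `|b|).

Let b1' : 0 < 1 - `|b|. Proof. by rewrite subr_gt0. Qed.

Let kap0 : 0 <= kap. Proof. by rewrite divr_ge0// ltW. Qed.

Lemma arx_unit (u : nat -> R) n : (1 - b) * Xb u n = \sum_(i < n) (1 - b ^+ (n - i)) * u i.
Proof.
elim: n => [|n IHn]; first by rewrite arx0 mulr0 big_ord0.
have := arx_factor 1 b u n; rewrite arx_walk => E.
have -> : (1 - b) * Xb u n.+1 = (1 - b) * walk u n.+1 + b * ((1 - b) * Xb u n) by rewrite E; ring.
rewrite IHn /walk !big_ord_recr/= subSnn expr1 mulrDr addrAC; congr (_ + _).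
rewrite mulr_sumr mulr_sumr -big_split/=; apply: eq_bigr => i _.
rewrite subSn ?exprS; last exact/ltnW.
ring.
Qed.

Lemma arx_unit_walk (u : nat -> R) n (K : R) : 0 <= K -> (forall i, (i < n)%N -> `|u i| <= K) ->
  `|(1 - b) * Xb u n - walk u n| <= kap * K.
Proof.
move=> K0 uK; rewrite arx_unit /walk -sumrB.
rewrite (eq_bigr (fun i : 'I_n => - (b ^+ (n - i) * u i))); last by move=> i _; ring.
apply: (le_trans (ler_norm_sum _ _ _)).
apply: (@le_trans _ _ (\sum_(i < n) `|b| * `|b| ^+ (n - i.+1) * K)).
  apply: ler_sum => i _; rewrite normrN normrM normrX -exprS -subSn//.
  by apply: ler_wpM2l; [exact: exprn_ge0|exact: uK].
rewrite -mulr_suml; apply: ler_wpM2r => //; rewrite -mulr_sumr; apply: ler_wpM2l => //.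
rewrite (reindex_inj rev_ord_inj)/=.
rewrite (eq_bigr (fun i : 'I_n => `|b| ^+ i)); last first.
  by move=> i _; congr (_ ^+ _); have := ltn_ord i; clear; lia.
by rewrite -(big_mkord xpredT (fun i => `|b| ^+ i)) /index_iota subn0; apply: sum_geom_le; rewrite normr_ge0.
Qed.

Lemma arx_unit_split (u : nat -> R) k n :
  (1 - b) * Xb u (k + n) = \sum_(i < k) (1 - b ^+ (k + n - i)) * u i + (1 - b) * Xb (fun i => u (k + i)%N) n.
Proof.
rewrite !arx_unit big_split_ord/=; congr (_ + _).
by apply: eq_bigr => i _; rewrite subnDl.
Qed.

Let omb : 0 < 1 - b. Proof. by rewrite subr_gt0 (le_lt_trans (ler_norm b)). Qed.

Lemma unit_root_ub K N : 0 <= K ->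
  pN (1 + b) (- (1 * b)) N <= pr m (wbelow (kap * K) N) + N%:R * fine (g [set y | K < `|y|]).
Proof.
move=> K0; apply: (@le_trans _ _ (pr m (wbelow (kap * K) N `|` [set u : seqT | exists i, (i < N)%N /\ K < `|u i|]))).
  apply: le_pr.
  - exact: measurable_negset.
  - by apply: measurableU; [exact: measurable_wbelow|exact: measurable_some_large].
  move=> u Hu; have [?|no] := pselect (exists i, (i < N)%N /\ K < `|u i|); [by right|left].
  move=> n /andP[n1 nN].
  have uK i : (i < n)%N -> `|u i| <= K.
    by move=> i_n; rewrite leNgt; apply/negP => h; apply: no; exists i; rewrite (leq_trans i_n).
  have := arx_unit_walk K0 uK; rewrite ler_norml => /andP[h _].
  have : (1 - b) * Xb u n <= 0 by rewrite mulr_ge0_le0 ?(ltW omb)//; apply: Hu; rewrite n1.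
  lra.
apply: (le_trans (pr_setU_le m _ _)).
- exact: measurable_wbelow.
- exact: measurable_some_large.
by rewrite lerD2l; exact: (pr_some_large gm).
Qed.

(* The first [k] steps, all at most -1, build a reserve that absorbs the error [kap * K]
   of the comparison with the random walk. *)
Lemma unit_root_lb K k N : 0 <= K -> kap * K <= k%:R * (1 - `|b|) ->
  beta ^+ k * (cbin N - N%:R * fine (g [set y | K < `|y|])) <= pN (1 + b) (- (1 * b)) N.
Proof.
move=> K0 kK.
pose A : set seqT := cylinder k (fun=> `]-oo, -1]%classic).
pose L : set seqT := [set u : seqT | exists i, (i < N)%N /\ K < `|u i|].
pose B : set seqT := wbelow 0 N `\` L.
have mL : measurable L by exact: measurable_some_large.
have mW := measurable_wbelow 0 N.
have mB : measurable B by exact: measurableD.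
have mA : measurable A by exact: measurable_cylinder.
have mS : measurable [set u : seqT | B (fun i => u (k + i)%N)].
  by rewrite -[X in measurable X]setTI; exact: measurable_shift.
apply: (@le_trans _ _ (pr m (A `&` [set u : seqT | B (fun i => u (k + i)%N)]))).
  rewrite /pr (prob_prefix_shift gm mA mB); last first.
    by move=> u v uv Au i ik; rewrite -uv//; exact: Au.
  have -> : m A = (pr m A)%:E by exact: prE.
  have -> : m B = (pr m B)%:E by exact: prE.
  rewrite -[leRHS]/(pr m A * pr m B).
  have -> : pr m A = beta ^+ k.
    by rewrite (pr_cylinder gm)// big_const_seq count_predT size_iota iter_mulr_1.
  apply: ler_wpM2l; first by rewrite exprn_ge0// ltW.
  rewrite -wbelow0 lerBlDr; apply: (@le_trans _ _ (pr m (B `|` L))).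
    apply: le_pr => //; first exact: measurableU.
    by move=> u Wu; have [Lu|nLu] := pselect (L u); [right|left].
  apply: (le_trans (pr_setU_le m mB mL)); rewrite lerD2l; exact: (pr_some_large gm).
apply: (@le_trans _ _ (pN (1 + b) (- (1 * b)) (k + N))); last first.
  apply: le_pr; try exact: measurable_negset.
  by apply: neg_le; rewrite leq_addl.
apply: le_pr; [exact: measurableI|exact: measurable_negset|].
move=> u [Au [Wu Lu]] n /andP[n1 nkN].
have u1 i : (i < k)%N -> u i <= -1 by move=> ik; have := Au i ik; rewrite /= in_itv.
have bj j : (0 < j)%N -> 1 - `|b| <= 1 - b ^+ j.
  case: j => // j _; rewrite lerD2l lerN2 (le_trans (ler_norm _))// normrX exprS.
  by rewrite ler_piMr// exprn_ile1// ltW.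
rewrite -(pmulr_rle0 _ omb).
have [nk|kn] := leqP n k.
  rewrite arx_unit; apply: sumr_le0 => i _; rewrite mulr_ge0_le0//.
    by apply: le_trans (bj _ _); [exact: ltW|rewrite subn_gt0].
  by apply: (le_trans (u1 _ _)); [exact: leq_trans nk|lra].
rewrite -(subnKC (ltnW kn)) arx_unit_split.
have h1 : \sum_(i < k) (1 - b ^+ (k + (n - k) - i)) * u i <= - (k%:R * (1 - `|b|)).
  rewrite mulr_natl -mulNrn -[X in _ *+ X]card_ord -sumr_const; apply: ler_sum => i _.
  have hb : 1 - `|b| <= 1 - b ^+ (k + (n - k) - i).
    by apply: bj; have := ltn_ord i; move: kn; clear; lia.
  have := ler_wpM2l (le_trans (ltW b1') hb) (u1 i (ltn_ord i)).
  lra.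
pose v := fun i => u (k + i)%N.
have vK i : (i < n - k)%N -> `|v i| <= K.
  move=> ik; rewrite leNgt; apply/negP => h; apply: Lu; exists i; split => //.
  by move: ik nkN; clear; lia.
have := arx_unit_walk K0 vK; rewrite ler_norml => /andP[_ h2].
have h3 : walk v (n - k) <= 0 by apply: Wu; move: kn nkN; clear; lia.
rewrite -/v; lra.
Qed.

End interior.

Lemma cbin_ub N : (0 < N)%N -> cbin N <= N%:R `^ (- (1 / 2)) :> R.
Proof.
move=> N0; have Np : (0 : R) < N%:R by rewrite ltr0n.
rewrite powRN mul1r powR12_sqrt; last exact: ltW.
have r0 : 0 < Num.sqrt N%:R :> R by rewrite sqrtr_gt0.
rewrite -[leRHS]mul1r ler_pdivlMr//.
have := sqr_sqrtr (ltW Np); have := cbin_sqr_ub (R := R) N; have := cbin_gt0 (R := R) N.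
move: (Num.sqrt _) r0 (cbin N) => r r0 x x0 h rE.
rewrite -(@ler_pXn2r _ 2) ?nnegrE ?mulr_ge0 ?ltW// expr1n exprMn rE.
by have := sqr_ge0 x; lra.
Qed.

Lemma cbin_lb N : (0 < N)%N -> 1 / 2 * N%:R `^ (- (1 / 2)) <= cbin N :> R.
Proof.
move=> N0; have Np : (0 : R) < N%:R by rewrite ltr0n.
have h : 1 / 4 <= N%:R * cbin N ^+ 2 :> R.
  case: N N0 {Np} => // N _; elim: N => [|N IHN]; last exact: le_trans (cbin_sqr_incr _).
  by have -> : cbin 1 = 1 / 2 :> R; [rewrite cbinS /=; field|rewrite expr2; lra].
have -> : N%:R `^ (- (1 / 2)) = (Num.sqrt N%:R)^-1 :> R.
  by rewrite powRN mul1r powR12_sqrt// ltW.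
have r0 : 0 < Num.sqrt N%:R :> R by rewrite sqrtr_gt0.
rewrite ler_pdivrMr//; have := sqr_sqrtr (ltW Np); have := cbin_gt0 (R := R) N.
move: h; move: (Num.sqrt _) r0 (cbin N) => r r0 x h x0 rE.
have k0 : 0 <= 1 / 2 :> R by lra.
have k1 : 0 <= x * r by rewrite mulr_ge0// ltW.
by rewrite -(@ler_pXn2r _ 2)// [leRHS]exprMn rE expr2; lra.
Qed.

Lemma powR_expR (a x : R) : 0 < a -> a `^ x = expR (x * ln a).
Proof. by move=> a0; rewrite /powR gt_eqF. Qed.

Lemma unit_root_expo b : `|b| < 1 ->
  expo_le (1 / 2) (fun N => pN (1 + b) (- (1 * b)) N) /\
  expo_ge (1 / 2) (fun N => pN (1 + b) (- (1 * b)) N).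
Proof.
move=> b1; pose kap := `|b| / (1 - `|b|).
have b1' : 0 < 1 - `|b| by rewrite subr_gt0.
have kap0 : 0 <= kap by rewrite divr_ge0// ltW.
split=> e e0.
  have [t [t0 Ht]] := wbelow_ub.
  pose de := e / (t * kap + 1).
  have tk : 0 < t * kap + 1 by have := mulr_ge0 t0 kap0; lra.
  have de0 : 0 < de by rewrite divr_gt0.
  have dee : t * kap * de <= e.
    by rewrite /de mulrCA ler_piMr ?(ltW e0)// ler_pdivrMr// mul1r lerDl.
  have [M [M0 HM]] := tail_exp (divr_ge0 (ler0n _ 3) (ltW de0)).
  exists (expR t + M); near=> N.
  have N0 : (0 < N)%N by near: N; exact: nbhs_infty_gt.
  have Np : (0 : R) < N%:R by rewrite ltr0n.
  have l0 : 0 <= ln N%:R :> R by rewrite ln_ge0// ler1n.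
  have K0 : 0 <= de * ln N%:R by rewrite mulr_ge0// ltW.
  apply: (le_trans (unit_root_ub b1 N K0)); rewrite mulrDl -/kap.
  have NE : N%:R = expR (ln N%:R) :> R by rewrite lnK.
  apply: lerD.
    apply: (le_trans (Ht _ _ _)); first by rewrite mulr_ge0.
    apply: (le_trans (ler_wpM2l (expR_ge0 _) (cbin_ub N0))).
    rewrite !powR_expR// -!expRD ler_expR.
    have := ler_wpM2r l0 dee; lra.
  apply: (le_trans (ler_wpM2l (ltW Np) (HM _))).
  rewrite mulrCA; apply: ler_wpM2l => //.
  rewrite {1}NE powR_expR// -expRD ler_expR.
  have -> : 3 / de * (de * ln N%:R) = 3 * ln N%:R by field; rewrite gt_eqF.
  have := mulr_ge0 (ltW e0) l0; lra.
pose s := - ln beta.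
have s0 : 0 <= s by rewrite oppr_ge0 ln_le0//; exact/ltW/ray_lt1.
pose q := kap / (1 - `|b|).
have q0 : 0 <= q by rewrite divr_ge0// ltW.
pose de := e / (s * q + 1).
have tk : 0 < s * q + 1 by have := mulr_ge0 s0 q0; lra.
have de0 : 0 < de by rewrite divr_gt0.
have dee : s * q * de <= e.
  by rewrite /de mulrCA ler_piMr ?(ltW e0)// ler_pdivrMr// mul1r lerDl.
have [M [M0 HM]] := tail_exp (divr_ge0 (ler0n _ 3) (ltW de0)).
exists (expR (- s) / 4); split; first by rewrite divr_gt0// expR_gt0.
near=> N.
have N0 : (0 < N)%N by near: N; exact: nbhs_infty_gt.
have Np : (0 : R) < N%:R by rewrite ltr0n.
have NM : 4 * M < N%:R `^ (3 / 2) by near: N; apply: powR_near; lra.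
have l0 : 0 <= ln N%:R :> R by rewrite ln_ge0// ler1n.
have NE : N%:R = expR (ln N%:R) :> R by rewrite lnK.
pose K := de * ln N%:R.
have K0 : 0 <= K by rewrite mulr_ge0// ltW.
have := truncnS_gt (q * K); set k := (Num.truncn (q * K)).+1 => xk.
have kx : k%:R <= q * K + 1 by rewrite /k -natr1 lerD2r truncn_le mulr_ge0.
have kK : kap * K <= k%:R * (1 - `|b|).
  by rewrite -ler_pdivrMr// mulrAC ltW.
apply: le_trans (unit_root_lb b1 N K0 kK).
have -> : expR (- s) / 4 * N%:R `^ (- (1 / 2) - e) =
    expR (- s - e * ln N%:R) * (1 / 4 * N%:R `^ (- (1 / 2))).
  rewrite !powR_expR// expRD mulrBl expRD; ring.
apply: ler_pM; try exact: expR_ge0.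
- by rewrite mulr_ge0 ?powR_ge0//; lra.
- have -> : beta ^+ k = expR (- s * k%:R).
    by rewrite /s opprK mulrC expRM_natl lnK.
  rewrite ler_expR; have := ler_wpM2l s0 kx; have := ler_wpM2r l0 dee.
  by rewrite /K; lra.
have := cbin_lb N0; suff : N%:R * fine (g [set y | K < `|y|]) <= 1 / 4 * N%:R `^ (- (1 / 2)) by lra.
apply: (le_trans (ler_wpM2l (ltW Np) (HM _))).
have -> : 3 / de * K = 3 * ln N%:R by rewrite /K; field; rewrite gt_eqF.
have -> : N%:R * (M * expR (- (3 * ln N%:R))) = M * (N%:R `^ (- (3 / 2)) * N%:R `^ (- (1 / 2))).
  rewrite {1}NE !powR_expR// -expRD mulrCA -expRD; congr (_ * expR _); lra.
rewrite mulrA; apply: ler_wpM2r; first exact: powR_ge0.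
rewrite powRN ler_pdivrMr ?powR_gt0//; lra.
Unshelve. all: by end_near. Qed.

End unit_root.

(** * Regimes *)

Section regions.
Context {R : realType} (g : probability R R).
Hypothesis tg : tame g.
Variable m : probability (@seqT R) R.
Hypothesis gm : iid_law g m.
Local Notation seqT := (@seqT R).
Local Notation pN a1 a2 N := (pr m (neg a1 a2 N)).

Lemma real_roots (a1 a2 : R) : 0 <= a1 ^+ 2 + 4 * a2 ->
  exists r s1 s2, [/\ 0 <= r, r ^+ 2 = a1 ^+ 2 + 4 * a2, s1 = (a1 + r) / 2,
    s2 = (a1 - r) / 2 & (s1 + s2 = a1 /\ - (s1 * s2) = a2)].
Proof.
move=> D0; pose r := Num.sqrt (a1 ^+ 2 + 4 * a2).
have r2 : r ^+ 2 = a1 ^+ 2 + 4 * a2 by rewrite sqr_sqrtr.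
exists r, ((a1 + r) / 2), ((a1 - r) / 2); split=> //; first exact: sqrtr_ge0.
split; first by field.
have -> : - ((a1 + r) / 2 * ((a1 - r) / 2)) = (r ^+ 2 - a1 ^+ 2) / 4 by field.
by rewrite r2; field.
Qed.

Lemma lt_of_sqr (x y : R) : 0 <= y -> x ^+ 2 < y ^+ 2 -> x < y.
Proof.
move=> y0 h; rewrite ltNge; apply/negP => yx; move: h; rewrite ltNge => /negP; apply.
by rewrite ler_pXn2r// nnegrE// (le_trans y0).
Qed.

Lemma le_of_sqr (x y : R) : 0 <= y -> x ^+ 2 <= y ^+ 2 -> x <= y.
Proof.
move=> y0 h; rewrite leNgt; apply/negP => yx; move: h; rewrite leNgt => /negP; apply.
by rewrite ltr_pXn2r// nnegrE// (le_trans y0)// ltW.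
Qed.

Lemma regionC_bound (a1 a2 : R) : regionC a1 a2 -> exists c : R, 0 < c /\ forall N, c <= pN a1 a2 N.
Proof.
move=> HC.
have a10 : 0 <= a1 by case: HC => [[? _]|[[/andP[? _] _]|[[_ ?]|[-> _]]]]//; lra.
have [a20|a20] := leP 0 a2.
  apply: (neg_pos_ge0 tg gm) => //.
  case: HC => [[? _]|[[/andP[? ?] ?]|[[E ?]|[-> ?]]]]; try lra.
have D0 : 0 <= a1 ^+ 2 + 4 * a2.
  case: HC => [[_ /ltW]|[[/andP[? ?] ?]|[[-> _]|[_ ?]]]]//; last lra.
  by have := sqr_ge0 (a1 - 2); rewrite !expr2; lra.
have [r [s1 [s2 [r0 r2 s1E s2E [sE sM]]]]] := real_roots D0.
have s11 : 1 < s1.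
  have : 2 - a1 < r; last by rewrite s1E; lra.
  case: HC => [[h1 h2]|[[/andP[? ?] ?]|[[_ ?]|[_ ?]]]]; [| | lra | lra].
    have : r != 0 by apply: contraTneq h2 => r00; rewrite -r2 r00 expr0n ltxx.
    by rewrite neq_lt => /orP[|]; lra.
  by apply: lt_of_sqr => //; rewrite r2 !expr2; lra.
have s20 : 0 <= s2.
  have : r <= a1 by apply: le_of_sqr => //; rewrite r2; lra.
  by rewrite s2E; lra.
have s10 : 0 <= s1 by lra.
have s11' : 1 < s1 + 0 by rewrite addr0.
have [c [c0 Hc]] := neg_pos_ge0 tg gm s10 (lexx 0) s11'.
exists c; split=> // N; apply: (le_trans (Hc N)).
rewrite -sE -sM; apply: le_pr; try exact: measurable_negset.
exact: neg_factor_ge0.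
Qed.

Lemma regionE_decay (a1 a2 : R) : regionE a1 a2 -> exp_decay (fun N => pN a1 a2 N).
Proof.
move=> [nC nP].
have stable s1 s2 : `|s1| < 1 -> `|s2| < 1 -> s1 + s2 = a1 -> - (s1 * s2) = a2 ->
    exp_decay (fun N => pN a1 a2 N).
  by move=> h1 h2 <- <-; exact: (decay_stable tg gm).
have [a20|a20] := leP a2 0.
  have [a10|a10] := leP a1 0; first by apply: (decay_no_positive_root tg gm) => //; left.
  have [D0|D0] := leP 0 (a1 ^+ 2 + 4 * a2); last by apply: (decay_no_positive_root tg gm) => //; right.
  have a12 : a1 < 2.
    rewrite ltNge; apply/negP => a1g; move: D0; rewrite le_eqVlt => /predU1P[D0|D0].
      move: a1g; rewrite le_eqVlt => /predU1P[a1E|a1g].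
        by apply: nP; split; [|apply/andP; split]; move: D0; rewrite -a1E expr2; lra.
      by apply: nC; right; right; left; split.
    by apply: nC; left.
  have s1 : a1 + a2 < 1.
    rewrite ltNge le_eqVlt; apply/negP => /predU1P[E|E].
      by apply: nP; split => //; apply/andP; split; lra.
    by apply: nC; right; left; rewrite a10 a12.
  have [r [s [t [r0 r2 sE tE [h1 h2]]]]] := real_roots D0.
  have ra : r <= a1 by apply: le_of_sqr; [exact: ltW|rewrite r2; lra].
  have rb : r < 2 - a1 by apply: lt_of_sqr; [lra|rewrite r2 !expr2; lra].
  by apply: (stable s t) => //; rewrite ger0_norm ?sE ?tE; lra.
have D0 : 0 <= a1 ^+ 2 + 4 * a2 by have := sqr_ge0 a1; lra.
have [r [s [t [r0 r2 sE tE [h1 h2]]]]] := real_roots D0.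
have [a10|a10] := leP 0 a1.
  have s1 : a1 + a2 < 1.
    rewrite ltNge le_eqVlt; apply/negP => /predU1P[E|E].
      by apply: nP; split => //; apply/andP; split; lra.
    apply: nC; have [a12|a12] := leP 2 a1; first by left; split => //; have := sqr_ge0 a1; lra.
    move: a10; rewrite le_eqVlt => /predU1P[a10|a10]; last by right; left; rewrite a10 a12.
    by right; right; right; split => //; lra.
  have ra : a1 <= r by apply: le_of_sqr => //; rewrite r2; lra.
  have rb : r < 2 - a1 by apply: lt_of_sqr; [lra|rewrite r2 !expr2; lra].
  by apply: (stable s t) => //; rewrite ltr_norml ?sE ?tE; apply/andP; split; lra.
have ra : - a1 < r by apply: lt_of_sqr => //; rewrite r2 sqrrN; lra.
have [s1|s1] := leP 1 s.
  have <- : s - - t = a1 by rewrite opprK.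
  have <- : s * - t = a2 by rewrite mulrN.
  by apply: (decay_alternating tg gm) => //; rewrite sE tE; lra.
apply: (@exp_decay_le R _ (fun N => pN s 0 N)).
  move=> N; rewrite -h1 -h2; apply: le_pr; try exact: measurable_negset.
  by apply: neg_factor_le0; rewrite tE; lra.
have -> : (fun N => pN s 0 N) = (fun N => pN (s + 0) (- (s * 0)) N).
  by apply/funext => N; rewrite addr0 mulr0 oppr0.
apply: (decay_stable tg gm); last by rewrite normr0.
by rewrite ltr_norml; apply/andP; split=> //; rewrite sE; lra.
Qed.

Lemma persist_gt0 (a1 a2 : R) N : 0 < pN a1 a2 N.
Proof.
elim: N => [|N IHN].
  rewrite /pr (_ : neg a1 a2 0 = setT) ?(iid_law_setT gm)//.
  by apply/seteqP; split => // u _ [|n] //.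
pose phi (u : seqT) := a1 * (arp a1 a2 u N).2 + a2 * (arp a1 a2 u N).1.
have arxE u : arx a1 a2 u N.+1 = phi u + u N by [].
have mphi : measurable_fun setT phi.
  apply: (eq_measurable_fun (fun u : seqT => arx a1 a2 u N.+1 - u N)) => [u _|].
    by rewrite arxE addrK.
  by apply: measurable_funB; [exact: measurable_arx|exact: measurable_coord].
pose E L : set seqT := neg a1 a2 N `&` [set u | phi u <= L%:R].
have mE L : measurable (E L).
  apply: measurableI; first exact: measurable_negset.
  by apply: measurable_le_set => //; exact: measurable_cst.
have [L EL] : exists L, 0 < pr m (E L).
  apply: contrapT => /forallNP none.
  have : m.-negligible (neg a1 a2 N).
    apply: (@negligibleS _ _ _ m (\bigcup_L E L)).
      move=> u Nu; have := truncnS_gt (phi u) => /ltW h.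
      by exists (Num.truncn (phi u)).+1.
    apply: negligible_bigcup => L; apply/negligibleP => //.
    have : pr m (E L) = 0.
      by apply/eqP; rewrite eq_le pr_ge0 andbT leNgt; apply/negP; exact: none.
    by move=> h; transitivity ((pr m (E L))%:E); [exact: prE|rewrite h].
  move=> ng; have h : m (neg a1 a2 N) = 0%E by apply/negligibleP => //; exact: measurable_negset.
  by move: IHN; rewrite /pr h ltxx.
pose B : set seqT := [set u | u 0%N <= - L%:R].
have mB : measurable B by apply: measurable_le_set => //; exact: measurable_coord.
have Bp : 0 < pr m B.
  rewrite (_ : B = [set u : seqT | `]-oo, (- L%:R)]%classic (u 0%N)]); last first.
    by apply/seteqP; split => u /=; rewrite in_itv.
  by rewrite /pr (prob_coord gm 0 (B := `]-oo, (- L%:R)]%classic)); [exact: (ray_gt0 tg)|].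
apply: (@lt_le_trans _ _ (pr m (E L `&` [set u : seqT | B (fun i => u (N + i)%N)]))).
  rewrite /pr (prob_prefix_shift gm (mE L) mB).
    have -> : m (E L) = (pr m (E L))%:E by exact: prE.
    have -> : m B = (pr m B)%:E by exact: prE.
    by rewrite -[ltRHS]/(pr m (E L) * pr m B) mulr_gt0.
  move=> u v uv [Nu Pu]; split; first exact: neg_ext uv Nu.
  move: Pu; rewrite /= /phi; have <- // : arp a1 a2 u N = arp a1 a2 v N.
  have H n : (n <= N)%N -> arp a1 a2 u n = arp a1 a2 v n; last exact: H.
  by elim: n => //= n IHn nN; rewrite IHn ?uv//; exact: ltnW.
apply: le_pr.
- apply: measurableI => //.
  by rewrite -[X in measurable X]setTI; apply: measurable_shift.
- exact: measurable_negset.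
move=> u [[Nu Pu] Bu] n /andP[n1]; rewrite leq_eqVlt => /predU1P[->|nN].
  by rewrite arxE; move: Pu Bu; rewrite /B /= addn0; lra.
by apply: Nu; rewrite n1.
Qed.

Lemma persist_le1 (a1 a2 : R) N : pN a1 a2 N <= 1.
Proof. by apply: pr_le1; exact: measurable_negset. Qed.

Lemma persist_nonincr (a1 a2 : R) n k : (n <= k)%N -> pN a1 a2 k <= pN a1 a2 n.
Proof. by move=> nk; apply: le_pr; try exact: measurable_negset; exact: neg_le. Qed.

Section exponents.
Variables a1 a2 : R.
Local Notation p := (fun N => pN a1 a2 N).

Lemma limit_of_regionC : regionC a1 a2 -> exists pinf : R, 0 < pinf /\ p N @[N --> \oo] --> pinf.
Proof.
move=> /regionC_bound[c [c0 Hc]].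
have pcv : cvgn p.
  apply: nonincreasing_is_cvgn; first by move=> n k; exact: persist_nonincr.
  by exists c => _ [N _ <-]; exact: Hc.
exists (limn p); split=> //; apply: (lt_le_trans c0); apply: limr_ge => //.
by near=> N; exact: Hc.
Unshelve. all: by end_near. Qed.

Lemma expo_of_limit : (exists pinf : R, 0 < pinf /\ p N @[N --> \oo] --> pinf) ->
  expo_le 0 p /\ expo_ge 0 p.
Proof.
move=> [pinf [p0 pcv]]; split.
  apply: (@expo_le_of R 0 _ 1) => //; near=> N; rewrite oppr0 powRr0 mulr1; exact: persist_le1.
apply: (@expo_ge_of R 0 _ (pinf / 2)); first by rewrite divr_gt0.
have lt : pinf / 2 < pinf by lra.
near=> N; rewrite oppr0 powRr0 mulr1; near: N; exact: (cvgr_ge _ pcv).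
Unshelve. all: by end_near. Qed.

Lemma expo_of_inverse : (exists c : R, 0 < c /\ p N / (c * N%:R^-1) @[N --> \oo] --> (1 : R)) ->
  expo_le 1 p /\ expo_ge 1 p.
Proof.
move=> [c [c0 pcv]].
have scale N (x : R) : (0 < N)%N -> x * c * N%:R `^ (- 1) = x * (c * N%:R^-1).
  by move=> N0; rewrite powRN powRr1// mulrA.
have pos N : (0 < N)%N -> 0 < c * N%:R^-1 by move=> N0; rewrite mulr_gt0// invr_gt0 ltr0n.
split.
  apply: (@expo_le_of R 1 _ (2 * c)); first by rewrite mulr_ge0// ltW.
  near=> N; have N0 : (0 < N)%N by near: N; exact: nbhs_infty_gt.
  rewrite scale// -ler_pdivrMr ?pos//; near: N; apply: (cvgr_le _ pcv); lra.
apply: (@expo_ge_of R 1 _ (1 / 2 * c)); first by rewrite mulr_gt0//; lra.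
near=> N; have N0 : (0 < N)%N by near: N; exact: nbhs_infty_gt.
rewrite scale// -ler_pdivlMr ?pos//; near: N; apply: (cvgr_ge _ pcv); lra.
Unshelve. all: by end_near. Qed.

Lemma expo_of_quarter : asymp p (fun N => N%:R `^ (- (1 / 4))) ->
  expo_le (1 / 4) p /\ expo_ge (1 / 4) p.
Proof.
move=> [[M HM] [L HL]]; split.
  apply: (@expo_le_of R (1 / 4) _ `|M|) => //; near=> N.
  have N0 : (0 : R) < N%:R by near: N; exact: nbhs_infty_gtr.
  rewrite -ler_pdivrMr ?powR_gt0//; apply: (@le_trans _ _ M); last exact: ler_norm.
  by near: N.
have L0 : 0 < `|L| + 1 by rewrite ltr_wpDl.
apply: (@expo_ge_of R (1 / 4) _ (`|L| + 1)^-1); first by rewrite invr_gt0.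
near=> N; rewrite ler_pdivrMl// -ler_pdivrMr; last exact: persist_gt0.
apply: (@le_trans _ _ L); last by have := ler_norm L; lra.
by near: N.
Unshelve. all: by end_near. Qed.

Lemma expo_of_half : (exists e : nat -> R, e N @[N --> \oo] --> (0 : R) /\
    \forall N \near \oo, p N = N%:R `^ (- (1 / 2) + e N)) ->
  expo_le (1 / 2) p /\ expo_ge (1 / 2) p.
Proof.
move=> [e [e0 pe]]; split=> d d0.
  exists 1; near=> N; have N1 : (1 : R) <= N%:R by near: N; exact: nbhs_infty_ger.
  have -> : p N = N%:R `^ (- (1 / 2) + e N) by near: N.
  rewrite [leRHS]mul1r; apply: ler_powR => //; rewrite lerD2l.
  by near: N; exact: (cvgr_le _ e0).
exists 1; split=> //; near=> N; have N1 : (1 : R) <= N%:R by near: N; exact: nbhs_infty_ger.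
have -> : p N = N%:R `^ (- (1 / 2) + e N) by near: N.
rewrite [leLHS]mul1r; apply: ler_powR => //; rewrite lerD2l.
by near: N; apply: (cvgr_ge _ e0); rewrite oppr_lt0.
Unshelve. all: by end_near. Qed.

Lemma expo_of_exponential : (exists lam : R, 0 < lam /\ precsim p (fun N => expR (- lam * N%:R))) ->
  forall k, expo_le k.+1%:R p.
Proof.
move=> [lam [l0 [M HM]]] k.
pose F : R := (k.+1)`!%:R / lam ^+ k.+1.
have F0 : 0 < F by rewrite divr_gt0 ?exprn_gt0// ltr0n fact_gt0.
apply: (@expo_le_of R _ _ (`|M| * F)); first by rewrite mulr_ge0// ltW.
near=> N; have N0 : (0 : R) < N%:R by near: N; exact: nbhs_infty_gtr.
apply: (@le_trans _ _ (`|M| * expR (- lam * N%:R))).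
  rewrite -ler_pdivrMr ?expR_gt0//; apply: (@le_trans _ _ M); last exact: ler_norm.
  by near: N.
rewrite -mulrA; apply: ler_wpM2l => //.
have lN : 0 <= lam * N%:R by rewrite mulr_ge0// ltW.
rewrite mulNr expRN powRN powR_mulrn; last exact: ltW.
have h := expR_ge1Dxn k lN.
rewrite -[leRHS]invrK lef_pV2 ?posrE ?expR_gt0 ?invr_gt0 ?mulr_gt0 ?invr_gt0 ?exprn_gt0//.
rewrite invfM invrK /F invf_div mulrAC -exprMn; lra.
Unshelve. all: by end_near. Qed.

Lemma quarter_asymp : a1 = 2 -> a2 = - 1 -> asymp p (fun N => N%:R `^ (- (1 / 4))).
Proof.
move=> -> ->; have [e [E [e0 [E0 H]]]] := persist_quarter tg gm.
have qE N : qroot N = N%:R `^ (1 / 4) :> R.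
  rewrite /qroot -!powR12_sqrt ?powR_ge0// -powRrM; congr (_ `^ _); lra.
split; [exists E|exists e^-1]; near=> N.
  have N0 : (0 < N)%N by near: N; exact: nbhs_infty_gt.
  by have /andP[_] := H N N0; rewrite powRN invrK -qE.
have N0 : (0 < N)%N by near: N; exact: nbhs_infty_gt.
have /andP[h _] := H N N0; rewrite powRN -qE -invfM mulrC lef_pV2 ?posrE//.
exact: lt_le_trans h.
Unshelve. all: by end_near. Qed.

Lemma half_of_expo : expo_le (1 / 2) p -> expo_ge (1 / 2) p ->
  exists e : nat -> R, e N @[N --> \oo] --> (0 : R) /\
    \forall N \near \oo, p N = N%:R `^ (- (1 / 2) + e N).
Proof.
move=> ple pge; exists (fun N => 1 / 2 + ln (p N) / ln N%:R); split; last first.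
  near=> N; have N1 : (1 : R) < N%:R by near: N; exact: nbhs_infty_gtr.
  have l0 : 0 < ln N%:R :> R by rewrite ln_gt0.
  rewrite addrA addNr add0r powR_expR ?(lt_trans _ N1)// divfK ?gt_eqF// lnK//.
  exact: persist_gt0.
apply/cvgrPdist_le => /= d d0.
have h1 := expo_le_near ple d0; have h2 := expo_ge_near pge d0.
near=> N; have N1 : (1 : R) < N%:R by near: N; exact: nbhs_infty_gtr.
have l0 : 0 < ln N%:R :> R by rewrite ln_gt0.
have N0 : (0 : R) < N%:R by rewrite (lt_trans _ N1).
have pp : 0 < p N by exact: persist_gt0.
have k1 : p N <= N%:R `^ (- (1 / 2) + d) by near: N.
have k2 : N%:R `^ (- (1 / 2) - d) <= p N by near: N.
have u1 : ln (p N) / ln N%:R <= - (1 / 2) + d.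
  rewrite ler_pdivrMr//; have := k1; rewrite -ler_ln ?posrE ?powR_gt0//.
  by rewrite powR_expR// expRK.
have u2 : - (1 / 2) - d <= ln (p N) / ln N%:R.
  rewrite ler_pdivlMr//; have := k2; rewrite -ler_ln ?posrE ?powR_gt0//.
  by rewrite powR_expR// expRK.
by rewrite sub0r normrN ler_norml; apply/andP; split; lra.
Unshelve. all: by end_near. Qed.

Lemma exponential_of_decay : exp_decay p ->
  exists lam : R, 0 < lam /\ precsim p (fun N => expR (- lam * N%:R)).
Proof.
move=> [C [lam [C0 l0 H]]]; exists lam; split=> //; exists C; near=> N.
by rewrite ler_pdivrMr ?expR_gt0.
Unshelve. all: by end_near. Qed.

Let L1 := exists pinf : R, 0 < pinf /\ p N @[N --> \oo] --> pinf.
Let L2 := exists c : R, 0 < c /\ p N / (c * N%:R^-1) @[N --> \oo] --> (1 : R).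
Let L3 := asymp p (fun N => N%:R `^ (- (1 / 4))).
Let L4 := exists e : nat -> R, e N @[N --> \oo] --> (0 : R) /\
  \forall N \near \oo, p N = N%:R `^ (- (1 / 2) + e N).
Let L5 := exists lam : R, 0 < lam /\ precsim p (fun N => expR (- lam * N%:R)).

Let R2L2 : a1 = 0 /\ a2 = 1 -> L2.
Proof. by move=> [e1 e2]; rewrite /L2 e1 e2; exact: (neg01_cvg tg gm). Qed.

Let R3L3 : a1 = 2 /\ a2 = - 1 -> L3.
Proof. by move=> [e1 e2]; exact: quarter_asymp. Qed.

Let R4L4 : regionP a1 a2 /\ `|a2| < 1 -> L4.
Proof.
move=> [[s _] a21].
have [] := unit_root_expo tg gm (_ : `|- a2| < 1); first by rewrite normrN.
have -> : 1 + - a2 = a1 by rewrite -s; ring.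
have -> : - (1 * - a2) = a2 by ring.
exact: half_of_expo.
Qed.

Let R5L5 : regionE a1 a2 -> L5.
Proof. by move/regionE_decay; exact: exponential_of_decay. Qed.

Let cover : [\/ regionC a1 a2, a1 = 0 /\ a2 = 1, a1 = 2 /\ a2 = - 1 | regionP a1 a2 /\ `|a2| < 1] \/ regionE a1 a2.
Proof.
have [C|nC] := pselect (regionC a1 a2); first by left; constructor 1.
have [[s /andP[h1 h2]]|nP] := pselect (regionP a1 a2); last by right.
left; have [e|n1] := eqVneq a2 1; first by constructor 2; split=> //; move: s; rewrite e; lra.
have [e|n2] := eqVneq a2 (- 1); first by constructor 3; split=> //; move: s; rewrite e; lra.
constructor 4; split; first by split=> //; apply/andP.
by rewrite ltr_norml !lt_neqAle h1 h2 n1 eq_sym n2.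
Qed.

Let poly_not_exp th : expo_ge th p -> ~ L5.
Proof.
move=> pge /expo_of_exponential/(_ (Num.truncn th)) ple.
by have := expo_uniq ple pge; rewrite leNgt truncnS_gt.
Qed.

Let expo_clash th th' : expo_le th p /\ expo_ge th p -> expo_le th' p /\ expo_ge th' p -> th = th'.
Proof. by move=> [a b] [c d]; apply/eqP; rewrite eq_le (expo_uniq a d) (expo_uniq c b). Qed.

Lemma persistence_regimes :
  (L1 <-> regionC a1 a2) /\ (L2 <-> (a1 = 0 /\ a2 = 1)) /\ (L3 <-> (a1 = 2 /\ a2 = - 1)) /\
  (L4 <-> (regionP a1 a2 /\ `|a2| < 1)) /\ (L5 <-> regionE a1 a2).
Proof.
have Q1 := expo_of_limit; have Q2 := expo_of_inverse; have Q3 := expo_of_quarter.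
have Q4 := expo_of_half; have R1L1 := limit_of_regionC.
split; [|split; [|split; [|split]]]; split=> //.
- move=> /Q1 H; case: cover => [[//|/R2L2/Q2 H'|/R3L3/Q3 H'|/R4L4/Q4 H']|/R5L5 H'].
  1-3: by have := expo_clash H H'; lra.
  by case: (poly_not_exp H.2 H').
- move=> /Q2 H; case: cover => [[/R1L1/Q1 H'|//|/R3L3/Q3 H'|/R4L4/Q4 H']|/R5L5 H'].
  1-3: by have := expo_clash H H'; lra.
  by case: (poly_not_exp H.2 H').
- move=> /Q3 H; case: cover => [[/R1L1/Q1 H'|/R2L2/Q2 H'|//|/R4L4/Q4 H']|/R5L5 H'].
  1-3: by have := expo_clash H H'; lra.
  by case: (poly_not_exp H.2 H').
- move=> /Q4 H; case: cover => [[/R1L1/Q1 H'|/R2L2/Q2 H'|/R3L3/Q3 H'|//]|/R5L5 H'].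
  1-3: by have := expo_clash H H'; lra.
  by case: (poly_not_exp H.2 H').
- move=> H; case: cover => [[/R1L1/Q1 H'|/R2L2/Q2 H'|/R3L3/Q3 H'|/R4L4/Q4 H']|//].
  all: by case: (poly_not_exp H'.2 H).
Qed.

End exponents.

End regions.

Theorem theorem1p4 (R : realType) (d : measure_display) (T : measurableType d)
    (P : probability T R) (Y : nat -> {RV P >-> R}) (sigma : R) (a1 a2 : R) :
  0 < sigma ->
  indep_pos Y ->
  gaussian_pos Y sigma ->
  let p := persist_prob P a1 a2 (fun n => Y n : T -> R) in
  ((exists pinf : R, 0 < pinf /\ p N @[N --> \oo] --> pinf)
     <-> regionC a1 a2)
  /\ ((exists c : R, 0 < c /\ p N / (c * N%:R^-1) @[N --> \oo] --> (1 : R))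
     <-> (a1 = 0 /\ a2 = 1))
  /\ (asymp p (fun N => N%:R `^ (- (1 / 4))) <-> (a1 = 2 /\ a2 = -1))
  /\ ((exists e : nat -> R, e N @[N --> \oo] --> (0 : R) /\
         \forall N \near \oo, p N = N%:R `^ (- (1 / 2) + e N))
     <-> (regionP a1 a2 /\ `|a2| < 1))
  /\ ((exists lam : R, 0 < lam /\ precsim p (fun N => expR (- lam * N%:R)))
     <-> regionE a1 a2).
Proof.
move=> s0 indY gaussY p.
have [|m [gm mE]] := seq_law (g := normal_law sigma) indY.
  by move=> n n0 A mA; rewrite gaussY// normal_lawE.
have pE : p = fun N => pr m (neg a1 a2 N).
  apply/funext => N; rewrite /p /persist_prob /pr -mE; last exact: measurable_negset.
  congr (fine (P _)); apply/seteqP.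
  by split=> w H n /H; rewrite ar2E.
rewrite pE; exact: (persistence_regimes (normal_law_tame s0) gm).
Qed.
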